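(* Let $n\ge2$ and $b>0$. Suppose that $u\in{}_0H^1(\Omega;\mathbb{R}^n)$ and define $g=\operatorname{div}u\in L^2(\Omega)$ and $h=u_n|_{\Sigma_b}\in H^{1/2}(\Sigma_b)$. Then $$h-\int_0^bg(\cdot,x_n)\,dx_n\in\dot H^{-1}(\mathbb{R}^{n-1})$$ and $$\Big[h-\int_0^bg(\cdot,x_n)\,dx_n\Big]_{\dot H^{-1}}\le2\pi\sqrt b\,\|u\|_{L^2}.$$
   Context: $\Omega=\mathbb{R}^{n-1}\times(0,b)$, $\Sigma_b=\{x_n=b\}$ (identified with $\mathbb{R}^{n-1}$), $\Sigma_0=\{x_n=0\}$. ${}_0H^1(\Omega;\mathbb{R}^n)=\{u\in H^1(\Omega;\mathbb{R}^n):u=0\text{ on }\Sigma_0\}$ (trace sense). With $\hat f(\xi)=\int_{\mathbb{R}^d}f(x)e^{-2\pi ix\cdot\xi}dx$, $\dot H^{-1}(\mathbb{R}^d)$ is the space of real-valued tempered distributions $f$ with $\hat f\in L^1_{loc}(\mathbb{R}^d)$ and $[f]_{\dot H^{-1}}^2=\int_{\mathbb{R}^d}|\xi|^{-2}|\hat f(\xi)|^2d\xi<\infty$. *)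

(* Defs.v *)
From HB Require Import structures.
From mathcomp Require Import all_boot all_order all_algebra.
From mathcomp Require Import complex.
From mathcomp Require Import all_classical all_reals all_analysis.

Set Implicit Arguments.
Unset Strict Implicit.
Unset Printing Implicit Defensive.
Import Order.TTheory GRing.Theory Num.Theory.
Import numFieldNormedType.Exports.
Import ComplexField.Normc.

Local Open Scope classical_set_scope.
Local Open Scope ring_scope.

(* R^n is 'rV[R]_n.  The ambient norm `|x| of 'rV[R]_n in the library is the
   sup norm, hence the explicit Euclidean norm below. *)
Definition dotp (R : realType) (n : nat) (x y : 'rV[R]_n) : R :=
  \sum_(i < n) x 0 i * y 0 i.

Definition enorm (R : realType) (n : nat) (x : 'rV[R]_n) : R :=
  Num.sqrt (dotp x x).

(* The point (x', t) of R^{d+1} = R^d x R. *)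
Definition join_pt (R : realType) (d : nat) (p : 'rV[R]_d * R) : 'rV[R]_d.+1 :=
  \row_(i < d.+1) if unlift ord_max i is Some j then p.1 0 j else p.2.

Definition measure_rV_display : measure_display.
Proof. exact: (measure_tuple_display (default_measure_display)). Qed.

(* 'rV[R]_n carries the sigma-algebra generated by the coordinates (the same
   construction as the library's one on n.-tuple R), which is the Borel one. *)
Section measurable_rV.
Variables (R : realType) (n : nat).

Let coors : 'I_n -> 'rV[R]_n -> R := fun i x => x 0 i.

Let rV_set0 : g_sigma_preimage coors set0.
Proof. exact: sigma_algebra0. Qed.

Let rV_setC A : g_sigma_preimage coors A -> g_sigma_preimage coors (~` A).
Proof. exact: sigma_algebraC. Qed.

Let rV_bigcup (F : (set 'rV[R]_n)^nat) :
  (forall i, g_sigma_preimage coors (F i)) ->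
  g_sigma_preimage coors (\bigcup_i (F i)).
Proof. exact: sigma_algebra_bigcup. Qed.

HB.instance Definition _ := @isMeasurable.Build measure_rV_display
  'rV[R]_n (g_sigma_preimage coors) rV_set0 rV_setC rV_bigcup.

End measurable_rV.

Lemma measurable_coord (R : realType) (n : nat) (i : 'I_n) :
  measurable_fun [set: 'rV[R]_n] (fun x : 'rV[R]_n => x 0 i).
Proof.
move=> _ Y mY; rewrite setTI; apply: sub_sigma_algebra => /=.
rewrite -bigcup_seq/=; exists i => /=; first by rewrite mem_index_enum.
by exists Y => //; rewrite setTI.
Qed.

Lemma measurable_rVP d (T : measurableType d) (R : realType) (n : nat)
    (f : T -> 'rV[R]_n) :
  (forall i, measurable_fun [set: T] (fun t => f t 0 i)) ->
  measurable_fun [set: T] f.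
Proof.
move=> mf _ A mA; rewrite setTI; move: A mA.
pose G := [set A : set 'rV[R]_n | measurable (f @^-1` A)].
suff : g_sigma_preimage (fun (i : 'I_n) (x : 'rV[R]_n) => x 0 i) `<=` G by [].
apply: smallest_sub.
  split; rewrite /G /=.
  - by rewrite preimage_set0.
  - move=> A mA; rewrite setTD preimage_setC; exact: measurableC.
  - by move=> F mF; rewrite preimage_bigcup; exact: bigcup_measurable.
elim/big_ind : _ => [//|X Y XG YG A [/XG|/YG]//|i _ _ [B mB <-]].
by rewrite /G /= setTI; have := mf i measurableT B mB; rewrite setTI.
Qed.

Lemma measurable_join_pt (R : realType) (d : nat) :
  measurable_fun [set: 'rV[R]_d * R] (@join_pt R d).
Proof.
apply: measurable_rVP => i; rewrite /join_pt.
case: (unliftP ord_max i) => [j ->|->].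
- rewrite [X in measurable_fun _ X](_ : _ = (fun x : 'rV[R]_d => x 0 j) \o fst).
    by apply: measurableT_comp; [exact: measurable_coord|].
  by apply/funext => p /=; rewrite mxE liftK.
- rewrite [X in measurable_fun _ X](_ : _ = snd) //.
  by apply/funext => p /=; rewrite mxE unlift_none.
Qed.

(* Lebesgue measure on R^n, as the iterated product of lebesgue_measure. *)
Section lebesgue_rV.
Variable R : realType.

Definition leb_step (d : nat) (m : {measure set 'rV[R]_d -> \bar R}) :
    set 'rV[R]_d.+1 -> \bar R :=
  pushforward (m \x (@lebesgue_measure R))%E (@join_pt R d).

HB.instance Definition _ (d : nat) (m : {measure set 'rV[R]_d -> \bar R}) :=
  Measure.copy (leb_step m)
    (measure_function_pushforward__canonical__measure_function_Measure
       (m \x (@lebesgue_measure R))%E (@measurable_join_pt R d)).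

Fixpoint leb (n : nat) : {measure set 'rV[R]_n -> \bar R} :=
  match n with
  | 0 => dirac (0 : 'rV[R]_0)
  | d.+1 => leb_step (leb d)
  end.

End lebesgue_rV.
Arguments leb {R n}.

Section calculus.
Variables (R : realType) (n : nat).
Implicit Types (f g v : 'rV[R]_n -> R) (D : set 'rV[R]_n) (phi : 'rV[R]_n -> R).

Definition partial (i : 'I_n) f : 'rV[R]_n -> R :=
  fun x => derive f x (delta_mx 0 i).

Definition partials (s : seq 'I_n) f : 'rV[R]_n -> R := foldr partial f s.

(* C^infinity: all iterated partial derivatives are (Frechet) differentiable. *)
Definition smooth f : Prop :=
  forall (s : seq 'I_n) (x : 'rV[R]_n), differentiable (partials s f) x.

(* C_c^infinity(D) *)
Definition test_fun D phi : Prop :=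
  smooth phi /\
  exists K : set 'rV[R]_n,
    [/\ compact K, K `<=` D & forall x, ~ K x -> phi x = 0].

Definition L2norm D f : \bar R := 'N[leb]_2%:E [EFin \o (f \_ D)].

Definition L2 D f : Prop := measurable_fun D f /\ (L2norm D f < +oo)%E.

Definition is_weak_partial D (i : 'I_n) f v : Prop :=
  forall phi, test_fun D phi ->
    \int[leb]_(x in D) (f x * partial i phi x) =
    - \int[leb]_(x in D) (v x * phi x).

Definition H1 D f : Prop :=
  L2 D f /\ forall i : 'I_n, exists v, L2 D v /\ is_weak_partial D i f v.

(* A representative of the weak derivative, determined a.e. on D for D open
   and f in H^1(D); the value off D is irrelevant. *)
Definition weak_partial D (i : 'I_n) f : 'rV[R]_n -> R :=
  xget (cst 0) [set v | L2 D v /\ is_weak_partial D i f v].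

Definition H1norm D f : \bar R :=
  ((\int[leb]_(x in D)
     (f x ^+ 2 + \sum_(i < n) weak_partial D i f x ^+ 2)%:E) `^ 2^-1)%E.

Definition weak_div D (u : 'rV[R]_n -> 'rV[R]_n) : 'rV[R]_n -> R :=
  fun x => \sum_(i < n) weak_partial D i (fun y => u y 0 i) x.

End calculus.

Section strip.
Variables (R : realType) (d : nat).
Implicit Types (b c : R) (f : 'rV[R]_d.+1 -> R) (h : 'rV[R]_d -> R).

Definition strip b : set 'rV[R]_d.+1 := [set x | 0 < x 0 ord_max < b].

(* h is the trace of f in H^1(strip b) on {x_n = c}, c in {0, b}: the trace
   operator is the extension by continuity, from H^1(strip b) to L^2(R^d), of
   the restriction to {x_n = c}, initially defined on C_c^infinity(R^n). *)
Definition is_trace b c f h : Prop :=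
  [/\ H1 (strip b) f, L2 setT h &
  exists phi : nat -> 'rV[R]_d.+1 -> R,
    [/\ forall k, test_fun setT (phi k),
        H1norm (strip b) (phi k \- f) @[k --> \oo] --> 0%E &
        L2norm setT ((fun x' => phi k (join_pt (x', c))) \- h)
          @[k --> \oo] --> 0%E]].

Definition trace b c f : 'rV[R]_d -> R := xget (cst 0) [set h | is_trace b c f h].

(* The space of the u in H^1(strip b; R^n) with u = 0 on {x_n = 0}. *)
Definition H1_0 b (u : 'rV[R]_d.+1 -> 'rV[R]_d.+1) : Prop :=
  forall i : 'I_d.+1,
    H1 (strip b) (fun x => u x 0 i) /\
    is_trace b 0 (fun x => u x 0 i) (cst 0).

End strip.

Section distributions.
Variables (R : realType) (n : nat).
Local Open Scope complex_scope.
Implicit Types (phi psi F : 'rV[R]_n -> R[i]) (T : ('rV[R]_n -> R[i]) -> R[i]).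

Definition cint F : R[i] :=
  (\int[leb]_x complex.Re (F x)) +i* (\int[leb]_x complex.Im (F x)).

Definition cpartials (s : seq 'I_n) phi : 'rV[R]_n -> R[i] := fun x =>
  partials s (@complex.Re R \o phi) x +i* partials s (@complex.Im R \o phi) x.

Definition schwartz_values (N : nat) phi : set R :=
  [set r | exists (s : seq 'I_n) (x : 'rV[R]_n), (size s <= N)%N /\
     r = (1 + enorm x) ^+ N * normc (cpartials s phi x)].

Definition schwartz phi : Prop :=
  [/\ smooth (@complex.Re R \o phi), smooth (@complex.Im R \o phi) &
      forall N : nat, has_ubound (schwartz_values N phi)].

Definition schwartz_norm (N : nat) phi : R := sup (schwartz_values N phi).

(* Tempered distributions: continuous linear functionals on the Schwartz
   space.  The values of T off the Schwartz space play no role. *)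
Definition tempered T : Prop :=
  (forall (a : R[i]) phi psi, schwartz phi -> schwartz psi ->
     T (fun x => a * phi x + psi x) = a * T phi + T psi) /\
  exists (N : nat) (C : R), forall phi, schwartz phi ->
     normc (T phi) <= C * schwartz_norm N phi.

Definition real_valued T : Prop :=
  forall phi, schwartz phi -> (forall x, complex.Im (phi x) = 0) ->
    complex.Im (T phi) = 0.

(* The distribution associated with a real function f. *)
Definition regular_distr (f : 'rV[R]_n -> R) : ('rV[R]_n -> R[i]) -> R[i] :=
  fun phi => cint (fun x => (f x)%:C * phi x).

Definition cexpi (t : R) : R[i] := cos t +i* sin t.

Definition fourier phi : 'rV[R]_n -> R[i] := fun xi =>
  cint (fun x => phi x * cexpi (- (2 * pi * dotp x xi))).

Definition fourier_distr T : ('rV[R]_n -> R[i]) -> R[i] :=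
  fun phi => T (fourier phi).

Definition L1loc F : Prop :=
  [/\ measurable_fun setT (@complex.Re R \o F),
      measurable_fun setT (@complex.Im R \o F) &
      forall K : set 'rV[R]_n, compact K ->
        (\int[leb]_(x in K) (normc (F x))%:E < +oo)%E].

(* F in L^1_loc is the Fourier transform of the tempered distribution T; it
   suffices to test on C_c^infinity, where the integral surely converges. *)
Definition is_fourier T F : Prop :=
  L1loc F /\
  forall phi, test_fun setT (@complex.Re R \o phi) ->
              test_fun setT (@complex.Im R \o phi) ->
    fourier_distr T phi = cint (fun x => F x * phi x).

Definition fourier_fun T : 'rV[R]_n -> R[i] := xget (cst 0) [set F | is_fourier T F].

(* For n >= 1 the junk value 0^-1 = 0 of the weight at xi = 0 is harmless. *)
Definition Hdotm1_norm T : \bar R :=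
  ((\int[leb]_xi (enorm xi ^- 2 * normc (fourier_fun T xi) ^+ 2)%:E) `^ 2^-1)%E.

Definition Hdotm1 T : Prop :=
  [/\ tempered T, real_valued T, exists F, is_fourier T F &
      (Hdotm1_norm T < +oo)%E].

End distributions.

(* Main.v *)
(* Let U_j(x') be the integral of u_j(x', .) over (0, b), for j < n.  Since u
   vanishes at the bottom, h is the integral of the derivative of u_n in x_n, so
   h minus the integral of div u is - sum_(j < n) d_j U_j, with Fourier transform
   - 2 pi i sum_j xi_j (U_j)^.  Cauchy-Schwarz over j bounds |xi|^-2 times its
   squared modulus by 4 pi^2 sum_j |(U_j)^|^2, Plancherel's inequality bounds
   the integral of the latter by that of sum_j |U_j|^2, and Cauchy-Schwarz in x_n
   gives |U_j|^2 <= b * (integral of |u_j(x', .)|^2).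

   Plancherel's inequality follows from inserting the weight prod_i e^(-e |xi_i|),
   whose transform is a product of Cauchy kernels, of integral 1, and letting
   e tend to 0.  Weak derivatives, traces and Fourier transforms are well defined
   because a function that integrates to 0 against every test function is 0 a.e.;
   the test functions come from e^(-c/t). *)
Require Import Defs.
From HB Require Import structures.
From mathcomp Require Import all_boot all_order all_algebra.
From mathcomp Require Import complex.
From mathcomp Require Import all_classical all_reals all_analysis.
From mathcomp Require Import measurable_realfun ring lra.

Set Implicit Arguments.
Unset Strict Implicit.
Unset Printing Implicit Defensive.
Import Order.TTheory GRing.Theory Num.Theory.
Import numFieldNormedType.Exports.
Import ComplexField.Normc.
Local Open Scope classical_set_scope.
Local Open Scope ring_scope.

(** The $U_j$ are only square integrable, so their transforms are not given by convergent integrals.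
    Each transform is replaced by a pair of real functions, a cosine and a sine part, characterised
    by their pairings with test functions and obtained as $L^2$ limits along truncations; this
    matches the definition of [is_fourier], which also tests by duality. The other obstacle is that
    weak derivatives, traces and [fourier_fun] are chosen representatives, and that [u] is merely
    $H^1$. The test functions that the definition of the trace supplies converge to a component of
    [u] in $H^1$, and vertical integration is bounded on $L^2$ of the strip. So every identity is
    first checked on these test functions, by the fundamental theorem of calculus vertically and by
    integration by parts horizontally, and then passed to the limit. Representatives are compared
    only almost everywhere, which suffices under integrals. The $2\pi$ of the bound comes from
    differentiating $e^{-2\pi i x\cdot\xi}$, the $\sqrt b$ from the length of the vertical
    segments. *)

Lemma join_pt_max (R : realType) (d : nat) (p : 'rV[R]_d * R) :
  join_pt p 0 ord_max = p.2.
Proof. by rewrite mxE unlift_none. Qed.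

Lemma join_pt_lift (R : realType) (d : nat) (p : 'rV[R]_d * R) (j : 'I_d) :
  join_pt p 0 (lift ord_max j) = p.1 0 j.
Proof. by rewrite mxE liftK. Qed.

Lemma ord_maxP (d : nat) (P : 'I_d.+1 -> Prop) :
  P ord_max -> (forall j : 'I_d, P (lift ord_max j)) -> forall i, P i.
Proof. by move=> Pm Pl i; case: (unliftP ord_max i) => [j ->|->]. Qed.

Lemma sum_lift_max (R : nmodType) (d : nat) (F : 'I_d.+1 -> R) :
  \sum_i F i = \sum_(j < d) F (lift ord_max j) + F ord_max.
Proof.
rewrite big_ord_recr /=; congr (_ + _); apply: eq_bigr => j _; congr F.
by apply/val_inj; rewrite /= /bump leqNgt ltn_ord.
Qed.

Lemma prod_lift_max (R : pzSemiRingType) (d : nat) (F : 'I_d.+1 -> R) :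
  \prod_i F i = (\prod_(j < d) F (lift ord_max j)) * F ord_max.
Proof.
rewrite big_ord_recr /=; congr (_ * _); apply: eq_bigr => j _; congr F.
by apply/val_inj; rewrite /= /bump leqNgt ltn_ord.
Qed.

(** * Lebesgue measure on R^n *)

Section boxes.
Variables (R : realType) (n : nat).

Definition obox (a c : 'rV[R]_n) : set 'rV[R]_n :=
  [set x | forall i, a 0 i < x 0 i < c 0 i].

Definition cube (M : R) : set 'rV[R]_n := obox (const_mx (- M)) (const_mx M).

Lemma measurable_coord_preim (i : 'I_n) (A : set R) : measurable A ->
  measurable [set x : 'rV[R]_n | A (x 0 i)].
Proof.
by move=> mA; rewrite -[X in measurable X]setTI;
   exact: (@measurable_coord R n i measurableT A mA).
Qed.

Lemma measurable_obox (a c : 'rV[R]_n) : measurable (obox a c).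
Proof.
rewrite (_ : obox a c =
  \bigcap_(i in [set: 'I_n]) [set x : 'rV[R]_n | `]a 0 i, c 0 i[%classic (x 0 i)]).
  apply: fin_bigcap_measurable => // i _.
  by apply: (@measurable_coord_preim i `]a 0 i, c 0 i[%classic).
apply/seteqP; split => x /=.
  by move=> h i _; rewrite /= in_itv; exact: h.
by move=> h i; have := h i I; rewrite /= in_itv.
Qed.

Lemma cubeP M (x : 'rV[R]_n) : cube M x <-> forall i, `|x 0 i| < M.
Proof.
by split => h i; have := h i; rewrite !mxE ltr_norml.
Qed.

Lemma bigcup_cube : \bigcup_k cube k%:R = [set: 'rV[R]_n].
Proof.
apply/seteqP; split => // x _.
have [k hk] : exists k : nat, forall i, `|x 0 i| < k%:R.
  exists (Num.truncn (\sum_i `|x 0 i|)).+1 => i.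
  apply: le_lt_trans (truncnS_gt _).
  by rewrite (bigD1 i) //= lerDl sumr_ge0.
by exists k => //; apply/cubeP.
Qed.

End boxes.
Arguments cube {R n} M.

Section leb_product.
Variable R : realType.
Local Notation mu := (@lebesgue_measure R).

(** Through [join_pt] a box is the product of a lower-dimensional box and an interval, so the
    measure multiplies; in dimension 0 it is that of a Dirac mass. *)
Lemma leb_obox_lty (n : nat) (a c : 'rV[R]_n) : (leb (obox a c) < +oo)%E.
Proof.
elim: n a c => [|n IH] a c.
  by rewrite /= /dirac indicE; case: (_ \in _); rewrite ltry.
rewrite /= /leb_step /pushforward.
pose a' := \row_j a 0 (lift ord_max j); pose c' := \row_j c 0 (lift ord_max j).
rewrite (_ : _ @^-1` _ = obox a' c' `*` `]a 0 ord_max, c 0 ord_max[); last first.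
  apply/seteqP; split => -[x t] /=.
    move=> h; split.
      by move=> i; have := h (lift ord_max i); rewrite !mxE liftK.
    by have := h ord_max; rewrite join_pt_max in_itv.
  move=> [h1]; rewrite /= in_itv /= => h2; elim/ord_maxP.
    by rewrite join_pt_max.
  by move=> j; rewrite join_pt_lift; have := h1 j; rewrite !mxE.
rewrite product_measure1E; [|exact: measurable_obox|exact: measurable_itv].
rewrite lte_mul_pinfty//.
- by rewrite ge0_fin_numE//; exact: IH.
- have := @lebesgue_measure_itv R `]a 0 ord_max, c 0 ord_max[ => /= ->.
  by case: ifP => _; rewrite -?EFinD ltry.
Qed.

Lemma leb_sigma_finite (n : nat) : sigma_finite setT (@leb R n).
Proof.
exists (fun k => cube k%:R); first by rewrite bigcup_cube.
by move=> k; split; [exact: measurable_obox|exact: leb_obox_lty].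
Qed.

(* [leb n] itself has a projection as head symbol, which cannot carry the
   sigma-finiteness instance needed by Fubini's theorem. *)
Definition sleb (n : nat) : set 'rV[R]_n -> \bar R := leb.

HB.instance Definition _ (n : nat) := Measure.copy (@sleb n) (@leb R n).

HB.instance Definition _ (n : nat) :=
  Measure_isSigmaFinite.Build _ _ _ (@sleb n) (@leb_sigma_finite n).

Lemma leb_tonelli1 (d : nat) (f : 'rV[R]_d.+1 -> \bar R) :
  measurable_fun setT f -> (forall x, (0 <= f x)%E) ->
  (\int[leb]_x f x = \int[leb]_x \int[mu]_t f (join_pt (x, t)))%E.
Proof.
move=> mf f0 /=; rewrite ge0_integral_pushforward//; last first.
  exact: measurable_join_pt.
rewrite preimage_setT.
have mfj : measurable_fun setT (f \o @join_pt R d).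
  by apply: measurableT_comp => //; exact: measurable_join_pt.
exact: (@fubini_tonelli1 _ _ _ _ _ (@sleb d) mu _ mfj (fun p => f0 _)).
Qed.

Lemma leb_integrable_join (d : nat) (f : 'rV[R]_d.+1 -> \bar R) :
  leb.-integrable setT f ->
  (@sleb d \x mu)%E.-integrable setT (f \o @join_pt R d).
Proof.
move=> /integrableP[mf fi]; apply/integrableP; split.
  by apply: measurableT_comp => //; exact: measurable_join_pt.
apply: le_lt_trans fi; rewrite /= [X in (_ <= X)%E]ge0_integral_pushforward//.
- exact: measurable_join_pt.
- exact: measurableT_comp.
Qed.

Lemma leb_integral_join (d : nat) (f : 'rV[R]_d.+1 -> \bar R) :
  leb.-integrable setT f ->
  (\int[leb]_x f x = \int[@sleb d \x mu]_p f (join_pt p))%E.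
Proof.
move=> fi; have [mf _] := integrableP _ _ _ fi.
rewrite /= integral_pushforward//; first exact: measurable_join_pt.
exact: leb_integrable_join.
Qed.

End leb_product.
Arguments sleb {R n}.

Section rV_topology.
Variables (R : realType) (n : nat).

(** The sigma-algebra is generated by coordinates, so openness is reduced to countably many boxes:
    every point of [U] lies in a box with rational centre and half-side [1 / (k + 1)] that is
    contained in [U]. *)
Lemma open_measurable_rV (U : set 'rV[R]_n) : open U -> measurable U.
Proof.
move=> oU.
pose e (k : nat) : R := k.+1%:R^-1.
pose B (qk : 'rV[rat]_n * nat) : set 'rV[R]_n :=
  obox (map_mx ratr qk.1 - const_mx (e qk.2)) (map_mx ratr qk.1 + const_mx (e qk.2)).
rewrite (_ : U = \bigcup_qk [set x | B qk x /\ B qk `<=` U]).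
  apply: countable_bigcupT_measurable => // qk.
  have [BU|nBU] := pselect (B qk `<=` U).
    rewrite (_ : [set _ | _] = B qk); first exact: measurable_obox.
    by apply/seteqP; split => x // [].
  rewrite (_ : [set _ | _] = set0) //.
  by apply/seteqP; split => x // [].
apply/seteqP; split => [x Ux|x [qk _ [Bx]]]; last exact.
have /nbhs_ballP[r /= r0 rU] : nbhs x U by exact: open_nbhs_nbhs.
(* The centre [q] will be within [e k] of [x] and the box has half-side [e k], so its points stay
   within [2 * e k < r] of [x]. *)
pose k := Num.truncn (2 / r).
have e0 : 0 < e k by rewrite invr_gt0.
have er : e k * 2 < r.
  by rewrite /e mulrC ltr_pdivrMr// mulrC -ltr_pdivrMr//; exact: truncnS_gt.
have [q hq] : {q : 'I_n -> rat & forall i, ratr (q i) \in `]x 0 i - e k, x 0 i + e k[}.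
  by apply: (@choice _ _ (fun i q => ratr q \in `]x 0 i - e k, x 0 i + e k[)) => i; apply: rat_in_itvoo; lra.
exists (\row_i q i, k) => //; split.
  move=> i; have := hq i; rewrite !mxE in_itv /= => /andP[h1 h2].
  by apply/andP; split; lra.
move=> y By; apply: rU; split => // i' i.
rewrite (ord1 i'); have := By i; have := hq i.
rewrite !mxE in_itv /= => /andP[h1 h2] /andP[h3 h4].
rewrite /ball /= ltr_norml; apply/andP; split; lra.
Qed.

Lemma continuous_measurable_rV (f : 'rV[R]_n -> R) :
  continuous f -> measurable_fun setT f.
Proof.
move=> cf; apply: (measurability _ (RGenOInfty.measurableE R)) => _ [_ [r ->] <-].
rewrite setTI; apply: open_measurable_rV.
by apply: open_comp => [x _|]; [exact: cf|exact: interval_open].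
Qed.

Lemma compact_measurable_rV (K : set 'rV[R]_n) : compact K -> measurable K.
Proof.
move=> cK; rewrite -[K]setCK; apply: measurableC; apply: open_measurable_rV.
by rewrite openC; apply: compact_closed => //; exact: norm_hausdorff.
Qed.

Lemma rV_norm_lt (x : 'rV[R]_n) (e : R) : 0 < e ->
  (`|x| < e) = [forall i, `|x 0 i| < e].
Proof.
move=> e0; have /(congr1 (fun B => B 0 e x)) := @mx_norm_ball R 1 n.
rewrite /= -[X in _ = X]/((`|0 - x| < e) : Prop) sub0r normrN => E.
apply/idP/idP => [|/forallP h].
  rewrite -E => -[_ h]; apply/forallP => i; have := h 0 i.
  by rewrite /ball /= mxE sub0r normrN.
rewrite -E; split => // i' i; rewrite (ord1 i') /ball /= mxE sub0r normrN.
exact: h.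
Qed.

Lemma compact_sub_cube (K : set 'rV[R]_n) : compact K ->
  exists2 M : R, 0 < M & K `<=` cube M.
Proof.
move=> /compact_bounded [M [_ hM]].
have M0 : 0 < `|M| + 2 by rewrite ltr_wpDl.
exists (`|M| + 2) => // x Kx; apply/cubeP.
have /(_ (`|M| + 1)) := hM.
rewrite (le_lt_trans (ler_norm M)) ?ltrDl// => /(_ isT x Kx) /= h.
have : `|x| < `|M| + 2 by apply: (le_lt_trans h); lra.
by rewrite rV_norm_lt// => /forallP.
Qed.

End rV_topology.

Lemma cvg0_le (R : realType) (f g : nat -> R) : (forall k, 0 <= f k <= g k) ->
  g k @[k --> \oo] --> 0 -> f k @[k --> \oo] --> 0.
Proof.
move=> fg gc; apply: (@squeeze_cvgr _ _ _ _ (fun=> 0) g) gc; last exact: cvg_cst.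
by apply: nearW => k; exact: fg.
Qed.

Lemma cvg0_lin (R : realType) (c e : R) (f g : nat -> R) : f k @[k --> \oo] --> 0 ->
  g k @[k --> \oo] --> 0 -> c * f k + e * g k @[k --> \oo] --> 0.
Proof.
move=> f0 g0; have h := cvgD (cvgM (cvg_cst c) f0) (cvgM (cvg_cst e) g0).
by rewrite !mulr0 addr0 in h; exact: h.
Qed.

(** * Integrable and square integrable functions *)

Section real_integrals.
Context (disp : measure_display) (T : measurableType disp) (R : realType).
Variable mu : {measure set T -> \bar R}.
Implicit Types f g h : T -> R.
Local Notation integ f := (mu.-integrable setT (EFin \o f)).

Lemma integ_measurable f : integ f -> measurable_fun setT f.
Proof. by move=> /integrableP[/measurable_EFinP]. Qed.

Lemma integ_le f g : measurable_fun setT f -> (forall x, `|f x| <= g x) ->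
  integ g -> integ f.
Proof.
move=> mf fg; apply: le_integrable => //; first exact/measurable_EFinP.
by move=> x _ /=; rewrite lee_fin (le_trans (fg x))// ler_norm.
Qed.

Lemma integ_lty f : measurable_fun setT f -> (forall x, 0 <= f x) ->
  (\int[mu]_x (f x)%:E < +oo)%E -> integ f.
Proof.
move=> mf f0 fi; apply/integrableP; split; first exact/measurable_EFinP.
by under eq_integral do rewrite /= ger0_norm//.
Qed.

Lemma integD f g : integ f -> integ g -> integ (fun x => f x + g x).
Proof. by move=> fi gi; have := integrableD measurableT fi gi; apply: eq_integrable. Qed.

Lemma integB f g : integ f -> integ g -> integ (fun x => f x - g x).
Proof. by move=> fi gi; have := integrableB measurableT fi gi; apply: eq_integrable. Qed.

Lemma integN f : integ f -> integ (fun x => - f x).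
Proof. by move=> fi; have := integrableN fi; apply: eq_integrable. Qed.

Lemma integZ (k : R) f : integ f -> integ (fun x => k * f x).
Proof. by move=> fi; have := integrableZl measurableT k fi; apply: eq_integrable. Qed.

Lemma integ_abs f : integ f -> integ (fun x => `|f x|).
Proof. by move=> fi; have := integrable_abse fi; apply: eq_integrable. Qed.

Lemma integ_mulb (M : R) f h : integ f -> measurable_fun setT h ->
  (forall x, `|h x| <= M) -> integ (fun x => f x * h x).
Proof.
move=> fi mh hM; apply: integ_le (integZ M (integ_abs fi)).
  by apply: measurable_funM => //; exact: integ_measurable fi.
by move=> x; rewrite normrM mulrC ler_wpM2r.
Qed.

Lemma integ0 : integ (fun=> 0).
Proof. exact: integrable0. Qed.

Lemma integ_sum (I : Type) (s : seq I) (F : I -> T -> R) :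
  (forall i, integ (F i)) -> integ (fun x => \sum_(i <- s) F i x).
Proof.
move=> Fi; elim: s => [|i s IH].
  by under eq_fun do rewrite big_nil; exact: integ0.
by under eq_fun do rewrite big_cons; exact: integD.
Qed.

Lemma RintD f g : integ f -> integ g ->
  \int[mu]_x (f x + g x) = \int[mu]_x f x + \int[mu]_x g x.
Proof. exact: RintegralD. Qed.

Lemma RintB f g : integ f -> integ g ->
  \int[mu]_x (f x - g x) = \int[mu]_x f x - \int[mu]_x g x.
Proof. exact: RintegralB. Qed.

Lemma RintZ (k : R) f : integ f -> \int[mu]_x (k * f x) = k * \int[mu]_x f x.
Proof. by move=> fi; exact: RintegralZl. Qed.

Lemma RintN f : integ f -> \int[mu]_x (- f x) = - \int[mu]_x f x.
Proof.
move=> fi; under eq_Rintegral do rewrite -mulN1r.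
by rewrite RintZ// mulN1r.
Qed.

Lemma Rint_sum (I : Type) (s : seq I) (F : I -> T -> R) :
  (forall i, integ (F i)) ->
  \int[mu]_x (\sum_(i <- s) F i x) = \sum_(i <- s) \int[mu]_x F i x.
Proof.
move=> Fi; elim: s => [|i s IH].
  under eq_Rintegral do rewrite big_nil.
  by rewrite big_nil /Rintegral integral0.
under eq_Rintegral do rewrite big_cons.
rewrite big_cons -IH RintD//; exact: integ_sum.
Qed.

Lemma Rint_le f g : integ f -> integ g -> (forall x, f x <= g x) ->
  \int[mu]_x f x <= \int[mu]_x g x.
Proof. by move=> fi gi fg; apply: le_Rintegral. Qed.

Lemma Rint_ge0 f : (forall x, 0 <= f x) -> 0 <= \int[mu]_x f x.
Proof. by move=> f0; apply: Rintegral_ge0 => x _. Qed.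

Lemma Rint_norm f : integ f -> `|\int[mu]_x f x| <= \int[mu]_x `|f x|.
Proof. by move=> fi; exact: le_normr_Rintegral. Qed.

Lemma EFin_Rint f : integ f -> (\int[mu]_x f x)%:E = (\int[mu]_x (f x)%:E)%E.
Proof. by move=> fi; rewrite /Rintegral fineK//; exact: integrable_fin_num. Qed.

Lemma Rint_ae f g : measurable_fun setT f -> measurable_fun setT g ->
  {ae mu, forall x, f x = g x} -> \int[mu]_x f x = \int[mu]_x g x.
Proof.
move=> mf mg fg; rewrite /Rintegral; congr fine.
apply: ae_eq_integral => //; [exact/measurable_EFinP|exact/measurable_EFinP|].
by apply: filterS fg => x /= -> _.
Qed.

Lemma integ_ae f g : measurable_fun setT g -> integ f ->
  {ae mu, forall x, f x = g x} -> integ g.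
Proof.
move=> mg /integrableP[mf fi] fg; apply/integrableP; split; first exact/measurable_EFinP.
rewrite (_ : (\int[mu]_x _)%E = \int[mu]_x `|(f x)%:E|)%E//.
apply: ae_eq_integral => //.
- by apply: measurableT_comp => //; exact/measurable_EFinP.
- exact: measurableT_comp.
- by apply: filterS fg => x /= -> _.
Qed.

(* Square integrability on the whole space; functions on a subdomain are
   extended by zero. *)
Definition sqint f := measurable_fun setT f /\ integ (fun x => f x ^+ 2).

Definition nsq f : R := \int[mu]_x (f x ^+ 2).

Lemma sqint_mul f g : sqint f -> sqint g -> integ (fun x => f x * g x).
Proof.
move=> [mf fi] [mg gi]; apply: (integ_le (g := fun x => f x ^+ 2 + g x ^+ 2)).
- exact: measurable_funM.
- move=> x; have := sqr_ge0 (f x + g x); have := sqr_ge0 (f x - g x).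
  have := sqr_ge0 (f x); have := sqr_ge0 (g x).
  by rewrite ler_norml sqrrB sqrrD => *; apply/andP; split; lra.
- exact: integD.
Qed.

Lemma sqintD f g : sqint f -> sqint g -> sqint (fun x => f x + g x).
Proof.
move=> f2 g2; have [[mf fi] [mg gi]] := (f2, g2).
split; first exact: measurable_funD.
have -> : (fun x => (f x + g x) ^+ 2) =
    (fun x => (f x ^+ 2 + g x ^+ 2) + 2 * (f x * g x)).
  by apply/funext => x; ring.
by apply: integD; [exact: integD|apply: integZ; exact: sqint_mul].
Qed.

Lemma sqintZ (k : R) f : sqint f -> sqint (fun x => k * f x).
Proof.
move=> [mf fi]; split; first exact: measurable_funM.
by under eq_fun do rewrite exprMn; exact: integZ.
Qed.

Lemma sqintN f : sqint f -> sqint (fun x => - f x).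
Proof.
move=> [mf fi]; split; first exact: measurable_funN.
by under eq_fun do rewrite sqrrN.
Qed.

Lemma sqintB f g : sqint f -> sqint g -> sqint (fun x => f x - g x).
Proof. by move=> f2 g2; apply: sqintD => //; exact: sqintN. Qed.

Lemma sqint0 : sqint (fun=> 0).
Proof.
by split; [exact: measurable_cst|under eq_fun do rewrite expr0n; exact: integ0].
Qed.

Lemma sqint_sum (I : Type) (s : seq I) (F : I -> T -> R) :
  (forall i, sqint (F i)) -> sqint (fun x => \sum_(i <- s) F i x).
Proof.
move=> Fi; elim: s => [|i s IH].
  by under eq_fun do rewrite big_nil; exact: sqint0.
by under eq_fun do rewrite big_cons; exact: sqintD.
Qed.

Lemma sqint_le f g : measurable_fun setT f -> (forall x, `|f x| <= `|g x|) ->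
  sqint g -> sqint f.
Proof.
move=> mf fg [mg gi]; split => //; apply: integ_le gi.
  exact: measurable_funX.
by move=> x; rewrite normrX -[leRHS]real_normK ?num_real// lerXn2r ?nnegrE.
Qed.

Lemma sqint_mulb (M : R) f g : measurable_fun setT f -> (forall x, `|f x| <= M) ->
  sqint g -> sqint (fun x => f x * g x).
Proof.
move=> mf fM g2; apply: sqint_le (sqintZ M g2).
  by apply: measurable_funM => //; case: g2.
move=> x; rewrite !normrM ler_wpM2r//.
by rewrite (le_trans (fM x))// ler_norm.
Qed.

Lemma nsq_ge0 f : 0 <= nsq f.
Proof. by apply: Rint_ge0 => x; exact: sqr_ge0. Qed.

Lemma nsqZ (k : R) f : sqint f -> nsq (fun x => k * f x) = k ^+ 2 * nsq f.
Proof.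
by move=> [mf fi]; rewrite /nsq; under eq_Rintegral do rewrite exprMn; rewrite RintZ.
Qed.

Lemma nsqN f : nsq (fun x => - f x) = nsq f.
Proof. by rewrite /nsq; under eq_Rintegral do rewrite sqrrN. Qed.

Lemma nsqD f g : sqint f -> sqint g ->
  nsq (fun x => f x + g x) <= 2 * nsq f + 2 * nsq g.
Proof.
move=> f2 g2; rewrite /nsq -!RintZ ?f2.2 ?g2.2//.
rewrite -RintD; [|apply: integZ; exact: f2.2|apply: integZ; exact: g2.2].
apply: Rint_le.
- exact: (sqintD f2 g2).2.
- by apply: integD; apply: integZ; [exact: f2.2|exact: g2.2].
- by move=> x; have := sqr_ge0 (f x - g x); rewrite sqrrB sqrrD => *; lra.
Qed.

(** The quadratic polynomial [t |-> nsq (f + t * g)] is nonnegative. If [nsq g] is nonzero it is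
    evaluated at its minimum; otherwise it is affine and its slope has to vanish. *)
Lemma cauchy_schwarz f g : sqint f -> sqint g ->
  (\int[mu]_x (f x * g x)) ^+ 2 <= nsq f * nsq g.
Proof.
move=> f2 g2; set B := Rintegral _ _ _.
have fgi := sqint_mul f2 g2.
have key (t : R) : 0 <= nsq f + 2 * t * B + t ^+ 2 * nsq g.
  suff -> : nsq f + 2 * t * B + t ^+ 2 * nsq g = nsq (fun x => f x + t * g x).
    exact: nsq_ge0.
  rewrite /nsq /B -!RintZ ?g2.2// -RintD ?f2.2//; last exact: integZ.
  rewrite -RintD; [|by apply: integD; [exact: f2.2|exact: integZ]|
    by apply: integZ; exact: g2.2].
  by apply: eq_Rintegral => x _; ring.
have [g0|g0] := eqVneq (nsq g) 0.
  have B0 : B = 0.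
    apply/eqP/negPn/negP => B0.
    (* At this [t] the affine polynomial would take the value [-1]. *)
    have := key (- (nsq f + 1) / (2 * B)); rewrite g0.
    have -> : 2 * (- (nsq f + 1) / (2 * B)) * B = - (nsq f + 1) by field.
    by lra.
  by rewrite B0 g0 expr0n mulr0.
have gp : 0 < nsq g by rewrite lt_neqAle eq_sym g0 nsq_ge0.
have := key (- B / nsq g).
have -> : nsq f + 2 * (- B / nsq g) * B + (- B / nsq g) ^+ 2 * nsq g =
  (nsq f * nsq g - B ^+ 2) / nsq g by field.
by rewrite pmulr_lge0 ?invr_gt0// subr_ge0.
Qed.

Lemma nsq_eq0 f : sqint f -> nsq f = 0 -> {ae mu, forall x, f x = 0}.
Proof.
move=> [mf fi] f0.
have mff : measurable_fun setT (EFin \o (fun x => f x ^+ 2)).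
  exact/measurable_EFinP/measurable_funX.
have h : (\int[mu]_x `|((f x ^+ 2)%R)%:E| = 0)%E.
  under eq_integral do rewrite /= ger0_norm ?sqr_ge0//.
  by rewrite -EFin_Rint// -/(nsq f) f0.
have := (ae_eq_integral_abs mu measurableT mff).1 h.
apply: filterS => x /(_ I) /= [] /eqP.
by rewrite sqrf_eq0 => /eqP.
Qed.

Lemma nsq_cvg_mul (F : nat -> T -> R) f g : (forall k, sqint (F k)) ->
  sqint f -> sqint g -> nsq (fun x => F k x - f x) @[k --> \oo] --> 0 ->
  (\int[mu]_x (F k x * g x)) @[k --> \oo] --> \int[mu]_x (f x * g x).
Proof.
move=> F2 f2 g2 Ff.
apply/subr_cvg0.
have E k : \int[mu]_x (F k x * g x) - \int[mu]_x (f x * g x) =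
    \int[mu]_x ((F k x - f x) * g x).
  rewrite -RintB; [|exact: sqint_mul|exact: sqint_mul].
  by apply: eq_Rintegral => x _; ring.
under eq_cvg do rewrite E.
apply: norm_cvg0.
have b k : 0 <= `|\int[mu]_x ((F k x - f x) * g x)| <=
    Num.sqrt (nsq (fun x => F k x - f x) * nsq g).
  rewrite normr_ge0 /= -sqrtr_sqr ler_wsqrtr//.
  by apply: cauchy_schwarz => //; exact: sqintB.
apply: cvg0_le b _.
rewrite -[X in _ --> X]sqrtr0; apply: continuous_cvg; first exact: sqrt_continuous.
by rewrite -[X in _ --> X](mul0r (nsq g)); apply: cvgM => //; exact: cvg_cst.
Qed.

End real_integrals.

Local Notation integ f := (leb.-integrable setT (EFin \o f)).

Lemma limn_einf_le (R : realType) (u : (\bar R)^nat) (c : \bar R) (N : nat) :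
  (forall k, (N <= k)%N -> (u k <= c)%E) -> (limn_einf u <= c)%E.
Proof.
move=> uc; rewrite limn_einf_lim; apply: lime_le; first exact: is_cvg_einfs.
apply: nearW => n; apply: (@le_trans _ _ (u (maxn n N))); last exact/uc/leq_maxr.
by apply: ereal_inf_lbound; exists (maxn n N) => //=; exact: leq_maxl.
Qed.

Lemma sum_half_le (R : realType) (n : nat) : \sum_(0 <= k < n) (2^-1 : R) ^+ k <= 2.
Proof.
suff -> : \sum_(0 <= k < n) (2^-1 : R) ^+ k = 2 - 2 * 2^-1 ^+ n.
  by rewrite lerBlDr lerDl mulr_ge0// exprn_ge0// invr_ge0.
elim: n => [|n IH]; first by rewrite big_nil expr0; ring.
by rewrite big_nat_recr//= IH exprS; field.
Qed.

(** Used with [e = 2 ^ k]: absolute convergence of a series then follows from a geometric series and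
    a weighted sum of squares. *)
Lemma norm_le_amgm (R : realFieldType) (e y : R) : 0 < e -> `|y| <= e^-1 + e * y ^+ 2.
Proof.
move=> e0; rewrite -[y ^+ 2]real_normK ?num_real//.
set z := `|y|; rewrite -subr_ge0 -(pmulr_rge0 _ e0).
have -> : e * (e^-1 + e * z ^+ 2 - z) = 1 + (e * z) ^+ 2 - e * z by field; lra.
have := sqr_ge0 (e * z - 1); have := sqr_ge0 (e * z + 1).
by rewrite sqrrB sqrrD => *; nra.
Qed.

(** * Completeness of $L^2$ *)

Section riesz_fischer.
Context (disp : measure_display) (T : measurableType disp) (R : realType).
Variable mu : {measure set T -> \bar R}.
Implicit Types f g : T -> R.

(** The sum of the squared increments, weighted by [2 ^ k], has integral at most 2, hence is finite
    almost everywhere, and there the increments are absolutely summable. Fatou's lemma turns the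
    pointwise limit into a limit in $L^2$. *)
Lemma riesz_fischer (F : nat -> T -> R) : (forall k, sqint mu (F k)) ->
  (forall k m, (k <= m)%N -> nsq mu (fun x => F m x - F k x) <= (2^-1 ^+ k) ^+ 2) ->
  exists G, sqint mu G /\ nsq mu (fun x => F k x - G x) @[k --> \oo] --> 0.
Proof.
move=> F2 FF.
have mF k : measurable_fun setT (F k) by case: (F2 k).
pose D k x := F k.+1 x - F k x.
have D2 k : sqint mu (D k) by exact: sqintB.
(* The weight spends half of the decay [4^-k] of the squared increments; the integral of [t k] is
   still at most [2^-k]. *)
pose t k x := 2 ^+ k * D k x ^+ 2.
have t0 k x : 0 <= t k x by apply: mulr_ge0; [exact: exprn_ge0|exact: sqr_ge0].
have mt k : measurable_fun setT (t k).
  by apply: measurable_funM => //; exact/measurable_funX/(D2 k).1.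
pose s x := (\sum_(0 <= k <oo) (t k x)%:E)%E.
have s0 x : (0 <= s x)%E by apply: nneseries_ge0 => k _ _; rewrite lee_fin.
have ms : measurable_fun setT s.
  apply: ge0_emeasurable_sum => [k x _ _|k _]; first by rewrite lee_fin.
  exact/measurable_EFinP.
have si : (\int[mu]_x s x <= 2%:E)%E.
  rewrite integral_nneseries//; last 2 first.
    by move=> k; exact/measurable_EFinP.
    by move=> k x _; rewrite lee_fin.
  apply: lime_le.
    by apply: is_cvg_nneseries => k _ _; apply: integral_ge0 => x _; rewrite lee_fin.
  apply: nearW => n; apply: (@le_trans _ _ (\sum_(0 <= k < n) (2^-1 ^+ k)%:E)%E).
    apply: lee_sum => k _.
    rewrite -EFin_Rint; last by apply: integZ; exact: (D2 k).2.
    rewrite lee_fin RintZ; last exact: (D2 k).2.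
    have : nsq mu (D k) <= (2^-1 ^+ k) ^+ 2 by exact: FF.
    rewrite -/(nsq mu (D k)) => h.
    have -> : (2^-1 ^+ k : R) = 2 ^+ k * (2^-1 ^+ k) ^+ 2.
      by rewrite expr2 mulrA -exprMn mulfV// expr1n mul1r.
    by rewrite ler_wpM2l// exprn_ge0.
  by rewrite sumEFin lee_fin; exact: sum_half_le.
have sae : {ae mu, forall x, s x \is a fin_num}.
  have sint : mu.-integrable setT s.
    apply/integrableP; split => //.
    under eq_integral do rewrite gee0_abs//.
    by apply: (le_lt_trans si); rewrite ltry.
  by apply: filterS (integrable_ae measurableT sint) => x; exact.
have Fcvg x : s x \is a fin_num -> cvgn (F ^~ x).
  move=> sfin.
  have h : cvgn (series (fun k => `|D k x|)).
    apply: nondecreasing_is_cvgn.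
      by apply: nondecreasing_series => n _ _; rewrite normr_ge0.
    exists (2 + fine (s x)) => _ [n _ <-]; rewrite /series /=.
    apply: (@le_trans _ _ (\sum_(0 <= k < n) (2^-1 ^+ k + t k x))).
      apply: ler_sum => k _; rewrite /t.
      by rewrite exprVn; apply: norm_le_amgm; rewrite exprn_gt0.
    rewrite big_split /= lerD ?sum_half_le// -lee_fin fineK// -sumEFin.
    by apply: (@nneseries_lim_ge R (fun k => (t k x)%:E) xpredT 0) => k _ _; rewrite lee_fin.
  have /cvg_ex[l hl] := normed_cvg (u_ := fun k => D k x) h.
  apply/cvg_ex; exists (l + F 0 x).
  rewrite (_ : F ^~ x = series (fun k => D k x) \+ cst (F 0 x)); last first.
    by apply/funext => n; rewrite /= /series /= telescope_sumr// subrK.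
  exact: cvgD hl (cvg_cst _).
(* The upper limit is measurable without removing an exceptional set, and it is the limit wherever
   [s] is finite. *)
pose G x := fine (limn_esup (fun k => (F k x)%:E)).
have mG : measurable_fun setT G.
  apply: measurableT_comp => //; apply: measurable_fun_limn_esup => k.
  exact/measurable_EFinP.
have FG x : s x \is a fin_num -> F k x @[k --> \oo] --> G x.
  move=> /Fcvg /cvg_ex[l hl].
  have h : (F k x)%:E @[k --> \oo] --> l%:E by apply: cvg_EFin => //; exact: nearW.
  by rewrite /G (cvg_limn_einf_sup h).2.
(* Fatou's lemma in [m]: almost everywhere the integrand is the lower limit of [(F m - F k) ^+ 2],
   whose integral is bounded by hypothesis once [m >= k]. *)
have bnd k : (\int[mu]_x ((F k x - G x) ^+ 2)%:E <= ((2^-1 ^+ k) ^+ 2)%:E)%E.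
  rewrite (_ : (\int[mu]_x _)%E =
    \int[mu]_x limn_einf (fun m => ((F m x - F k x) ^+ 2)%:E))%E; last first.
    apply: ae_eq_integral => //.
    - by apply/measurable_EFinP/measurable_funX/measurable_funB.
    - apply: (eq_measurable_fun (fun x => (- limn_esup (fun m => (- ((F m x - F k x) ^+ 2))%:E))%E)).
        by move=> x _; rewrite -limn_einfN; congr limn_einf; apply/funext => m /=; rewrite opprK.
      apply: measurableT_comp => //; apply: measurable_fun_limn_esup => m.
      exact/measurable_EFinP/measurable_funN/measurable_funX/measurable_funB.
    - apply: filterS sae => x /FG h _; apply/esym.
      apply: (cvg_limn_einf_sup _).1.
      apply: cvg_EFin; first exact: nearW.
      rewrite -sqrrN opprB; rewrite !expr2.
      by apply: cvgM; apply: cvgB => //; exact: cvg_cst.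
  apply: le_trans (fatou mu measurableT _ _) _ => //.
  - by move=> m; exact/measurable_EFinP/measurable_funX/measurable_funB.
  - by move=> m x _; rewrite lee_fin sqr_ge0.
  apply: (limn_einf_le (N := k)) => m km.
  rewrite -EFin_Rint; last exact: (sqintB (F2 m) (F2 k)).2.
  by rewrite lee_fin; exact: FF.
have FG2 k : sqint mu (fun x => F k x - G x).
  split; first exact: measurable_funB.
  apply: integ_lty.
  - exact/measurable_funX/measurable_funB.
  - by move=> x; exact: sqr_ge0.
  - by apply: (le_lt_trans (bnd k)); rewrite ltry.
exists G; split.
  have := sqintB (F2 0) (FG2 0); congr (sqint mu _).
  by apply/funext => x; ring.
apply: (cvg0_le (g := fun k => (2^-1 ^+ k) ^+ 2)) => [k|].
  by rewrite nsq_ge0 /= -lee_fin EFin_Rint ?bnd//; exact: (FG2 k).2.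
- have h : (2^-1 : R) ^+ k @[k --> \oo] --> 0.
    by apply: cvg_expr; rewrite ger0_norm ?invr_ge0// invf_lt1// ltr1n.
  by have h2 := cvgM h h; rewrite mulr0 in h2; exact: h2.
Qed.

(** Expanding the square around [f] leaves [nsq (F k - f)], which tends to 0, and the pairing of
    [F k] with [f], which converges by [nsq_cvg_mul]. *)
Lemma nsq_cvg (F : nat -> T -> R) f : (forall k, sqint mu (F k)) -> sqint mu f ->
  nsq mu (fun x => F k x - f x) @[k --> \oo] --> 0 ->
  nsq mu (F k) @[k --> \oo] --> nsq mu f.
Proof.
move=> F2 f2 Ff.
have E k : nsq mu (F k) =
    nsq mu (fun x => F k x - f x) + (2 * \int[mu]_x (F k x * f x) - nsq mu f).
  rewrite /nsq -RintZ; last exact: sqint_mul.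
  rewrite -RintB; [|by apply: integZ; exact: sqint_mul|exact: f2.2].
  rewrite -RintD.
  - by apply: eq_Rintegral => x _; ring.
  - exact: (sqintB (F2 k) f2).2.
  - by apply: integB; [apply: integZ; exact: sqint_mul|exact: f2.2].
have h := nsq_cvg_mul F2 f2 f2 Ff.
have := cvgD Ff (cvgB (cvgM (cvg_cst (2 : R)) h) (cvg_cst (nsq mu f))).
have -> : \int[mu]_x (f x * f x) = nsq mu f by apply: eq_Rintegral => x _; rewrite expr2.
rewrite (_ : 0 + (2 * nsq mu f - nsq mu f) = nsq mu f); last by ring.
move=> H; rewrite (_ : (fun k => nsq mu (F k)) = fun k =>
    nsq mu (fun x => F k x - f x) + (2 * \int[mu]_x (F k x * f x) - nsq mu f));
  [exact: H|exact/funext].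
Qed.

End riesz_fischer.

(** * Plancherel's inequality *)

Section exp_kernel.
Variable R : realType.
Local Notation mu := (@lebesgue_measure R).

Lemma lebesgue_Rint_opp (f : R -> R) : mu.-integrable setT (EFin \o f) ->
  \int[mu]_x f (- x) = \int[mu]_x f x.
Proof.
move=> fi; have [mf _] := integrableP _ _ _ fi.
have mopp : measurable_fun setT (-%R : measurableTypeR R -> measurableTypeR R).
  exact: oppr_measurable.
have E (g : R -> \bar R) :
    (\int[mu]_x g x = \int[pushforward mu (-%R : measurableTypeR R -> measurableTypeR R)]_x g x)%E.
  by apply: eq_measure_integral => //= A mA _; exact/esym/lebesgue_measureN.
have mfo : measurable_fun setT ((EFin \o f) \o (-%R : measurableTypeR R -> measurableTypeR R)).
  exact: measurableT_comp.
rewrite /Rintegral [in RHS]E integral_pushforward//=.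
apply/integrableP; split; first exact: mfo.
have [_] := integrableP _ _ _ fi; rewrite E ge0_integral_pushforward//=.
exact: (measurableT_comp (@abse_measurable R setT) mf).
Qed.

Lemma derivable_continuous (f : R -> R) (x : R) : derivable f x 1 -> {for x, continuous f}.
Proof. by move=> fx; apply: differentiable_continuous; exact/derivable1_diffP. Qed.

Lemma ge0_FTC_half (f F : R -> R) (l : R) : (forall x, 0 <= f x) ->
  continuous f -> (forall x : R, is_derive x 1 F (f x)) ->
  F x @[x --> +oo] --> l ->
  (\int[mu]_(x in `[0%R, +oo[) (f x)%:E = (l - F 0)%:E)%E.
Proof.
move=> f0 cf dF Fl.
have cF : continuous F.
  by move=> x; apply: derivable_continuous; apply: ex_derive.
rewrite (ge0_continuous_FTC2y _ _ Fl)//.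
- by apply: continuous_subspaceT.
- by apply: cvg_at_right_filter; exact: cF.
- by move=> x _; rewrite derive1E; have [] := dF x.
Qed.

Lemma cvg_expR_decay (e : R) : 0 < e -> expR (- (e * x)) @[x --> +oo] --> 0.
Proof.
move=> e0; have h := @cvgr_expR R.
have : e * x @[x --> +oo] --> +oo by apply: gt0_cvgMry => //; exact: cvg_id.
by move=> /(cvg_comp _ _) /(_ h).
Qed.

Definition exp_weight (e x : R) : R := expR (- (e * `|x|)).

Lemma exp_weight_gt0 e x : 0 < exp_weight e x.
Proof. exact: expR_gt0. Qed.

Lemma continuous_exp_weight e : continuous (exp_weight e).
Proof.
move=> x; apply: (@continuous_comp _ _ _ (fun x => - (e * `|x|)) expR); last exact: continuous_expR.
apply: continuousN; apply: (@continuousM _ _ (cst e) (fun x => `|x|)); first exact: cst_continuous.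
exact: norm_continuous.
Qed.

Lemma continuous_cosM (a : R) : continuous (fun x => cos (a * x)).
Proof. by move=> x; apply: derivable_continuous; apply: ex_derive. Qed.

Lemma continuous_sinM (a : R) : continuous (fun x => sin (a * x)).
Proof. by move=> x; apply: derivable_continuous; apply: ex_derive. Qed.

(** Adding 1 to the cosine makes the integrand nonnegative, as the symmetrisation and the
    fundamental theorem on the half-line demand; [Rint_exp_weight_cos] subtracts the extra term
    again. *)
Lemma integral_exp_weight_cos1 (e a : R) : 0 < e ->
  (\int[mu]_x (exp_weight e x * (1 + cos (a * x)))%:E
   = (2 / e + 2 * e / (e ^+ 2 + a ^+ 2))%:E)%E.
Proof.
move=> e0.
have ea0 : 0 < e ^+ 2 + a ^+ 2 by rewrite ltr_wpDr ?sqr_ge0// exprn_gt0.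
have c0 x : 0 <= 1 + cos (a * x) by have := cos_geN1 (a * x); lra.
rewrite ge0_symfun_integralT; last 3 first.
- by move=> x; rewrite mulr_ge0// ltW// exp_weight_gt0.
- move=> x; apply: (@continuousM _ _ (exp_weight e)); first exact: continuous_exp_weight.
  by apply: derivable_continuous; apply: ex_derive.
- by move=> x /=; rewrite /exp_weight normrN mulrN cosN.
pose f x := expR (- (e * x)) * (1 + cos (a * x)).
(* The antiderivative of [f] that tends to 0 at infinity. The half-line integral is minus its value
   at 0, and symmetry doubles it. *)
pose F x := expR (- (e * x)) *
  (- e^-1 + (a * sin (a * x) - e * cos (a * x)) / (e ^+ 2 + a ^+ 2)).
rewrite (_ : [set x | 0 <= x] = `[0, +oo[%classic); last first.
  by apply/seteqP; split => x /=; rewrite in_itv /= andbT.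
under eq_integral => x.
  rewrite inE /= in_itv /= andbT => x0; rewrite /exp_weight (ger0_norm x0) -/(f x).
  over.
have f0 x : 0 <= f x.
  by rewrite /f mulr_ge0// expR_ge0.
have cf : continuous f.
  by move=> x; apply: derivable_continuous; apply: ex_derive.
have dF (x : R) : is_derive x 1 F (f x).
  rewrite /F; apply: is_derive_eq; rewrite /f !scaler0 /GRing.scale /=.
  field; lra.
have F0 : F x @[x --> +oo] --> 0.
  pose C := e^-1 + (`|a| + e) / (e ^+ 2 + a ^+ 2).
  have bF x : - (expR (- (e * x)) * C) <= F x <= expR (- (e * x)) * C.
    rewrite -ler_norml /F normrM ger0_norm ?expR_ge0// ler_wpM2l ?expR_ge0//.
    rewrite (le_trans (ler_normD _ _))// normrN ger0_norm ?invr_ge0 ?(ltW e0)//.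
    rewrite lerD2l normrM [`|_^-1|]ger0_norm ?invr_ge0 ?(ltW ea0)//.
    rewrite ler_wpM2r ?invr_ge0 ?(ltW ea0)// (le_trans (ler_normB _ _))//.
    rewrite !normrM (ger0_norm (ltW e0)) lerD//.
      by rewrite ler_piMr// sin_max.
    by rewrite ler_piMr ?(ltW e0)// cos_max.
  have hC : expR (- (e * x)) * C @[x --> +oo] --> 0.
    by have h := cvgM (cvg_expR_decay e0) (cvg_cst C); rewrite mul0r in h; exact: h.
  apply: (squeeze_cvgr _ _ hC); first by apply: nearW => x; exact: bF.
  by have h := cvgN hC; rewrite oppr0 in h; exact: h.
rewrite (ge0_FTC_half f0 cf dF F0).
rewrite -EFinM /F !mulr0 oppr0 expR0 cos0 sin0; congr EFin; field; lra.
Qed.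

Lemma integrable_exp_weight (e : R) : 0 < e ->
  mu.-integrable setT (EFin \o exp_weight e).
Proof.
move=> e0; have me := continuous_measurable_fun (@continuous_exp_weight e).
apply: integ_lty => //; first by move=> x; rewrite ltW// exp_weight_gt0.
(* At frequency 0 the integrand just computed is [2 * exp_weight e], which dominates the weight. *)
apply: (@le_lt_trans _ _ (\int[mu]_x (exp_weight e x * (1 + cos (0 * x)))%:E)%E).
  apply: ge0_le_integral => //.
  - by move=> x _; rewrite lee_fin ltW// exp_weight_gt0.
  - exact/measurable_EFinP.
  - apply/measurable_EFinP; apply: measurable_funM => //.
    by under eq_fun do rewrite mul0r cos0; exact: measurable_cst.
  - move=> x _; rewrite lee_fin mul0r cos0 ler_peMr//; last by lra.
    by rewrite ltW// exp_weight_gt0.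
by rewrite integral_exp_weight_cos1// ltry.
Qed.

(** The Fourier transform of [exp_weight e], that is, the Cauchy density (Poisson kernel) of scale
    [e / (2 * pi)]. *)
Definition cauchy_kernel (e z : R) : R := 2 * e / (e ^+ 2 + (2 * pi * z) ^+ 2).

Lemma cauchy_kernel_ge0 e z : 0 < e -> 0 <= cauchy_kernel e z.
Proof.
move=> e0; rewrite /cauchy_kernel divr_ge0//; first by rewrite mulr_ge0 ?(ltW e0).
by rewrite addr_ge0 ?sqr_ge0.
Qed.

Lemma integrable_exp_weight_mul (e a : R) (c : R -> R) : 0 < e ->
  continuous (fun x => c (a * x)) -> (forall x, `|c x| <= 1) ->
  mu.-integrable setT (EFin \o (fun x => exp_weight e x * c (a * x))).
Proof.
move=> e0 cc c1; apply: (integ_mulb (M := 1) (integrable_exp_weight e0)) => //.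
exact: continuous_measurable_fun cc.
Qed.

Lemma integrable_exp_weight_cos (e a : R) : 0 < e ->
  mu.-integrable setT (EFin \o (fun x => exp_weight e x * cos (a * x))).
Proof.
by move=> e0; apply: integrable_exp_weight_mul (@cos_max R) => //; exact: continuous_cosM.
Qed.

Lemma integrable_exp_weight_sin (e a : R) : 0 < e ->
  mu.-integrable setT (EFin \o (fun x => exp_weight e x * sin (a * x))).
Proof.
by move=> e0; apply: integrable_exp_weight_mul (@sin_max R) => //; exact: continuous_sinM.
Qed.

Lemma Rint_exp_weight_cos (e z : R) : 0 < e ->
  \int[mu]_x (exp_weight e x * cos (2 * pi * z * x)) = cauchy_kernel e z.
Proof.
move=> e0; have ei := integrable_exp_weight e0.
have ci a := integrable_exp_weight_cos a e0.
have h a : \int[mu]_x exp_weight e x + \int[mu]_x (exp_weight e x * cos (a * x))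
    = 2 / e + 2 * e / (e ^+ 2 + a ^+ 2).
  rewrite -RintD//.
  rewrite -[RHS]/(fine (2 / e + 2 * e / (e ^+ 2 + a ^+ 2))%:E) -integral_exp_weight_cos1//.
  by rewrite /Rintegral; congr fine; apply: eq_integral => x _; rewrite mulrDr mulr1.
(* Frequency 0 gives twice the integral of the weight alone, which is therefore [2 / e]. *)
have := h 0; under [X in _ + X]eq_Rintegral do rewrite mul0r cos0 mulr1.
move=> h0; have := h (2 * pi * z); rewrite /cauchy_kernel => h1.
have -> : \int[mu]_x (exp_weight e x * cos (2 * pi * z * x)) =
  2 / e + 2 * e / (e ^+ 2 + (2 * pi * z) ^+ 2) - \int[mu]_x exp_weight e x.
  by rewrite -h1; ring.
have -> : \int[mu]_x exp_weight e x = 2 / e.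
  apply: (@mulfI _ 2); first by lra.
  rewrite mulr_natl mulr2n h0 expr0n addr0; field; lra.
by ring.
Qed.

(** The integrand is odd, so the integral equals its own opposite. *)
Lemma Rint_exp_weight_sin (e a : R) : 0 < e ->
  \int[mu]_x (exp_weight e x * sin (a * x)) = 0.
Proof.
move=> e0; have si := integrable_exp_weight_sin a e0.
have := lebesgue_Rint_opp si.
under eq_Rintegral do rewrite /exp_weight normrN mulrN sinN mulrN -/(exp_weight e _).
rewrite RintN//; set B := Rintegral _ _ _ => h; lra.
Qed.

Lemma oneDsqr_nneg (x : R) : 0 <= oneDsqr x.
Proof. by rewrite addr_ge0 ?sqr_ge0. Qed.

Lemma integral_oneDsqrV : (\int[mu]_x ((oneDsqr x)^-1)%:E = (pi : R)%:E)%E.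
Proof.
rewrite ge0_symfun_integralT.
- rewrite (_ : [set x | 0 <= x] = `[0, +oo[%classic); last first.
    by apply/seteqP; split => x /=; rewrite in_itv /= andbT.
  by rewrite integral0y_oneDsqr -EFinM; congr EFin; field.
- by move=> x; rewrite invr_ge0 oneDsqr_nneg.
- by move=> x; exact: continuous_oneDsqrV.
- by move=> x; rewrite /oneDsqr /= sqrrN.
Qed.

(** The affine substitution [y |-> 2 * pi / e * (y - x)] reduces the kernel to
    [1 / (pi * (1 + y ^+ 2))], whose integral is 1. *)
Lemma integral_cauchy_kernel (e x : R) : 0 < e ->
  (\int[mu]_y (cauchy_kernel e (x - y))%:E = 1)%E.
Proof.
move=> e0; have pi0 : 0 < pi :> R by exact: pi_gt0.
pose k : R := 2 * pi / e.
have k0 : 0 < k by rewrite divr_gt0// mulr_gt0.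
pose F (y : R) : R := k * (y - x).
have dF (y : R) : is_derive y 1 F k.
  by rewrite /F; apply: is_derive_eq; rewrite /GRing.scale /= !subr0 mulr1.
have F' : (F^`())%classic = cst k.
  by apply/funext => y; rewrite derive1E derive_val.
have E : (\int[mu]_x ((pi^-1 * (oneDsqr x)^-1))%:E = (1 : R)%:E)%E.
  under eq_integral do rewrite EFinM.
  rewrite ge0_integralZl//=.
  - by rewrite integral_oneDsqrV -EFinM mulVf// gt_eqF.
  - apply/measurable_EFinP; apply: continuous_measurable_fun => y; exact: continuous_oneDsqrV.
  - by rewrite lee_fin invr_ge0; exact: ltW.
rewrite -E (@increasing_ge0_integration_by_substitutionT _ F (fun y => pi^-1 * (oneDsqr y)^-1)).
- apply: eq_integral => y _; rewrite F'; congr EFin.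
  rewrite -[RHS]/(pi^-1 * (1 + (2 * pi / e * (y - x)) ^+ 2)^-1 * (2 * pi / e)).
  rewrite /cauchy_kernel.
  have h1 : e ^+ 2 + (2 * pi * (x - y)) ^+ 2 != 0.
    by rewrite gt_eqF// ltr_wpDr ?sqr_ge0// exprn_gt0.
  have h2 : 1 + (2 * pi / e * (y - x)) ^+ 2 != 0.
    by rewrite gt_eqF// ltr_wpDr ?sqr_ge0.
  have -> : e ^+ 2 + (2 * pi * (x - y)) ^+ 2 = e ^+ 2 * (1 + (2 * pi / e * (y - x)) ^+ 2).
    by field; lra.
  move: (1 + _) h2 => q h2; move: (pi : R) pi0 => p p0; field.
  by rewrite h2 (gt_eqF e0) (gt_eqF p0).
- by move=> y z yz; rewrite /F ltr_pM2l// ltrD2r.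
- by rewrite F'; exact: cst_continuous.
- by rewrite F'; exact: is_cvg_cst.
- by rewrite F'; exact: is_cvg_cst.
- by move=> y; apply: ex_derive.
- apply: gt0_cvgMrNy => //; apply/cvgrNyPle => A.
  by apply: filterS (nbhs_ninfty_le (num_real (A + x))) => y; rewrite lerBlDr.
- by apply: gt0_cvgMry => //; exact: cvg_addrr.
- move=> y; apply: (@continuousM R R (cst (pi^-1)) (fun y => (oneDsqr y)^-1)); first exact: cst_continuous.
  exact: continuous_oneDsqrV.
- by move=> y; apply: mulr_ge0; rewrite invr_ge0; [exact: ltW|exact: oneDsqr_nneg].
Qed.

End exp_kernel.

Lemma measurable_coord_comp d (T : measurableType d) (R : realType) (n : nat)
    (f : T -> 'rV[R]_n) (i : 'I_n) :
  measurable_fun setT f -> measurable_fun setT (fun t => f t 0 i).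
Proof. by move=> mf; exact: (measurableT_comp (@measurable_coord R n i) mf). Qed.

Lemma measurable_dotp d (T : measurableType d) (R : realType) (n : nat)
    (f g : T -> 'rV[R]_n) :
  measurable_fun setT f -> measurable_fun setT g ->
  measurable_fun setT (fun t => dotp (f t) (g t)).
Proof.
move=> mf mg; apply: measurable_sum => i.
by apply: measurable_funM; exact: measurable_coord_comp.
Qed.

Section product_fubini.
Context (d1 d2 : measure_display) (T1 : measurableType d1) (T2 : measurableType d2).
Variable R : realType.
Variables (m1 : {sigma_finite_measure set T1 -> \bar R})
  (m2 : {sigma_finite_measure set T2 -> \bar R}).

Lemma integ_prod_mul (f : T1 -> R) (g : T2 -> R) :
  m1.-integrable setT (EFin \o f) -> m2.-integrable setT (EFin \o g) ->
  (m1 \x m2)%E.-integrable setT (EFin \o (fun p => f p.1 * g p.2)).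
Proof.
move=> fi gi; have mf := integ_measurable fi; have mg := integ_measurable gi.
have mfg : measurable_fun setT (fun p : T1 * T2 => f p.1 * g p.2).
  by apply: measurable_funM; [exact: (measurableT_comp mf)|exact: (measurableT_comp mg)].
apply/(integrable12ltyP m1 m2); first exact/measurable_EFinP.
under eq_integral => x _.
  under eq_integral do rewrite /= normrM EFinM.
  rewrite ge0_integralZl//; last exact/measurable_EFinP/measurableT_comp.
  rewrite -EFin_Rint; last exact: integ_abs.
  over.
rewrite /= ge0_integralZr//; last 2 first.
- exact/measurable_EFinP/measurableT_comp.
- by rewrite lee_fin Rint_ge0.
by rewrite -EFin_Rint ?ltry//; exact: integ_abs.
Qed.

(** A real integral is [fine] of an extended one; integrability of all slices lets [fine] be taken
    off the inner integrals at every point. *)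
Lemma RFubini (g : T1 * T2 -> R) :
  (m1 \x m2)%E.-integrable setT (EFin \o g) ->
  (forall x, m2.-integrable setT (EFin \o (fun y => g (x, y)))) ->
  (forall y, m1.-integrable setT (EFin \o (fun x => g (x, y)))) ->
  \int[m1]_x (\int[m2]_y g (x, y)) = \int[m2]_y (\int[m1]_x g (x, y)).
Proof.
move=> gi g1 g2; rewrite /Rintegral; congr fine.
transitivity (\int[m1]_x \int[m2]_y (g (x, y))%:E)%E.
  by apply: eq_integral => x _; rewrite fineK//; exact: (integrable_fin_num _ (g1 x)).
rewrite (Fubini gi).
by apply: eq_integral => y _; rewrite fineK//; exact: (integrable_fin_num _ (g2 y)).
Qed.

Lemma integ_fubini1 (g : T1 * T2 -> R) :
  (m1 \x m2)%E.-integrable setT (EFin \o g) ->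
  (forall x, m2.-integrable setT (EFin \o (fun y => g (x, y)))) ->
  m1.-integrable setT (EFin \o (fun x => \int[m2]_y g (x, y))).
Proof.
move=> gi g1; apply: eq_integrable (integrable_fubini_F gi) => // x _ /=.
by rewrite EFin_Rint//; exact: g1.
Qed.

End product_fubini.

Section leb_products.
Variable R : realType.
Local Notation mu := (@lebesgue_measure R).

Lemma integral_leb0 (f : 'rV[R]_0 -> \bar R) : (\int[leb]_x f x = f 0%R)%E.
Proof.
rewrite /= (_ : f = cst (f 0%R)); last by apply/funext => x; rewrite [x]thinmx0.
by rewrite integral_dirac//= diracE in_setT mul1e.
Qed.

(** Tonelli peels off the last coordinate, whose integral is a constant factor in the induction on
    the dimension. *)
Lemma integral_leb_prod (d : nat) (k : 'I_d -> R -> R) (c : 'I_d -> R) :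
  (forall i, measurable_fun setT (k i)) -> (forall i x, 0 <= k i x) ->
  (forall i, \int[mu]_x (k i x)%:E = (c i)%:E)%E ->
  (\int[@leb R d]_x (\prod_i k i (x 0 i))%:E = (\prod_i c i)%:E)%E.
Proof.
elim: d k c => [|d IH] k c mk k0 kc; first by rewrite integral_leb0 !big_ord0.
rewrite leb_tonelli1; last 2 first.
- apply/measurable_EFinP; apply: measurable_prod => i _.
  exact: (measurableT_comp (mk i) (@measurable_coord R _ i)).
- by move=> x; rewrite lee_fin prodr_ge0.
have E x : (\int[mu]_t (\prod_i k i (join_pt (x, t) 0 i))%:E =
    (\prod_j k (lift ord_max j) (x 0 j))%:E * (c ord_max)%:E)%E.
  rewrite -kc -ge0_integralZl//.
  - apply: eq_integral => t _; rewrite -EFinM prod_lift_max join_pt_max.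
    by congr (_ * _)%:E; apply: eq_bigr => j _; rewrite join_pt_lift.
  - by apply/measurable_EFinP; exact: mk.
  - by move=> t _; rewrite lee_fin.
  - by rewrite lee_fin prodr_ge0.
under eq_integral do rewrite E.
rewrite /= ge0_integralZr//; last 3 first.
- apply/measurable_EFinP; apply: measurable_prod => i _.
  exact: (measurableT_comp (mk _) (@measurable_coord R _ i)).
- by move=> x _; rewrite lee_fin prodr_ge0.
- by rewrite -(kc ord_max); apply: integral_ge0 => x _; rewrite lee_fin.
by rewrite (IH (fun j => k (lift ord_max j)) (fun j => c (lift ord_max j)))// -EFinM prod_lift_max.
Qed.

Lemma leb_Rfubini (d : nat) (f : 'rV[R]_d.+1 -> R) :
  integ f ->
  (forall x, mu.-integrable setT (EFin \o (fun t => f (join_pt (x, t))))) ->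
  \int[leb]_x f x = \int[leb]_x \int[mu]_t f (join_pt (x, t)).
Proof.
move=> fi fx; rewrite /Rintegral leb_integral_join//
  -(integral12_prod_meas1 (leb_integrable_join fi)); congr fine.
by apply: eq_integral => x _; rewrite fineK//; exact: (integrable_fin_num _ (fx x)).
Qed.

Definition weight (d : nat) (e : R) (x : 'rV[R]_d) : R := \prod_i exp_weight e (x 0 i).

Lemma weight_gt0 d e (x : 'rV[R]_d) : 0 < weight e x.
Proof. by apply: prodr_gt0 => i _; exact: exp_weight_gt0. Qed.

Lemma weight_join d e (x : 'rV[R]_d) t :
  weight e (join_pt (x, t)) = weight e x * exp_weight e t.
Proof.
rewrite /weight prod_lift_max join_pt_max; congr (_ * _).
by apply: eq_bigr => i _; rewrite join_pt_lift.
Qed.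

Lemma measurable_weight d e : measurable_fun setT (@weight d e).
Proof.
apply: measurable_prod => i _.
apply: (measurableT_comp _ (@measurable_coord R _ i)).
exact: continuous_measurable_fun (@continuous_exp_weight R e).
Qed.

Lemma integrable_weight d e : 0 < e -> integ (@weight d e).
Proof.
move=> e0; have ei := integrable_exp_weight e0.
apply: integ_lty; first exact: measurable_weight.
  by move=> x; exact/ltW/weight_gt0.
rewrite (@integral_leb_prod d (fun=> exp_weight e) (fun=> \int[mu]_x exp_weight e x)).
- by rewrite ltry.
- by move=> i; exact: integ_measurable ei.
- by move=> i x; exact/ltW/exp_weight_gt0.
- by move=> i; rewrite EFin_Rint.
Qed.

(** The growing weight [weight (- e)] cancels [weight e] once Fubini has been applied; see
    [measurable_osc]. *)
Lemma weightN d e (x : 'rV[R]_d) : weight e x * weight (- e) x = 1.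
Proof.
rewrite /weight -big_split big1//= => i _.
by rewrite /exp_weight mulNr opprK -expRD addNr expR0.
Qed.

Definition phase (d : nat) (x xi : 'rV[R]_d) : R := 2 * pi * dotp x xi.

Lemma phaseC d (x y : 'rV[R]_d) : phase x y = phase y x.
Proof. by congr (_ * _); apply: eq_bigr => i _; rewrite mulrC. Qed.

Lemma phaseBl d (x y z : 'rV[R]_d) : phase (x - y) z = phase x z - phase y z.
Proof.
rewrite /phase -mulrBr -sumrB; congr (_ * _); apply: eq_bigr => i _.
by rewrite !mxE mulrBl.
Qed.

Lemma measurable_phase dd (T : measurableType dd) d (f g : T -> 'rV[R]_d) :
  measurable_fun setT f -> measurable_fun setT g ->
  measurable_fun setT (fun t => phase (f t) (g t)).
Proof. by move=> mf mg; apply: measurable_funM => //; exact: measurable_dotp. Qed.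

Lemma measurable_cos dd (T : measurableType dd) (f : T -> R) :
  measurable_fun setT f -> measurable_fun setT (fun t => cos (f t)).
Proof.
move=> mf; apply: measurableT_comp mf.
by apply: continuous_measurable_fun => x; exact: continuous_cos.
Qed.

Lemma measurable_sin dd (T : measurableType dd) (f : T -> R) :
  measurable_fun setT f -> measurable_fun setT (fun t => sin (f t)).
Proof.
move=> mf; apply: measurableT_comp mf.
by apply: continuous_measurable_fun => x; exact: continuous_sin.
Qed.

Lemma integ_mul_cos dd (T : measurableType dd) (m : {measure set T -> \bar R})
    (f h : T -> R) : m.-integrable setT (EFin \o f) -> measurable_fun setT h ->
  m.-integrable setT (EFin \o (fun x => f x * cos (h x))).
Proof. by move=> fi mh; apply: (integ_mulb fi (measurable_cos mh)) => x; exact: cos_max. Qed.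

Lemma integ_mul_sin dd (T : measurableType dd) (m : {measure set T -> \bar R})
    (f h : T -> R) : m.-integrable setT (EFin \o f) -> measurable_fun setT h ->
  m.-integrable setT (EFin \o (fun x => f x * sin (h x))).
Proof. by move=> fi mh; apply: (integ_mulb fi (measurable_sin mh)) => x; exact: sin_max. Qed.

Definition kernel (d : nat) (e : R) (z : 'rV[R]_d) : R := \prod_i cauchy_kernel e (z 0 i).

(** Both integrals are computed in one induction on the dimension, because the addition formulas mix
    sine and cosine. The terms with a sine in the last coordinate vanish by parity. *)
Lemma Rint_weight_cos_sin d e (z : 'rV[R]_d) : 0 < e ->
  \int[leb]_x (weight e x * cos (phase z x)) = kernel e z /\
  \int[leb]_x (weight e x * sin (phase z x)) = 0.
Proof.
move=> e0; elim: d z => [|d IH] z.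
  rewrite /Rintegral !integral_leb0 /= /phase /dotp big_ord0 mulr0 cos0 sin0 mulr0.
  by rewrite /weight /kernel !big_ord0 mulr1.
pose z' : 'rV[R]_d := \row_j z 0 (lift ord_max j).
pose a := 2 * pi * z 0 ord_max.
have pz (x : 'rV[R]_d) t : phase z (join_pt (x, t)) = phase z' x + a * t.
  rewrite /phase /dotp sum_lift_max join_pt_max mulrDr; congr (_ + _).
    by congr (_ * _); apply: eq_bigr => j _; rewrite join_pt_lift mxE.
  by rewrite mulrA.
have wi := integrable_weight d.+1 e0.
have mph (n : nat) (y : 'rV[R]_n) : measurable_fun setT (phase y).
  by apply: measurable_phase => //; exact: measurable_cst.
have wi' := integrable_weight d e0.
have wc := integ_mul_cos wi' (mph _ z'); have ws := integ_mul_sin wi' (mph _ z').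
have ec := integrable_exp_weight_cos a e0; have es := integrable_exp_weight_sin a e0.
have [IHc IHs] := IH z'.
split.
- rewrite leb_Rfubini; last 2 first.
  + exact: (integ_mul_cos wi (mph _ z)).
  + move=> x; rewrite (_ : (fun t => _) =
      fun t => weight e x * exp_weight e t * cos (phase z' x + a * t)); last first.
      by apply/funext => t; rewrite weight_join pz.
    apply: integ_mul_cos; first exact/integZ/integrable_exp_weight.
    by apply: measurable_funD => //; exact: measurable_funM.
  under eq_Rintegral => x _.
    rewrite (_ : Rintegral _ _ _ = \int[mu]_t ((weight e x * cos (phase z' x)) *
        (exp_weight e t * cos (a * t))
        - (weight e x * sin (phase z' x)) * (exp_weight e t * sin (a * t)))).
      rewrite RintB; [|exact: integZ|exact: integZ].
      rewrite RintZ// RintZ// Rint_exp_weight_cos// Rint_exp_weight_sin// mulr0 subr0.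
      rewrite mulrC; over.
    by apply: eq_Rintegral => t _; rewrite weight_join pz cosD; ring.
  by rewrite RintZ// IHc /kernel prod_lift_max mulrC; congr (_ * _);
     apply: eq_bigr => j _; rewrite mxE.
- rewrite leb_Rfubini; last 2 first.
  + exact: (integ_mul_sin wi (mph _ z)).
  + move=> x; rewrite (_ : (fun t => _) =
      fun t => weight e x * exp_weight e t * sin (phase z' x + a * t)); last first.
      by apply/funext => t; rewrite weight_join pz.
    apply: integ_mul_sin; first exact/integZ/integrable_exp_weight.
    by apply: measurable_funD => //; exact: measurable_funM.
  under eq_Rintegral => x _.
    rewrite (_ : Rintegral _ _ _ = \int[mu]_t ((weight e x * sin (phase z' x)) *
        (exp_weight e t * cos (a * t))
        + (weight e x * cos (phase z' x)) * (exp_weight e t * sin (a * t)))).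
      rewrite RintD; [|exact: integZ|exact: integZ].
      rewrite RintZ// RintZ// Rint_exp_weight_cos// Rint_exp_weight_sin// mulr0 addr0.
      rewrite mulrC; over.
    by apply: eq_Rintegral => t _; rewrite weight_join pz sinD; ring.
  by rewrite RintZ// IHs mulr0.
Qed.

Lemma continuous_cauchy_kernel e : 0 < e -> continuous (@cauchy_kernel R e).
Proof.
move=> e0 z.
apply: (@continuousM R R (cst (2 * e)) (fun z => (e ^+ 2 + (2 * pi * z) ^+ 2)^-1)).
  exact: cst_continuous.
apply: cvgV; first by rewrite gt_eqF// ltr_wpDr ?sqr_ge0// exprn_gt0.
apply: (@derivable_continuous R (fun z => e ^+ 2 + (2 * pi * z) ^+ 2)).
exact: ex_derive.
Qed.

Lemma measurable_cauchy_kernel e : 0 < e -> measurable_fun setT (@cauchy_kernel R e).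
Proof. by move=> e0; apply: continuous_measurable_fun; exact: continuous_cauchy_kernel. Qed.

Lemma kernel_ge0 d e (z : 'rV[R]_d) : 0 < e -> 0 <= kernel e z.
Proof. by move=> e0; apply: prodr_ge0 => i _; exact: cauchy_kernel_ge0. Qed.

Lemma measurable_kernel d e : 0 < e -> measurable_fun setT (@kernel d e).
Proof.
move=> e0; apply: measurable_prod => i _.
exact: (measurableT_comp (measurable_cauchy_kernel e0) (@measurable_coord R _ i)).
Qed.

Lemma integral_kernel d e (x : 'rV[R]_d) : 0 < e ->
  (\int[leb]_y (kernel e (x - y))%:E = 1)%E.
Proof.
move=> e0.
have := @integral_leb_prod d (fun i t => cauchy_kernel e (x 0 i - t)) (fun=> 1).
rewrite prodr_const expr1n => <-.
- by apply: eq_integral => y _; congr EFin; apply: eq_bigr => i _; rewrite !mxE.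
- move=> i; apply: (measurableT_comp (measurable_cauchy_kernel e0)).
  by apply: measurable_funB.
- by move=> i t; exact: cauchy_kernel_ge0.
- by move=> i; exact: integral_cauchy_kernel.
Qed.

End leb_products.

(** * Cosine and sine transforms of integrable functions, and Schur's test *)

Section plancherel.
Variables (R : realType) (d : nat).
Implicit Types (f g phi : 'rV[R]_d -> R) (x y xi : 'rV[R]_d) (p : 'rV[R]_d * 'rV[R]_d).

(** For real [f] the Fourier transform is [cosT f - i * sinT f]; this real pair stands for it until
    distributions enter. *)
Definition cosT f xi : R := \int[leb]_x (f x * cos (phase x xi)).
Definition sinT f xi : R := \int[leb]_x (f x * sin (phase x xi)).

Lemma measurable_phase_l x : measurable_fun setT (phase x).
Proof. by apply: measurable_phase => //; exact: measurable_cst. Qed.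

Lemma measurable_phase_r xi : measurable_fun setT (fun x => phase x xi).
Proof. by apply: measurable_phase => //; exact: measurable_cst. Qed.

Lemma integ_pair f g (h : 'rV[R]_d * 'rV[R]_d -> R) (M : R) :
  integ f -> integ g -> measurable_fun setT h -> (forall p, `|h p| <= M) ->
  (@sleb R d \x @sleb R d)%E.-integrable setT (EFin \o (fun p => f p.1 * g p.2 * h p)).
Proof.
move=> fi gi mh hM; have fgi := @integ_prod_mul _ _ _ _ _ (@sleb R d) (@sleb R d) f g fi gi.
apply: integ_le (integZ M (integ_abs fgi)).
  by apply: measurable_funM => //; exact: integ_measurable fgi.
by move=> p; rewrite normrM mulrC ler_wpM2r.
Qed.

(** * Integrals against a bounded function of the phase, cosine and sine alike *)

Section oscillatory_integrals.
Variable c : R -> R.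
Hypotheses (mc : measurable_fun setT c) (c1 : forall t, `|c t| <= 1).
Local Notation osc f := (fun xi => \int[leb]_x (f x * c (phase x xi))).

Lemma integ_osc f xi : integ f -> integ (fun x => f x * c (phase x xi)).
Proof.
move=> fi; apply: (integ_mulb (M := 1) fi) => [|x]; last exact: c1.
exact: measurableT_comp mc (measurable_phase_r xi).
Qed.

Lemma norm_osc f xi : integ f -> `|osc f xi| <= \int[leb]_x `|f x|.
Proof.
move=> fi; apply: (le_trans (Rint_norm (integ_osc xi fi))).
apply: Rint_le; [exact/integ_abs/integ_osc|exact: integ_abs|move=> x].
by rewrite normrM ler_piMr.
Qed.

Lemma oscB f g xi : integ f -> integ g ->
  osc (fun x => f x - g x) xi = osc f xi - osc g xi.
Proof.
move=> fi gi; rewrite -RintB; [|exact: integ_osc|exact: integ_osc].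
by apply: eq_Rintegral => x _; rewrite mulrBl.
Qed.

Lemma measurable_osc_pair : measurable_fun setT
  (fun p => c (phase p.1 p.2)).
Proof. by apply: measurableT_comp mc _; exact: measurable_phase. Qed.

(* [xi |-> \int f x c (phase x xi)] need not be integrable on the product, so
   Fubini is applied after multiplication by an integrable positive weight. *)
Lemma measurable_osc f : integ f -> measurable_fun setT (osc f).
Proof.
move=> fi; have wi := @integrable_weight R d 1 ltr01.
have gi := integ_pair wi fi measurable_osc_pair (fun p => c1 _).
have := integ_fubini1 gi => /(_ _)/integ_measurable m.
have -> : osc f = fun xi => weight (- 1) xi *
    \int[@sleb R d]_x (weight 1 xi * f x * c (phase xi x)).
  apply/funext => xi.
  have -> : \int[@sleb R d]_x (weight 1 xi * f x * c (phase xi x)) =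
      weight 1 xi * osc f xi.
    rewrite -RintZ; last exact: integ_osc.
    by apply: eq_Rintegral => x _; rewrite phaseC mulrA.
  by rewrite mulrA [_ * weight 1 xi]mulrC weightN mul1r.
apply: measurable_funM; first exact: measurable_weight.
apply: m => xi; rewrite /=; under eq_fun do rewrite phaseC.
by apply: (@integ_osc (fun x => weight 1 xi * f x)); exact: integZ.
Qed.

(** The multiplication formula: the phase is symmetric, and [f x * phi y * c (phase x y)] is
    integrable on the product because [c] is bounded. *)
Lemma Rint_osc f phi : integ f -> integ phi ->
  \int[leb]_x (f x * osc phi x) = \int[leb]_x (osc f x * phi x).
Proof.
move=> fi pi.
have gi := integ_pair fi pi measurable_osc_pair (fun p => c1 _).
transitivity (\int[@sleb R d]_x \int[@sleb R d]_y (f x * phi y * c (phase x y))).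
  apply: eq_Rintegral => x _; rewrite -RintZ; last exact: integ_osc.
  by apply: eq_Rintegral => y _; rewrite phaseC mulrA.
rewrite (RFubini gi).
- apply: eq_Rintegral => y _; rewrite mulrC -RintZ; last exact: integ_osc.
  by apply: eq_Rintegral => x _ /=; ring.
- move=> x; rewrite /=; under eq_fun do rewrite phaseC.
  by apply: (@integ_osc (fun y => f x * phi y)); exact: integZ.
- move=> y; apply: (@integ_osc (fun x => f x * phi y)).
  by under eq_fun do rewrite mulrC; exact: integZ.
Qed.

End oscillatory_integrals.

Lemma integ_cosT f xi : integ f -> integ (fun x => f x * cos (phase x xi)).
Proof. exact: integ_osc (measurable_cos (@measurable_id _ R setT)) (@cos_max R) _ _. Qed.

Lemma norm_cosT f xi : integ f -> `|cosT f xi| <= \int[leb]_x `|f x|.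
Proof. exact: norm_osc (measurable_cos (@measurable_id _ R setT)) (@cos_max R) _ _. Qed.

Lemma cosTB f g xi : integ f -> integ g ->
  cosT (fun x => f x - g x) xi = cosT f xi - cosT g xi.
Proof. exact: oscB (measurable_cos (@measurable_id _ R setT)) (@cos_max R) _ _ _. Qed.

Lemma measurable_cosT f : integ f -> measurable_fun setT (cosT f).
Proof. exact: measurable_osc (measurable_cos (@measurable_id _ R setT)) (@cos_max R) _. Qed.

Lemma Rint_cosT f phi : integ f -> integ phi ->
  \int[leb]_x (f x * cosT phi x) = \int[leb]_x (cosT f x * phi x).
Proof. exact: Rint_osc (measurable_cos (@measurable_id _ R setT)) (@cos_max R) _ _. Qed.

Lemma integ_sinT f xi : integ f -> integ (fun x => f x * sin (phase x xi)).
Proof. exact: integ_osc (measurable_sin (@measurable_id _ R setT)) (@sin_max R) _ _. Qed.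

Lemma norm_sinT f xi : integ f -> `|sinT f xi| <= \int[leb]_x `|f x|.
Proof. exact: norm_osc (measurable_sin (@measurable_id _ R setT)) (@sin_max R) _ _. Qed.

Lemma sinTB f g xi : integ f -> integ g ->
  sinT (fun x => f x - g x) xi = sinT f xi - sinT g xi.
Proof. exact: oscB (measurable_sin (@measurable_id _ R setT)) (@sin_max R) _ _ _. Qed.

Lemma measurable_sinT f : integ f -> measurable_fun setT (sinT f).
Proof. exact: measurable_osc (measurable_sin (@measurable_id _ R setT)) (@sin_max R) _. Qed.

Lemma Rint_sinT f phi : integ f -> integ phi ->
  \int[leb]_x (f x * sinT phi x) = \int[leb]_x (sinT f x * phi x).
Proof. exact: Rint_osc (measurable_sin (@measurable_id _ R setT)) (@sin_max R) _ _. Qed.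

(** Each factor is largest at 0, where it equals [2 / e]. Boundedness makes the products of the
    kernel with integrable functions integrable. *)
Lemma kernel_le e (z : 'rV[R]_d) : 0 < e -> `|kernel e z| <= (2 / e) ^+ d.
Proof.
move=> e0; rewrite ger0_norm ?kernel_ge0// /kernel.
rewrite -[in leRHS](card_ord d) -prodr_const; apply: ler_prod => i _.
rewrite cauchy_kernel_ge0//= /cauchy_kernel.
rewrite (_ : 2 / e = 2 * e / e ^+ 2); last by field; lra.
rewrite ler_wpM2l ?mulr_ge0 ?(ltW e0)// lef_pV2 ?posrE ?exprn_gt0//.
  by rewrite lerDl sqr_ge0.
by rewrite ltr_wpDr ?sqr_ge0// exprn_gt0.
Qed.

Lemma kernelC e x y : kernel e (x - y) = kernel e (y - x).
Proof.
apply: eq_bigr => i _; rewrite !mxE /cauchy_kernel.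
by congr (_ / (_ + _)); rewrite -sqrrN; congr (_ ^+ 2); ring.
Qed.

Lemma measurable_kernelB e : 0 < e -> measurable_fun setT
  (fun p => kernel e (p.1 - p.2)).
Proof.
move=> e0; have mB : measurable_fun setT (fun p => p.1 - p.2).
  apply: measurable_rVP => i; under eq_fun do rewrite !mxE.
  by apply: measurable_funB; apply: measurable_coord_comp.
exact: (measurableT_comp (@measurable_kernel R d e e0) mB).
Qed.

Lemma integ_kernel e x : 0 < e -> integ (fun y => kernel e (x - y)).
Proof.
move=> e0; apply: integ_lty.
- have mB : measurable_fun setT (fun y : 'rV[R]_d => x - y).
    apply: measurable_rVP => i; under eq_fun do rewrite !mxE.
    by apply: measurable_funB => //; exact: measurable_coord.
  exact: (measurableT_comp (@measurable_kernel R d e e0) mB).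
- by move=> y; exact: kernel_ge0.
- by rewrite integral_kernel// ltry.
Qed.

(** Schur's test: [f x * f y] is at most half of [f x ^+ 2 + f y ^+ 2], and the symmetric kernel has
    integral 1 in either variable. *)
Lemma schur_kernel f e : 0 < e -> integ f -> sqint leb f ->
  \int[leb]_x (f x * \int[leb]_y (f y * kernel e (x - y))) <= nsq leb f.
Proof.
move=> e0 fi [mf f2].
have mK := measurable_kernelB e0; have bK z := @kernel_le e z e0.
have Ki x := integ_kernel x e0.
have mf1 : measurable_fun setT (fun p => f p.1).
  exact: (measurableT_comp mf).
have mf2 : measurable_fun setT (fun p => f p.2).
  exact: (measurableT_comp mf).
have slice x g : integ g -> integ (fun y => g y * kernel e (x - y)).
  move=> gi; apply: (integ_mulb gi (integ_measurable (Ki x))) => y.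
  exact: bK.
pose h1 p := f p.1 ^+ 2 * kernel e (p.1 - p.2).
pose h2 p := f p.2 ^+ 2 * kernel e (p.1 - p.2).
have K1 x : \int[leb]_y kernel e (x - y) = 1.
  by rewrite /Rintegral integral_kernel.
have K0 z := @kernel_ge0 R d e z e0.
have h1i : (@sleb R d \x @sleb R d)%E.-integrable setT (EFin \o h1).
  apply/integrable12ltyP.
    by apply/measurable_EFinP/measurable_funM => //; exact: measurable_funX.
  rewrite (_ : (\int[_]_x _)%E = \int[@leb R d]_x (f x ^+ 2)%:E)%E.
    by rewrite -EFin_Rint// ltry.
  apply: eq_integral => x _.
  transitivity (\int[@leb R d]_y (f x ^+ 2 * kernel e (x - y))%:E)%E.
    by apply: eq_integral => y _; rewrite /= ger0_norm// mulr_ge0 ?sqr_ge0.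
  rewrite -EFin_Rint; last exact: integZ.
  by rewrite RintZ// K1 mulr1.
(* Here the inner integral has to run over [x], so that [f y ^+ 2] comes out of it; symmetry of the
   kernel then gives integral 1. *)
have h2i : (@sleb R d \x @sleb R d)%E.-integrable setT (EFin \o h2).
  apply/integrable21ltyP.
    by apply/measurable_EFinP/measurable_funM => //; exact: measurable_funX.
  rewrite (_ : (\int[_]_x _)%E = \int[@leb R d]_x (f x ^+ 2)%:E)%E.
    by rewrite -EFin_Rint// ltry.
  apply: eq_integral => y _.
  transitivity (\int[@leb R d]_x (f y ^+ 2 * kernel e (y - x))%:E)%E.
    by apply: eq_integral => x _; rewrite /h2 /= (kernelC e x y) ger0_norm// mulr_ge0 ?sqr_ge0.
  rewrite -EFin_Rint; last exact: integZ.
  by rewrite RintZ// K1 mulr1.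
have Ki' y : integ (fun x => kernel e (x - y)).
  by under eq_fun do rewrite kernelC; exact: Ki.
have s1 x : integ (fun y => h1 (x, y)) by exact: (integZ (f x ^+ 2) (Ki x)).
have s2 x : integ (fun y => h2 (x, y)) by exact: (slice x _ f2).
have s2' y : integ (fun x => h2 (x, y)) by exact: (integZ (f y ^+ 2) (Ki' y)).
pose h p := 2^-1 * (h1 p + h2 p).
have hi : (@sleb R d \x @sleb R d)%E.-integrable setT (EFin \o h).
  exact: (integZ 2^-1 (integD h1i h2i)).
have sh x : integ (fun y => h (x, y)) by exact: (integZ 2^-1 (integD (s1 x) (s2 x))).
pose g p := f p.1 * f p.2 * kernel e (p.1 - p.2).
have gh p : `|g p| <= h p.
  rewrite /g /h /h1 /h2 normrM (ger0_norm (K0 _)) -mulrDl mulrA ler_wpM2r//.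
  have := sqr_ge0 (f p.1 + f p.2); have := sqr_ge0 (f p.1 - f p.2).
  by rewrite sqrrB sqrrD ler_norml => *; apply/andP; split; lra.
have gi : (@sleb R d \x @sleb R d)%E.-integrable setT (EFin \o g).
  by apply: integ_le hi => //; apply: measurable_funM => //; exact: measurable_funM.
have sg x : integ (fun y => g (x, y)).
  rewrite (_ : (fun y => g (x, y)) = fun y => f x * (f y * kernel e (x - y))).
    exact/integZ/slice.
  by apply/funext => y; rewrite mulrA.
rewrite (_ : Rintegral _ _ _ = \int[leb]_x \int[leb]_y g (x, y)); last first.
  apply: eq_Rintegral => x _; rewrite -RintZ; last exact: slice.
  by apply: eq_Rintegral => y _; rewrite mulrA.
apply: (@le_trans _ _ (\int[leb]_x \int[leb]_y h (x, y))).
  apply: Rint_le.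
  - exact: (@integ_fubini1 _ _ _ _ _ (@sleb R d) (@sleb R d) g gi sg).
  - exact: (@integ_fubini1 _ _ _ _ _ (@sleb R d) (@sleb R d) h hi sh).
  - by move=> x; apply: Rint_le => // y; exact: le_trans (ler_norm _) (gh _).
have I1 := @integ_fubini1 _ _ _ _ _ (@sleb R d) (@sleb R d) h1 h1i s1.
have I2 := @integ_fubini1 _ _ _ _ _ (@sleb R d) (@sleb R d) h2 h2i s2.
have -> : \int[leb]_x \int[leb]_y h (x, y) =
    2^-1 * (\int[leb]_x \int[leb]_y h1 (x, y) + \int[leb]_x \int[leb]_y h2 (x, y)).
  rewrite -RintD// -RintZ; last exact: integD.
  apply: eq_Rintegral => x _; rewrite RintZ; last exact: integD.
  by rewrite RintD.
have -> : \int[leb]_x \int[leb]_y h1 (x, y) = nsq leb f.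
  by apply: eq_Rintegral => x _; rewrite /h1 /= RintZ// K1 mulr1.
have -> : \int[leb]_x \int[leb]_y h2 (x, y) = nsq leb f.
  transitivity (\int[@leb R d]_y \int[@leb R d]_x h2 (x, y)).
    exact: (@RFubini _ _ _ _ _ (@sleb R d) (@sleb R d) h2 h2i s2 s2').
  apply: eq_Rintegral => y _; rewrite /h2 /= RintZ; last exact: Ki'.
  by under eq_Rintegral do rewrite kernelC; rewrite /= K1 mulr1.
by rewrite le_eqVlt; apply/orP; left; apply/eqP; field.
Qed.

End plancherel.

Lemma sqr_le_norm (R : realDomainType) (x M : R) : `|x| <= M -> x ^+ 2 <= M ^+ 2.
Proof.
move=> xM; rewrite -real_normK ?num_real//; apply: lerXn2r => //.
by rewrite nnegrE (le_trans _ xM).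
Qed.

Lemma cvg_prod_seq (R : realType) (I : Type) (s : seq I) (F : I -> nat -> R) (l : I -> R) :
  (forall i, F i k @[k --> \oo] --> l i) ->
  \prod_(i <- s) F i k @[k --> \oo] --> \prod_(i <- s) l i.
Proof.
move=> Fl; elim: s => [|i s IH].
  by rewrite big_nil; under eq_fun do rewrite big_nil; exact: cvg_cst.
rewrite big_cons; under eq_fun do rewrite big_cons.
by apply: cvgM.
Qed.

Section plancherel_ineq.
Variables (R : realType) (d : nat).
Implicit Types (f g phi U : 'rV[R]_d -> R) (x y xi : 'rV[R]_d) (p : 'rV[R]_d * 'rV[R]_d).

(** The squares are opened one factor at a time, so that Fubini is applied twice to pairs of
    variables in place of a triple integral. The result is the quadratic form of the kernel, which
    [schur_kernel] bounds. *)
Lemma plancherel_weight f e : 0 < e -> integ f -> sqint leb f ->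
  integ (fun xi => weight e xi * (cosT f xi ^+ 2 + sinT f xi ^+ 2)) /\
  \int[leb]_xi (weight e xi * (cosT f xi ^+ 2 + sinT f xi ^+ 2)) <= nsq leb f.
Proof.
move=> e0 fi f2; have wi := @integrable_weight R d e e0.
have mC := measurable_cosT fi; have mS := measurable_sinT fi.
pose M := \int[leb]_x `|f x|.
have bC xi : `|cosT f xi| <= M by exact: norm_cosT.
have bS xi : `|sinT f xi| <= M by exact: norm_sinT.
have M0 : 0 <= M by exact: Rint_ge0.
split.
  apply: (integ_mulb (M := M ^+ 2 + M ^+ 2)) => //.
    by apply: measurable_funD; exact: measurable_funX.
  move=> xi; rewrite ger0_norm ?addr_ge0 ?sqr_ge0//.
  by apply: lerD; apply: sqr_le_norm.
(* One factor of each square becomes an integral in [x]; the other stays as [cosT f] or [sinT f],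
   bounded by the $L^1$ norm [M], which keeps the integrand integrable on the product. *)
pose h1 p :=
  cos (phase p.2 p.1) * cosT f p.1 + sin (phase p.2 p.1) * sinT f p.1.
have mph : measurable_fun setT (fun p => phase p.2 p.1).
  exact: measurable_phase.
have mC1 : measurable_fun setT (fun p => cosT f p.1).
  exact: (measurableT_comp mC).
have mS1 : measurable_fun setT (fun p => sinT f p.1).
  exact: (measurableT_comp mS).
have mh1 : measurable_fun setT h1.
  by apply: measurable_funD; apply: measurable_funM => //;
     [exact: measurable_cos|exact: measurable_sin].
have bh1 p : `|h1 p| <= M + M.
  rewrite (le_trans (ler_normD _ _))// lerD// normrM.
    by rewrite (le_trans _ (bC p.1))// ler_piMl// cos_max.
  by rewrite (le_trans _ (bS p.1))// ler_piMl// sin_max.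
have g1i := integ_pair wi fi mh1 bh1.
have E1 : \int[leb]_xi (weight e xi * (cosT f xi ^+ 2 + sinT f xi ^+ 2)) =
    \int[@sleb R d]_xi \int[@sleb R d]_x (weight e xi * f x * h1 (xi, x)).
  apply: eq_Rintegral => xi _.
  transitivity (\int[@leb R d]_x (weight e xi * (cosT f xi * (f x * cos (phase x xi)) +
      sinT f xi * (f x * sin (phase x xi))))).
    rewrite RintZ; last by apply: integD; apply: integZ; [exact: integ_cosT|exact: integ_sinT].
    rewrite RintD; [|exact/integZ/integ_cosT|exact/integZ/integ_sinT].
    rewrite RintZ; last exact: integ_cosT.
    by rewrite RintZ; last exact: integ_sinT.
  by apply: eq_Rintegral => x _; rewrite /h1 /=; ring.
have s1 xi : integ (fun x => weight e xi * f x * h1 (xi, x)).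
  apply: (integ_mulb (M := M + M)); [exact: integZ| |by move=> x; exact: bh1].
  apply: measurable_funD; apply: measurable_funM.
  - exact: (measurable_cos (measurable_phase_r xi)).
  - by rewrite /=; exact: measurable_cst.
  - exact: (measurable_sin (measurable_phase_r xi)).
  - by rewrite /=; exact: measurable_cst.
have s1' x : integ (fun xi => weight e xi * f x * h1 (xi, x)).
  apply: (integ_mulb (M := M + M)); [| |by move=> xi; exact: bh1].
    by under eq_fun do rewrite mulrC; exact: integZ.
  apply: measurable_funD; apply: measurable_funM => //.
    exact: (measurable_cos (measurable_phase_l x)).
  exact: (measurable_sin (measurable_phase_l x)).
have mphB x : measurable_fun setT
    (fun p => cos (phase (x - p.2) p.1)).
  apply/measurable_cos/measurable_phase => //.
  apply: measurable_rVP => i; under eq_fun do rewrite !mxE.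
  by apply: measurable_funB => //; exact: measurable_coord_comp.
(* For fixed [x] the remaining transforms are opened. The subtraction formula merges the phases into
   that of [x - y], and integrating in [xi] first yields the kernel. *)
have E2 x : \int[@sleb R d]_xi (weight e xi * f x * h1 (xi, x)) =
    f x * \int[leb]_y (f y * kernel e (x - y)).
  transitivity (\int[@leb R d]_xi (f x * (weight e xi * h1 (xi, x)))).
    by apply: eq_Rintegral => xi _; ring.
  have wh1 : integ (fun xi => weight e xi * h1 (xi, x)).
    apply: (integ_mulb wi _ (fun xi => bh1 (xi, x))).
    apply: measurable_funD; apply: measurable_funM => //.
      exact: (measurable_cos (measurable_phase_l x)).
    exact: (measurable_sin (measurable_phase_l x)).
  rewrite RintZ//; congr (_ * _).
  have g2i := integ_pair wi fi (mphB x) (fun p => cos_max _).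
  transitivity (\int[@sleb R d]_xi \int[@sleb R d]_y
      (weight e xi * f y * cos (phase (x - y) xi))).
    apply: eq_Rintegral => xi _.
    transitivity (\int[@leb R d]_y (weight e xi *
        (cos (phase x xi) * (f y * cos (phase y xi)) +
         sin (phase x xi) * (f y * sin (phase y xi))))).
      rewrite RintZ; last by apply: integD; apply: integZ; [exact: integ_cosT|exact: integ_sinT].
      rewrite RintD; [|exact/integZ/integ_cosT|exact/integZ/integ_sinT].
      rewrite RintZ; last exact: integ_cosT.
      by rewrite RintZ; last exact: integ_sinT.
    by apply: eq_Rintegral => y _; rewrite phaseBl cosB; ring.
  transitivity (\int[@sleb R d]_y \int[@sleb R d]_xi
      (weight e xi * f y * cos (phase (x - y) xi))).
    apply: (@RFubini _ _ _ _ _ (@sleb R d) (@sleb R d)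
      (fun p => weight e p.1 * f p.2 * cos (phase (x - p.2) p.1)) g2i).
      move=> xi; apply: (@integ_mul_cos _ _ _ (@leb R d)); first by rewrite /=; exact: integZ.
      apply: measurable_phase => //.
      apply: measurable_rVP => i; under eq_fun do rewrite !mxE.
      by apply: measurable_funB => //; exact: measurable_coord.
    move=> y; apply: (@integ_mul_cos _ _ _ (@leb R d)); last first.
      by rewrite /=; exact: (measurable_phase_l (x - y)).
    by rewrite /=; under eq_fun do rewrite mulrC; exact: integZ.
  apply: eq_Rintegral => y _.
  have [<- _] := Rint_weight_cos_sin (x - y) e0.
  rewrite -RintZ; last first.
    by apply: (@integ_mul_cos _ _ _ (@leb R d)) => //; exact: measurable_phase_l.
  by apply: eq_Rintegral => xi _; ring.
rewrite E1 (@RFubini _ _ _ _ _ (@sleb R d) (@sleb R d)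
  (fun p => weight e p.1 * f p.2 * h1 p) g1i s1 s1').
under eq_Rintegral do rewrite E2.
exact: schur_kernel.
Qed.

Lemma weight_cvg1 (xi : 'rV[R]_d) : weight (k.+1%:R^-1) xi @[k --> \oo] --> (1 : R).
Proof.
rewrite -[X in _ --> X](expr1n R d) -[in X in _ --> X](card_ord d) -prodr_const.
apply: (cvg_prod_seq (F := fun (i : 'I_d) k => exp_weight (k.+1%:R^-1) (xi 0 i))) => i.
have h : - (k.+1%:R^-1 * `|xi 0 i|) @[k --> \oo] --> (0 : R).
  have := cvgN (cvgM (@cvg_harmonic R) (cvg_cst `|xi 0 i|)).
  by rewrite mul0r oppr0; exact.
have := cvg_comp _ _ h (@continuous_expR R 0).
by rewrite expR0; exact.
Qed.

(** Fatou's lemma along [e = 1 / (k + 1)]: the weights tend to 1 pointwise, while the weighted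
    integrals stay below [nsq leb f]. *)
Lemma plancherel_le f : integ f -> sqint leb f ->
  [/\ sqint leb (cosT f), sqint leb (sinT f) &
      nsq leb (cosT f) + nsq leb (sinT f) <= nsq leb f].
Proof.
move=> fi f2.
have mC := measurable_cosT fi; have mS := measurable_sinT fi.
pose q xi := cosT f xi ^+ 2 + sinT f xi ^+ 2.
have mq : measurable_fun setT q by apply: measurable_funD; exact: measurable_funX.
have q0 xi : 0 <= q xi by rewrite addr_ge0 ?sqr_ge0.
have bnd : (\int[leb]_xi (q xi)%:E <= (nsq leb f)%:E)%E.
  have e0 k : 0 < k.+1%:R^-1 :> R by rewrite invr_gt0.
  rewrite (_ : (\int[leb]_xi (q xi)%:E)%E =
    \int[leb]_xi limn_einf (fun k => (weight (k.+1%:R^-1) xi * q xi)%:E))%E; last first.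
    apply: eq_integral => xi _; apply/esym/(cvg_limn_einf_sup _).1.
    apply: cvg_EFin; first exact: nearW.
    rewrite -[X in _ --> X]mul1r; apply: cvgM; [exact: weight_cvg1|exact: cvg_cst].
  apply: le_trans (fatou _ measurableT _ _) _ => //.
  - move=> k; apply/measurable_EFinP/measurable_funM => //; exact: measurable_weight.
  - by move=> k xi _; rewrite lee_fin mulr_ge0// ltW// weight_gt0.
  apply: (limn_einf_le (N := 0)) => k _.
  have [wi wl] := plancherel_weight (e0 k) fi f2.
  by rewrite -EFin_Rint// lee_fin.
have qi : integ q by apply: integ_lty => //; apply: (le_lt_trans bnd); rewrite ltry.
have C2 : sqint leb (cosT f).
  split => //; apply: integ_le qi; first exact: measurable_funX.
  by move=> xi; rewrite ger0_norm ?sqr_ge0// lerDl sqr_ge0.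
have S2 : sqint leb (sinT f).
  split => //; apply: integ_le qi; first exact: measurable_funX.
  by move=> xi; rewrite ger0_norm ?sqr_ge0// lerDr sqr_ge0.
split => //; rewrite /nsq -RintD; [|exact: C2.2|exact: S2.2].
by rewrite -lee_fin EFin_Rint.
Qed.

End plancherel_ineq.

Lemma Rint_dominated (disp : measure_display) (T : measurableType disp) (R : realType)
    (mu : {measure set T -> \bar R}) (F : nat -> T -> R) (f g : T -> R) :
  (forall k, measurable_fun setT (F k)) -> measurable_fun setT f ->
  (forall x, F k x @[k --> \oo] --> f x) -> mu.-integrable setT (EFin \o g) ->
  (forall k x, `|F k x| <= g x) ->
  mu.-integrable setT (EFin \o f) /\
  (\int[mu]_x F k x) @[k --> \oo] --> \int[mu]_x f x.
Proof.
move=> mF mf Ff gi Fg.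
have FfE x : (F k x)%:E @[k --> \oo] --> (f x)%:E.
  by apply: cvg_EFin; [exact: nearW|exact: Ff].
have FgE x k : (`|(F k x)%:E| <= (g x)%:E)%E by rewrite lee_fin.
have [fi _ h] := @dominated_convergence _ _ _ mu setT measurableT
  (fun k => EFin \o F k) (EFin \o f) (EFin \o g)
  (fun k => (measurable_EFinP _ _).2 (mF k)) ((measurable_EFinP _ _).2 mf)
  (aeW mu (fun x _ => FfE x)) gi
  (aeW mu (fun x k _ => FgE x k)).
split => //.
have Fi k : mu.-integrable setT (EFin \o F k) by exact: integ_le gi.
have h2 : (\int[mu]_x (F k x)%:E)%E @[k --> \oo] --> (\int[mu]_x f x)%:E.
  by rewrite EFin_Rint.
exact: fine_cvg h2.
Qed.

(** * The transform of a square integrable function *)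

Section fourier_L2.
Variables (R : realType) (d : nat).
Implicit Types (f g phi U : 'rV[R]_d -> R) (x y xi : 'rV[R]_d).

Definition cut U (k : nat) : 'rV[R]_d -> R := fun x => U x * \1_(cube k%:R) x.

Lemma measurable_indic_cube (k : nat) :
  measurable_fun setT (\1_(cube k%:R : set 'rV[R]_d) : _ -> R).
Proof. by apply: measurable_indic; exact: measurable_obox. Qed.

Lemma integ_indic_cube (k : nat) : integ (\1_(cube k%:R : set 'rV[R]_d) : _ -> R).
Proof.
apply: integ_lty; [exact: measurable_indic_cube|by move=> x|].
by rewrite integral_indic ?setIT//; [exact: leb_obox_lty|exact: measurable_obox].
Qed.

Lemma sqint_cut U k : sqint leb U -> sqint leb (cut U k).
Proof.
move=> U2; have [mU _] := U2; apply: sqint_le U2.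
  by apply: measurable_funM => //; exact: measurable_indic_cube.
move=> x; rewrite /cut indicE normrM; case: (_ \in _); rewrite ?normr1 ?mulr1//.
by rewrite normr0 mulr0.
Qed.

(** A cube has finite measure, and on it [|U|] is at most [U ^+ 2 + 1]. *)
Lemma integ_cut U k : sqint leb U -> integ (cut U k).
Proof.
move=> U2; have [mU Ui] := U2.
apply: (@integ_le _ _ _ _ _ (fun x => U x ^+ 2 + \1_(cube k%:R) x)).
- by case: (sqint_cut k U2).
- move=> x; rewrite /cut indicE normrM; case: (_ \in _).
    rewrite /= normr1 mulr1 -(real_normK (num_real (U x))).
    have := sqr_ge0 (`|U x| - 1); rewrite sqrrB expr1n mulr1 => h.
    by have := normr_ge0 (U x); lra.
  by rewrite normr0 mulr0 addr0 sqr_ge0.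
- by apply: integD => //; exact: integ_indic_cube.
Qed.

(** Dominated convergence: at each point the difference is eventually 0, and its square never
    exceeds [U ^+ 2]. *)
Lemma nsq_cut_cvg U : sqint leb U -> nsq leb (fun x => U x - cut U k x) @[k --> \oo] --> 0.
Proof.
move=> U2; have [mU Ui] := U2.
have m k : measurable_fun setT (fun x => (U x - cut U k x) ^+ 2).
  by apply/measurable_funX/measurable_funB => //; case: (sqint_cut k U2).
have E x : (U x - cut U k x) ^+ 2 @[k --> \oo] --> 0.
  have [K _ xK] : (\bigcup_k cube k%:R) x by rewrite bigcup_cube.
  apply: cvg_near_cst; exists K => //= k /= Kk.
  rewrite /cut indicE mem_set ?mulr1 ?subrr ?expr0n//.
  by apply/cubeP => i; move/cubeP/(_ i)/lt_le_trans : xK; apply; rewrite ler_nat.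
have bnd k x : `|(U x - cut U k x) ^+ 2| <= U x ^+ 2.
  rewrite ger0_norm ?sqr_ge0// /cut indicE.
  by case: (_ \in _); rewrite /= ?mulr1 ?mulr0 ?subrr ?subr0 ?expr0n ?sqr_ge0.
have [_ h] := Rint_dominated m (@measurable_cst _ _ _ _ setT (0 : R)) E Ui (fun k x => bnd k x).
by move: h; rewrite /Rintegral integral0.
Qed.

(** [C] and [S] are the $L^2$ limits of the transforms of truncations of [U], which are integrable.
    The multiplication formula holds for the truncations, and both of its sides are continuous in
    $L^2$. *)
Lemma fourier_L2 U : sqint leb U -> exists C S : 'rV[R]_d -> R,
  [/\ sqint leb C, sqint leb S, nsq leb C + nsq leb S <= nsq leb U &
    forall phi, integ phi -> sqint leb phi ->
      \int[leb]_x (U x * cosT phi x) = \int[leb]_x (C x * phi x) /\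
      \int[leb]_x (U x * sinT phi x) = \int[leb]_x (S x * phi x)].
Proof.
move=> U2; have Ucvg := nsq_cut_cvg U2.
(* The quarter absorbs the two factors 2 of [nsqD] when [F m - F k] is estimated through [U]. *)
have r0 k : 0 < 4^-1 * ((2^-1 : R) ^+ k) ^+ 2 by rewrite mulr_gt0// !exprn_gt0.
have [n hn] : {n : nat -> nat & forall k,
    nsq leb (fun x => U x - cut U (n k) x) < 4^-1 * (2^-1 ^+ k) ^+ 2}.
  apply: (@choice _ _ (fun k n => nsq leb (fun x => U x - cut U n x) < 4^-1 * (2^-1 ^+ k) ^+ 2)).
  move=> k; have /cvgrPdist_lt/(_ _ (r0 k))[K _ /(_ K (leqnn K))] := Ucvg.
  by rewrite /= sub0r normrN ger0_norm ?nsq_ge0// => h; exists K.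
pose F k := cut U (n k).
have F2 k : sqint leb (F k) by exact: sqint_cut.
have Fi k : integ (F k) by exact: integ_cut.
have UF2 k : sqint leb (fun x => U x - F k x) by exact: sqintB.
have FF k m : (k <= m)%N -> nsq leb (fun x => F m x - F k x) <= (2^-1 ^+ k) ^+ 2.
  move=> km; have := nsqD (UF2 k) (sqintN (UF2 m)).
  rewrite (_ : (fun x => U x - F k x + - (U x - F m x)) = fun x => F m x - F k x); last by apply/funext => x; ring.
  move=> /le_trans; apply; rewrite nsqN.
  have h1 := ltW (hn k); have h2 := ltW (hn m).
  have h3 : ((2^-1 : R) ^+ m) ^+ 2 <= (2^-1 ^+ k) ^+ 2.
    by rewrite -!exprM ler_wiXn2l ?invr_ge0// ?invf_le1 ?ler1n// leq_mul2r km orbT.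
  by rewrite -/(F k) -/(F m) in h1 h2; lra.
(* By linearity, Plancherel's inequality for [F m - F k] bounds both differences of transforms, so
   that [riesz_fischer] applies to each. *)
have PD k m : [/\ sqint leb (cosT (F k)), sqint leb (sinT (F k)),
    nsq leb (fun xi => cosT (F m) xi - cosT (F k) xi) <= nsq leb (fun x => F m x - F k x) &
    nsq leb (fun xi => sinT (F m) xi - sinT (F k) xi) <= nsq leb (fun x => F m x - F k x)].
  have [C2 S2 _] := plancherel_le (Fi k) (F2 k).
  have [_ _ h] := plancherel_le (integB (Fi m) (Fi k)) (sqintB (F2 m) (F2 k)).
  have EC : cosT (fun x => F m x - F k x) = fun xi => cosT (F m) xi - cosT (F k) xi.
    by apply/funext => xi; exact: cosTB.
  have ES : sinT (fun x => F m x - F k x) = fun xi => sinT (F m) xi - sinT (F k) xi.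
    by apply/funext => xi; exact: sinTB.
  rewrite EC ES in h; split => //; apply: le_trans h.
    by rewrite lerDl nsq_ge0.
  by rewrite lerDr nsq_ge0.
have C2 k : sqint leb (cosT (F k)) by have [] := PD k 0%N.
have S2 k : sqint leb (sinT (F k)) by have [] := PD k 0%N.
have [C [sC cC]] := riesz_fischer C2 (fun k m km =>
  let: And4 _ _ h _ := PD k m in le_trans h (FF k m km)).
have [S [sS cS]] := riesz_fischer S2 (fun k m km =>
  let: And4 _ _ _ h := PD k m in le_trans h (FF k m km)).
have FU : nsq leb (fun x => F k x - U x) @[k --> \oo] --> 0.
  have h4 : 4^-1 * ((2^-1 : R) ^+ k) ^+ 2 @[k --> \oo] --> 0.
    have h : (2^-1 : R) ^+ k @[k --> \oo] --> 0.
      by apply: cvg_expr; rewrite ger0_norm ?invr_ge0// invf_lt1// ltr1n.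
    have h2 := cvgM (cvg_cst (4^-1 : R)) (cvgM h h).
    by rewrite !mulr0 in h2; exact: h2.
  apply: cvg0_le h4 => k; rewrite nsq_ge0 /=.
  rewrite (_ : nsq _ _ = nsq leb (fun x => U x - F k x)) ?(ltW (hn k))//.
  by apply: eq_Rintegral => x _; rewrite -sqrrN opprB.
exists C, S; split => //.
  have h1 : nsq leb (cosT (F k)) + nsq leb (sinT (F k)) @[k --> \oo] -->
      nsq leb C + nsq leb S.
    by apply: cvgD; [exact: nsq_cvg|exact: nsq_cvg].
  apply: (ler_cvg_to h1 (nsq_cvg F2 U2 FU)).
  by apply: nearW => k; have [_ _] := plancherel_le (Fi k) (F2 k).
move=> phi pi p2; have [cp2 sp2 _] := plancherel_le pi p2; split.
  have h1 := nsq_cvg_mul F2 U2 cp2 FU.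
  have h2 := nsq_cvg_mul C2 sC p2 cC.
  have h3 : (fun k => \int[leb]_x (F k x * cosT phi x)) =
            (fun k => \int[leb]_x (cosT (F k) x * phi x)).
    by apply/funext => k; exact: Rint_cosT.
  by rewrite h3 in h1; exact: (cvg_unique _ h1 h2).
have h1 := nsq_cvg_mul F2 U2 sp2 FU.
have h2 := nsq_cvg_mul S2 sS p2 cS.
have h3 : (fun k => \int[leb]_x (F k x * sinT phi x)) =
          (fun k => \int[leb]_x (sinT (F k) x * phi x)).
  by apply/funext => k; exact: Rint_sinT.
by rewrite h3 in h1; exact: (cvg_unique _ h1 h2).
Qed.

End fourier_L2.

(** * Integration by parts against test functions *)

Section directional.
Variable R : realType.

(** A directional derivative depends only on the values along one line. It therefore passes between
    a function and its slices, and to functions that are regular only along that line. *)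
Lemma is_derive_line (V W : normedModType R) (f : V -> R) (g : W -> R) a v c w df :
  (forall h : R, g (h *: w + c) = f (h *: v + a)) ->
  is_derive a v f df -> is_derive c w g df.
Proof.
move=> fg [dfx dfE].
have gc : g c = f a by have := fg 0; rewrite !scale0r !add0r.
have E : (fun h : R => h^-1 *: ((g \o shift c) (h *: w) - g c)) =
         (fun h : R => h^-1 *: ((f \o shift a) (h *: v) - f a)).
  by apply/funext => h; rewrite /= fg gc.
have dg : derivable g c w by rewrite /derivable E.
by apply: (DeriveDef dg); rewrite -dfE /derive E.
Qed.

Lemma Rint_supp (f : R -> R) (M : R) : (forall t, M <= `|t| -> f t = 0) ->
  \int[lebesgue_measure]_t f t = \int[lebesgue_measure]_(t in `[-M, M]) f t.
Proof.
move=> f0; rewrite [RHS]Rintegral_mkcond; apply: eq_Rintegral => t _.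
rewrite patchE; case: ifPn => //; rewrite notin_setE /= in_itv /= => tM.
apply: f0; rewrite leNgt; apply/negP; rewrite ltr_norml => /andP[h1 h2].
by apply: tM; rewrite !ltW.
Qed.

Lemma Rint_deriv_supp (f F : R -> R) (M : R) : 0 < M ->
  (forall t : R, is_derive t 1 F (f t)) -> continuous f ->
  (forall t, M <= `|t| -> F t = 0) -> (forall t, M <= `|t| -> f t = 0) ->
  \int[lebesgue_measure]_t f t = 0.
Proof.
move=> M0 dF cf F0 f0; rewrite (Rint_supp f0).
have cF : continuous F by move=> x; apply: derivable_continuous; have [] := dF x.
rewrite /Rintegral (@continuous_FTC2 _ f F).
- have -> : F M = 0 by apply: F0; exact: ler_norm.
  have -> : F (- M) = 0 by apply: F0; rewrite normrN; exact: ler_norm.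
  by rewrite subee.
- by lra.
- by apply: continuous_subspaceT.
- split.
  + by move=> x _; have [] := dF x.
  + by apply: cvg_at_right_filter; exact: cF.
  + by apply: cvg_at_left_filter; exact: cF.
- by move=> x _; rewrite derive1E; have [] := dF x.
Qed.

Lemma leb_Rfubini2 (d : nat) (f : 'rV[R]_d.+1 -> R) :
  integ f ->
  (forall t, integ (fun x => f (join_pt (x, t)))) ->
  \int[leb]_x f x = \int[lebesgue_measure]_t \int[leb]_x f (join_pt (x, t)).
Proof.
move=> fi fx; rewrite /Rintegral leb_integral_join//
  -(integral21_prod_meas1 (leb_integrable_join fi)); congr fine.
by apply: eq_integral => t _; rewrite fineK//; exact: (integrable_fin_num _ (fx t)).
Qed.

Lemma integ_supp_cube (n : nat) (f : 'rV[R]_n -> R) (M B : R) :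
  measurable_fun setT f -> (forall x, ~ cube M x -> f x = 0) ->
  (forall x, `|f x| <= B) -> integ f.
Proof.
move=> mf f0 fB; have mc : measurable (cube M : set 'rV[R]_n) by exact: measurable_obox.
apply: (@integ_le _ _ _ _ _ (fun x => B * \1_(cube M) x)) => //.
  move=> x; rewrite indicE; have [xc|xc] := pselect (cube M x).
    by rewrite mem_set// mulr1.
  by rewrite memNset// mulr0 f0// normr0.
apply: integZ; apply: integ_lty; first exact: measurable_indic.
  by move=> x.
by rewrite integral_indic// setIT; exact: leb_obox_lty.
Qed.

Lemma sqint_supp_cube (n : nat) (f : 'rV[R]_n -> R) (M B : R) :
  measurable_fun setT f -> (forall x, ~ cube M x -> f x = 0) ->
  (forall x, `|f x| <= B) -> sqint leb f.
Proof.
move=> mf f0 fB; split => //; apply: (integ_supp_cube (M := M) (B := B ^+ 2)).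
- exact: measurable_funX.
- by move=> x cx; rewrite f0// expr0n.
- by move=> x; rewrite normrX lerXn2r ?nnegrE// (le_trans _ (fB x)).
Qed.

Lemma measurable_join_l (d : nat) (t : R) :
  measurable_fun setT (fun x : 'rV[R]_d => join_pt (x, t)).
Proof.
exact: (measurableT_comp (@measurable_join_pt R d) (@pair2_measurable _ _ _ _ t)).
Qed.

Lemma measurable_join_r (d : nat) (x : 'rV[R]_d) :
  measurable_fun setT (fun t : R => join_pt (x, t)).
Proof.
exact: (measurableT_comp (@measurable_join_pt R d) (@pair1_measurable _ _ _ _ x)).
Qed.

Lemma join_cube (d : nat) (M : R) (x : 'rV[R]_d) t :
  cube M (join_pt (x, t)) <-> cube M x /\ `|t| < M.
Proof.
split => [/cubeP h|[/cubeP h1 h2]].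
  split; first by apply/cubeP => i; have := h (lift ord_max i); rewrite join_pt_lift.
  by have := h ord_max; rewrite join_pt_max.
by apply/cubeP; elim/ord_maxP => [|j]; rewrite ?join_pt_max// join_pt_lift.
Qed.

Lemma join_shift_max (d : nat) (x : 'rV[R]_d) t h :
  join_pt (x, h + t) = h *: delta_mx 0 ord_max + join_pt (x, t).
Proof.
apply/rowP; elim/ord_maxP => [|j]; rewrite [RHS]mxE.
  by rewrite !join_pt_max !mxE !eqxx mulr1.
rewrite !join_pt_lift !mxE (_ : (lift ord_max j == ord_max) = false) ?andbF ?mulr0 ?add0r//.
by apply/negbTE; rewrite eq_sym neq_lift.
Qed.

Lemma join_shift_lift (d : nat) (x : 'rV[R]_d) t h j :
  join_pt (h *: delta_mx 0 j + x, t) =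
  h *: delta_mx 0 (lift ord_max j) + join_pt (x, t).
Proof.
apply/rowP; elim/ord_maxP => [|i]; rewrite [RHS]mxE.
  rewrite !join_pt_max !mxE (_ : (ord_max == lift ord_max j) = false) ?andbF ?mulr0 ?add0r//.
  by apply/negbTE; rewrite neq_lift.
by rewrite !join_pt_lift !mxE (inj_eq lift_inj).
Qed.

(** [G] is differentiated in direction [i] only and may jump in other directions, as it does when it
    contains the indicator of the strip; hence the hypotheses on lines. In the last direction the
    fundamental theorem applies on vertical lines; for the others the last coordinate is integrated
    outermost and the induction hypothesis treats the inner integral. *)
Lemma Rint_partial0 (n : nat) (i : 'I_n) (G D : 'rV[R]_n -> R) (M B : R) : 0 < M ->
  (forall x, is_derive x (delta_mx 0 i) G (D x)) ->
  (forall x, continuous (fun s : R => D (s *: delta_mx 0 i + x))) ->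
  measurable_fun setT D -> (forall x, `|D x| <= B) ->
  (forall x, ~ cube M x -> G x = 0) -> (forall x, ~ cube M x -> D x = 0) ->
  \int[leb]_x D x = 0.
Proof.
move=> M0; elim: n i G D => [|d IH] i G D; first by case: i.
move=> dG cD mD bD G0 D0.
have Di : integ D by exact: (integ_supp_cube mD D0 bD).
case: (unliftP ord_max i) => [j ij|im]; subst i.
  rewrite leb_Rfubini2//; last first.
    move=> t; apply: (integ_supp_cube (M := M) (B := B)).
    - exact: (measurableT_comp mD (measurable_join_l t)).
    - by move=> x cx; apply: D0 => /join_cube[].
    - by move=> x; exact: bD.
  have E t : \int[leb]_x D (join_pt (x, t)) = 0.
    refine (IH j (fun x => G (join_pt (x, t))) (fun x => D (join_pt (x, t))) _ _ _ _ _ _).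
    - move=> x; apply: is_derive_line (dG (join_pt (x, t))) => h.
      by rewrite join_shift_lift.
    - move=> x; under eq_fun do rewrite join_shift_lift; exact: cD.
    - exact: (measurableT_comp mD (measurable_join_l t)).
    - by move=> x; exact: bD.
    - by move=> x cx; apply: G0 => /join_cube[].
    - by move=> x cx; apply: D0 => /join_cube[].
  by under eq_Rintegral do rewrite E; rewrite /Rintegral integral0.
have sD (x : 'rV[R]_d) : (fun t => D (join_pt (x, t))) =
    (fun s : R => D (s *: delta_mx 0 ord_max + join_pt (x, 0))).
  by apply/funext => t; rewrite -join_shift_max addr0.
have s0 (x : 'rV[R]_d) t : M <= `|t| -> ~ cube M (join_pt (x, t)).
  by move=> Mt /join_cube[_]; rewrite ltNge Mt.
rewrite leb_Rfubini//; last first.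
  move=> x; apply: (@integ_le _ _ R (@lebesgue_measure R) _ (fun t : R => B * \1_(`[-M, M]%classic) t)).
  - exact: (measurableT_comp mD (measurable_join_r x)).
  - move=> t; rewrite indicE; have [tM|tM] := lerP `|t| M.
      by rewrite mem_set ?mulr1//= in_itv /= -ler_norml.
    by rewrite D0 ?normr0 ?mulr_ge0// ?(le_trans _ (bD 0))//; exact/s0/ltW.
  - by apply: integZ; exact: integrable_indic_itv.
have E (x : 'rV[R]_d) : \int[lebesgue_measure]_t D (join_pt (x, t)) = 0.
  refine (@Rint_deriv_supp (fun t => D (join_pt (x, t))) (fun t => G (join_pt (x, t))) M
    M0 _ _ _ _).
  - move=> t; apply: is_derive_line (dG (join_pt (x, t))) => h.
    by rewrite -join_shift_max [_%:A]mulr1.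
  - by rewrite sD; exact: cD.
  - by move=> t Mt; apply/G0/s0.
  - by move=> t Mt; apply/D0/s0.
by under eq_Rintegral do rewrite E; rewrite /Rintegral integral0.
Qed.

End directional.

(** * Bounds and integration by parts for test functions *)

Section test_functions.
Variables (R : realType) (n : nat).
Implicit Types (f phi chi : 'rV[R]_n -> R) (K D : set 'rV[R]_n).

Lemma smooth_is_derive f (i : 'I_n) x : smooth f ->
  is_derive x (delta_mx 0 i) f (partial i f x).
Proof. by move=> sf; apply: DeriveDef => //; apply: diff_derivable; exact: (sf [::]). Qed.

Lemma smooth_continuous f : smooth f -> continuous f.
Proof. by move=> sf x; apply: differentiable_continuous; exact: (sf [::]). Qed.

Lemma smooth_partial_continuous f (i : 'I_n) : smooth f -> continuous (partial i f).
Proof. by move=> sf x; apply: differentiable_continuous; exact: (sf [:: i]). Qed.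

Lemma continuous_compact_supp_bounded f K : continuous f -> compact K ->
  (forall x, ~ K x -> f x = 0) -> exists2 B, 0 < B & forall x, `|f x| <= B.
Proof.
move=> cf cK f0.
have /compact_bounded[M [_ hM]] : compact (f @` K).
  by apply: continuous_compact => //; exact: continuous_subspaceT.
have M0 : 0 < `|M| + 1 by rewrite ltr_wpDl.
exists (`|M| + 1) => // x; have [Kx|Kx] := pselect (K x).
  by apply: (hM (`|M| + 1)); [rewrite (le_lt_trans (ler_norm M))// ltrDl|exists x].
by rewrite f0// normr0 ltW.
Qed.

(** The complement of a compact set is open, so [f] vanishes in a neighbourhood of [x]. *)
Lemma partial_off_supp f K (i : 'I_n) x : compact K ->
  (forall x, ~ K x -> f x = 0) -> ~ K x -> partial i f x = 0.
Proof.
move=> cK f0 Kx.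
have oK : open (~` K).
  by rewrite openC; apply: compact_closed => //; exact: norm_hausdorff.
rewrite /partial (@near_eq_derive _ _ _ f (cst 0)) ?derive_cst//.
by apply: filterS (open_nbhs_nbhs (conj oK Kx)) => y; exact: f0.
Qed.

Lemma test_fun_bounds D phi : test_fun D phi -> exists M B : R,
  [/\ 0 < M, 0 <= B, forall x, ~ cube M x \/ ~ D x -> phi x = 0,
    forall i x, ~ cube M x \/ ~ D x -> partial i phi x = 0 &
    (forall x, `|phi x| <= B) /\ forall i x, `|partial i phi x| <= B].
Proof.
move=> [sphi [K [cK KD phi0]]].
have [M M0 KM] := compact_sub_cube cK.
have [B B0 hB] := continuous_compact_supp_bounded (smooth_continuous sphi) cK phi0.
have /choice[C hC] i : exists C, 0 < C /\ forall x, `|partial i phi x| <= C.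
  have [C C0 hC] := continuous_compact_supp_bounded
    (smooth_partial_continuous (i := i) sphi) cK
    (fun x => @partial_off_supp phi K i x cK phi0).
  by exists C.
have nK x : ~ cube M x \/ ~ D x -> ~ K x.
  by case => h Kx; apply: h; [exact: KM|exact: KD].
have C0 i : 0 <= C i by have [/ltW] := hC i.
exists M, (B + \sum_i C i); split => //.
- by rewrite addr_ge0 ?sumr_ge0// ltW.
- by move=> x /nK; exact: phi0.
- by move=> i x /nK; exact: partial_off_supp.
split => [x|i x]; first by rewrite (le_trans (hB x))// lerDl sumr_ge0.
apply: (le_trans ((hC i).2 x)); rewrite (bigD1 i)//=.
have : 0 <= \sum_(j < n | j != i) C j by exact: sumr_ge0.
by move: (\sum_(j < n | j != i) C j) => z z0; lra.
Qed.

Lemma measurable_test D phi : test_fun D phi -> measurable_fun setT phi.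
Proof. by move=> [sphi _]; apply: continuous_measurable_rV; exact: smooth_continuous. Qed.

Lemma measurable_partial_test D phi i : test_fun D phi ->
  measurable_fun setT (partial i phi).
Proof.
move=> [sphi _]; apply: continuous_measurable_rV; exact: smooth_partial_continuous.
Qed.

Lemma continuous_line (g : 'rV[R]_n -> R) v x : continuous g ->
  continuous (fun s : R => g (s *: v + x)).
Proof.
move=> cg s; apply: (@continuous_comp _ _ _ (fun s : R => s *: v + x) g); last exact: cg.
apply: cvgD; last exact: cvg_cst.
by apply: cvgZr_tmp; exact: cvg_id.
Qed.

Lemma restrict_supp f D : (forall x, ~ D x -> f x = 0) -> f \_ D = f.
Proof.
move=> f0; apply/funext => x; rewrite patchE; case: ifPn => //.
by rewrite notin_setE => /f0.
Qed.

Lemma Rint_restrict f D : (forall x, ~ D x -> f x = 0) ->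
  \int[leb]_(x in D) f x = \int[leb]_x f x.
Proof. by move=> f0; rewrite Rintegral_mkcond restrict_supp. Qed.

Lemma integ_test_mul D phi (f : 'rV[R]_n -> R) (C : R) : test_fun D phi ->
  measurable_fun setT f -> (forall x, `|f x| <= C) ->
  integ (fun x => phi x * f x).
Proof.
move=> tp mf fC; have [M [B [M0 B0 p0 _ [pB _]]]] := test_fun_bounds tp.
apply: (integ_supp_cube (M := M) (B := B * C)).
- by apply: measurable_funM => //; exact: measurable_test tp.
- by move=> x cx; rewrite p0 ?mul0r//; left.
- by move=> x; rewrite normrM ler_pM.
Qed.

Lemma integ_partial_mul D phi i (f : 'rV[R]_n -> R) (C : R) : test_fun D phi ->
  measurable_fun setT f -> (forall x, `|f x| <= C) ->
  integ (fun x => partial i phi x * f x).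
Proof.
move=> tp mf fC; have [M [B [M0 B0 _ p0 [_ pB]]]] := test_fun_bounds tp.
apply: (integ_supp_cube (M := M) (B := B * C)).
- by apply: measurable_funM => //; exact: measurable_partial_test tp.
- by move=> x cx; rewrite p0 ?mul0r//; left.
- by move=> x; rewrite normrM ler_pM.
Qed.

(** [phi] may be nonzero at the boundary of [D], but [chi] is supported inside, so both integrals
    extend to the whole space, where the derivative of the product integrates to 0. *)
Lemma test_fun_weak_partial D phi i : test_fun setT phi ->
  is_weak_partial D i phi (partial i phi).
Proof.
move=> tp chi tc.
have [M [B [M0 B0 p0 dp0 [pB dpB]]]] := test_fun_bounds tp.
have [Mc [C [Mc0 C0 c0 dc0 [cC dcC]]]] := test_fun_bounds tc.
have mp := measurable_test tp; have mdp := @measurable_partial_test _ _ i tp.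
have mc := measurable_test tc; have mdc := @measurable_partial_test _ _ i tc.
have [sp _] := tp; have [sc _] := tc.
rewrite (@Rint_restrict (fun x => phi x * partial i chi x) D); last by move=> x Dx; rewrite dc0 ?mulr0//; right.
rewrite (@Rint_restrict (fun x => partial i phi x * chi x) D); last by move=> x Dx; rewrite c0 ?mulr0//; right.
apply/eqP; rewrite -addr_eq0 -RintD; last 2 first.
- exact: integ_test_mul tp mdc (dcC i).
- exact: integ_partial_mul tp mc cC.
apply/eqP; apply: (@Rint_partial0 R n i (fun x => phi x * chi x) _ M (B * C + B * C)) => //.
- move=> x; have h1 := @smooth_is_derive _ i x sp; have h2 := @smooth_is_derive _ i x sc.
  by apply: is_derive_eq; rewrite /GRing.scale /= [chi x * _]mulrC.
- move=> x; apply: (continuous_line (g := fun x => phi x * partial i chi x + partial i phi x * chi x)) => y.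
  have cp : {for y, continuous phi} by exact: smooth_continuous.
  have cc : {for y, continuous chi} by exact: smooth_continuous.
  have cdp : {for y, continuous (partial i phi)} by exact: smooth_partial_continuous.
  have cdc : {for y, continuous (partial i chi)} by exact: smooth_partial_continuous.
  exact: (cvgD (cvgM cp cdc) (cvgM cdp cc)).
- by apply: measurable_funD; exact: measurable_funM.
- by move=> x; rewrite (le_trans (ler_normD _ _))// lerD// normrM ler_pM.
- by move=> x cx; rewrite p0 ?mul0r//; left.
- by move=> x cx; rewrite p0 ?mul0r ?dp0 ?mul0r ?addr0//; left.
Qed.

End test_functions.

Section strip_slices.
Variables (R : realType) (d : nat).

Definition init_pt (x : 'rV[R]_d.+1) : 'rV[R]_d := \row_j x 0 (lift ord_max j).

Lemma init_join (x : 'rV[R]_d) t : init_pt (join_pt (x, t)) = x.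
Proof. by apply/rowP => j; rewrite mxE join_pt_lift. Qed.

Lemma measurable_init_pt : measurable_fun setT init_pt.
Proof.
by apply: measurable_rVP => j; under eq_fun do rewrite mxE; exact: measurable_coord.
Qed.

Lemma measurable_strip b : measurable (strip b : set 'rV[R]_d.+1).
Proof.
rewrite (_ : strip b = [set x : 'rV[R]_d.+1 | `]0, b[%classic (x 0 ord_max)]).
  by apply: (@measurable_coord_preim R d.+1 ord_max `]0, b[%classic).
by apply/seteqP; split => x; rewrite /strip /= in_itv.
Qed.

Definition istrip b : 'rV[R]_d.+1 -> R := \1_(strip b).

Lemma measurable_istrip b : measurable_fun setT (istrip b).
Proof. by apply: measurable_indic; exact: measurable_strip. Qed.

Lemma norm_istrip b x : `|istrip b x| <= 1.
Proof. by rewrite /istrip indicE; case: (_ \in _); rewrite ?normr1 ?normr0. Qed.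

Lemma init_shift (s : R) (j : 'I_d) x (xi : 'rV[R]_d) :
  phase (init_pt (s *: delta_mx 0 (lift ord_max j) + x)) xi =
  2 * pi * xi 0 j * s + phase (init_pt x) xi.
Proof.
rewrite /phase /dotp (bigD1 j)//= [in RHS](bigD1 j)//=.
rewrite (eq_bigr (fun i => init_pt x 0 i * xi 0 i)); last first.
  by move=> i ij; rewrite !mxE (inj_eq lift_inj) (negbTE ij) andbF mulr0 add0r.
by rewrite !mxE !eqxx mulr1; ring.
Qed.

Lemma istrip_shift b (s : R) (j : 'I_d) x :
  istrip b (s *: delta_mx 0 (lift ord_max j) + x) = istrip b x.
Proof.
rewrite /istrip !indicE; congr (nat_of_bool _)%:R.
apply/idP/idP; rewrite !inE /strip /= !mxE (_ : (ord_max == lift ord_max j) = false);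
  by rewrite ?andbF ?mulr0 ?add0r// -(negbTE (neq_lift ord_max j)).
Qed.

(** Horizontal integration by parts over the strip: the indicator is constant along horizontal
    lines, so it acts as a constant factor and no boundary term arises. *)
Lemma strip_partial_cos_sin b phi (j : 'I_d) (xi : 'rV[R]_d) : test_fun setT phi ->
  \int[leb]_x (partial (lift ord_max j) phi x * (istrip b x * cos (phase (init_pt x) xi))) =
    2 * pi * xi 0 j * \int[leb]_x (phi x * (istrip b x * sin (phase (init_pt x) xi))) /\
  \int[leb]_x (partial (lift ord_max j) phi x * (istrip b x * sin (phase (init_pt x) xi))) =
    - (2 * pi * xi 0 j) * \int[leb]_x (phi x * (istrip b x * cos (phase (init_pt x) xi))).
Proof.
pose ph x := phase (init_pt x) xi.
move=> tp; have [sp _] := tp; set i := lift ord_max j.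
have [M [B [M0 B0 p0 dp0 [pB dpB]]]] := test_fun_bounds tp.
have mp := measurable_test tp; have mdp := @measurable_partial_test _ _ _ _ i tp.
have mph : measurable_fun setT ph.
  by apply: measurable_phase; [exact: measurable_init_pt|exact: measurable_cst].
have mS := measurable_istrip b.
pose a := 2 * pi * xi 0 j.
(* To be applied to [cos], [- sin] and to [sin], [cos]; the factor [a] is the slope of the phase in
   direction [j]. *)
have key (F F' : R -> R) : (forall t : R, is_derive t 1 F (F' t)) ->
    continuous F' -> (forall t, `|F t| <= 1) -> (forall t, `|F' t| <= 1) ->
    \int[leb]_x (partial i phi x * (istrip b x * F (ph x))) =
    - a * \int[leb]_x (phi x * (istrip b x * F' (ph x))).
  move=> dF cF' F1 F'1.
  have cF : continuous F by move=> x; apply: derivable_continuous; have [] := dF x.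
  have mFp : measurable_fun setT (fun x => istrip b x * F (ph x)).
    by apply: measurable_funM => //; apply: measurableT_comp mph; exact: continuous_measurable_fun.
  have mF'p : measurable_fun setT (fun x => istrip b x * F' (ph x)).
    by apply: measurable_funM => //; apply: measurableT_comp mph; exact: continuous_measurable_fun.
  have b1 x : `|istrip b x * F (ph x)| <= 1.
    by rewrite normrM -[leRHS]mulr1 ler_pM// norm_istrip.
  have b2 x : `|istrip b x * F' (ph x)| <= 1.
    by rewrite normrM -[leRHS]mulr1 ler_pM// norm_istrip.
  have i1 := integ_partial_mul i tp mFp b1.
  have i2 := integ_test_mul tp mF'p b2.
  apply/eqP; rewrite mulNr -subr_eq0 opprK -RintZ// -RintD//; last exact: integZ.
  apply/eqP; apply: (@Rint_partial0 R d.+1 i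
    (fun x => phi x * (istrip b x * F (ph x))) _ M (B + `|a| * B)) => //.
  - move=> x.
    have h1 := @smooth_is_derive _ _ _ i x sp.
    pose k x := F (ph x).
    have h2 : is_derive x (delta_mx 0 i) k (a * F' (ph x)).
      pose f (s : R) := F (a * s + ph x).
      have df : is_derive (0 : R) (1 : R) f (a * F' (ph x)).
        have h := dF (a * 0 + ph x).
        have hl : is_derive (0 : R) (1 : R) (fun s : R => a * s + ph x) a.
          by apply: is_derive_eq; rewrite /GRing.scale /= !(mulr0, addr0, mulr1).
        have := @is_derive1_comp R F (fun s : R => a * s + ph x) 0 _ _ h hl.
        by rewrite mulr0 add0r mulrC.
      apply: is_derive_line df => s.
      by rewrite /k /f /ph init_shift addr0 [_%:A]mulr1.
    (* The indicator is frozen at its value at [x]; [is_derive_line] then transfers the derivative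
       to the function with the true indicator. *)
    have h3 : is_derive x (delta_mx 0 i) (fun y => istrip b x * (phi y * k y))
        (istrip b x * (partial i phi x * k x + phi x * (a * F' (ph x)))).
      by apply: is_derive_eq; rewrite /GRing.scale /=; ring.
    rewrite (_ : _ + _ = istrip b x * (partial i phi x * k x + phi x * (a * F' (ph x)))).
      apply: is_derive_line h3 => s.
      by rewrite istrip_shift /k; ring.
    by rewrite /k; ring.
  - move=> x.
    rewrite (_ : (fun s : R => _) = fun s : R =>
      partial i phi (s *: delta_mx 0 i + x) * (istrip b x * F (a * s + ph x))
      + a * (phi (s *: delta_mx 0 i + x) * (istrip b x * F' (a * s + ph x)))); last first.
      by apply/funext => s; rewrite istrip_shift /ph init_shift.
    move=> s.
    have c1 : {for s, continuous (fun s : R => a * s + ph x)}.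
      by apply: derivable_continuous; apply: ex_derive.
    have c2 : {for s, continuous (fun s : R => phi (s *: delta_mx 0 i + x))}.
      by apply: continuous_line; exact: smooth_continuous.
    have c3 : {for s, continuous (fun s : R => partial i phi (s *: delta_mx 0 i + x))}.
      by apply: continuous_line; exact: smooth_partial_continuous.
    have c4 : {for s, continuous (fun s : R => F (a * s + ph x))}.
      by apply: (@continuous_comp _ _ _ (fun s : R => a * s + ph x) F); [exact: c1|exact: cF].
    have c5 : {for s, continuous (fun s : R => F' (a * s + ph x))}.
      by apply: (@continuous_comp _ _ _ (fun s : R => a * s + ph x) F'); [exact: c1|exact: cF'].
    exact: (cvgD (cvgM c3 (cvgM (cvg_cst _) c4)) (cvgM (cvg_cst _) (cvgM c2 (cvgM (cvg_cst _) c5)))).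
  - by apply: measurable_funD; apply: measurable_funM => //; exact: measurable_funM.
  - move=> x; rewrite (le_trans (ler_normD _ _))// lerD//.
      by rewrite normrM -[leRHS]mulr1 ler_pM.
    by rewrite normrM ler_wpM2l// normrM -[leRHS]mulr1 ler_pM.
  - by move=> x cx; rewrite p0 ?mul0r//; left.
  - by move=> x cx; rewrite p0 ?mul0r ?dp0 ?mul0r ?mulr0 ?addr0//; left.
split.
  rewrite (key cos (fun t => - sin t)).
  - under eq_Rintegral do rewrite !mulrN.
    rewrite RintN; first by rewrite /a mulrNN.
    apply: (integ_test_mul (C := 1) tp).
      by apply: measurable_funM => //; exact: measurable_sin.
    by move=> x; rewrite normrM -[leRHS]mulr1 ler_pM// ?norm_istrip ?sin_max.
  - by move=> t; apply: cvgN; exact: continuous_sin.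
  - exact: cos_max.
  - by move=> t; rewrite normrN; exact: sin_max.
rewrite (key sin cos)//.
- by move=> t; exact: continuous_cos.
- exact: sin_max.
- exact: cos_max.
Qed.

End strip_slices.

Lemma indic_sqr (T : Type) (R : realType) (A : set T) (t : T) :
  \1_A t ^+ 2 = \1_A t :> R.
Proof. by rewrite indicE; case: (_ \in _); rewrite ?expr1n ?expr0n. Qed.

(** * Vertical averages *)

Section slab_average.
Variables (R : realType) (d : nat) (b : R).
Hypothesis b0 : 0 < b.
Local Notation mu := (@lebesgue_measure R).
Implicit Types w : 'rV[R]_d.+1 -> R.

(** Integration runs over the whole line, without division by [b]: functions on the strip are
    extended by 0. *)
Definition avg w : 'rV[R]_d -> R := fun x => \int[mu]_t w (join_pt (x, t)).

Definition off_strip0 w := forall x, ~ strip b x -> w x = 0.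

Lemma measurable_slice w x : measurable_fun setT w ->
  measurable_fun setT (fun t => w (join_pt (x, t))).
Proof. by move=> mw; exact: (measurableT_comp mw (measurable_join_r x)). Qed.

(** Slices of a measurable function may fail to be integrable, so Tonelli is applied to the positive
    and the negative part separately. *)
Lemma measurable_avg w : measurable_fun setT w -> measurable_fun setT (avg w).
Proof.
move=> mw; apply: measurableT_comp => //.
pose g (p : 'rV[R]_d * R) := (w (join_pt p))%:E.
have mg : measurable_fun setT g.
  by apply/measurable_EFinP; exact: (measurableT_comp mw (@measurable_join_pt R d)).
rewrite (_ : (fun x => _) = fun x => ((\int[mu]_t (g^\+ (x, t))%E) - (\int[mu]_t (g^\- (x, t))%E))%E).
  apply: emeasurable_funB.
    exact: (@measurable_fun_fubini_tonelli_F _ _ _ _ _ mu g^\+%E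
      (measurable_funepos mg) (fun p => funepos_ge0 _ p)).
  exact: (@measurable_fun_fubini_tonelli_F _ _ _ _ _ mu g^\-%E
      (measurable_funeneg mg) (fun p => funeneg_ge0 _ p)).
apply/funext => x; rewrite [LHS]integralE.
by congr (_ - _)%E; apply: eq_integral => t _; rewrite ?funeposE ?funenegE.
Qed.

Lemma off_strip_slice w x t : off_strip0 w -> ~ `]0, b[%classic t -> w (join_pt (x, t)) = 0.
Proof. by move=> w0 tb; apply: w0; rewrite /strip /= join_pt_max; rewrite /= in_itv in tb. Qed.

Lemma Rint_indic_itv : nsq mu (\1_(`]0, b[%classic) : R -> R) = b.
Proof.
rewrite /nsq; under eq_Rintegral do rewrite indic_sqr.
rewrite /Rintegral integral_indic// setIT.
have := @lebesgue_measure_itv R `]0, b[ => /= ->.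
by rewrite lte_fin b0 /= subr0.
Qed.

Lemma sqint_indic_itv : sqint mu (\1_(`]0, b[%classic) : R -> R).
Proof.
split; first exact: measurable_indic.
under eq_fun do rewrite indic_sqr.
exact: integrable_indic_itv.
Qed.

Lemma slice_mul_indic w x : off_strip0 w ->
  (fun t => w (join_pt (x, t))) =
  (fun t => w (join_pt (x, t)) * \1_(`]0, b[%classic) t).
Proof.
move=> w0; apply/funext => t; rewrite indicE.
have [tb|tb] := pselect (`]0, b[%classic t); first by rewrite mem_set// mulr1.
by rewrite memNset// mulr0 off_strip_slice.
Qed.

Lemma integ_slice w x : off_strip0 w -> sqint mu (fun t => w (join_pt (x, t))) ->
  mu.-integrable setT (EFin \o (fun t => w (join_pt (x, t)))).
Proof.
by move=> w0 sw; rewrite slice_mul_indic//; apply: sqint_mul => //; exact: sqint_indic_itv.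
Qed.

(** Cauchy-Schwarz against the indicator of [(0, b)], whose squared norm is [b]. The extended
    right-hand side allows for slices that are not square integrable. *)
Lemma avg_sqr_le w x : off_strip0 w -> measurable_fun setT w ->
  ((avg w x ^+ 2)%:E <= b%:E * \int[mu]_t (w (join_pt (x, t)) ^+ 2)%:E)%E.
Proof.
move=> w0 mw; set I := (\int[mu]_t _)%E.
have I0 : (0 <= I)%E by apply: integral_ge0 => t _; rewrite lee_fin sqr_ge0.
have [Iy|Iy] := eqVneq I +oo%E; first by rewrite Iy gt0_muley ?lte_fin// leey.
have sw : sqint mu (fun t => w (join_pt (x, t))).
  have ms := measurable_slice x mw; split => //; apply: integ_lty.
  - exact: measurable_funX.
  - by move=> t; exact: sqr_ge0.
  - by rewrite ltey.
have := cauchy_schwarz sw sqint_indic_itv.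
have E : (nsq mu (fun t => w (join_pt (x, t))))%:E = I.
  by rewrite /nsq EFin_Rint//; exact: sw.2.
rewrite Rint_indic_itv -lee_fin [nsq _ _ * _]mulrC [X in (_ <= X)%E]EFinM E; apply: le_trans.
by rewrite /avg (slice_mul_indic x w0).
Qed.

Lemma integral_avg_sqr_le w : off_strip0 w -> sqint leb w ->
  (\int[leb]_x (avg w x ^+ 2)%:E <= (b * nsq leb w)%:E)%E.
Proof.
move=> w0 [mw wi].
have mw2 : measurable_fun setT (fun x => (w x ^+ 2)%:E).
  exact/measurable_EFinP/measurable_funX.
pose h x := (\int[mu]_t (w (join_pt (x, t)) ^+ 2)%:E)%E.
have mh : measurable_fun setT h.
  apply: (@measurable_fun_fubini_tonelli_F _ _ _ _ _ mu
    (fun p : 'rV[R]_d * R => (w (join_pt p) ^+ 2)%:E)).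
    exact: (measurableT_comp mw2 (@measurable_join_pt R d)).
  by move=> p; rewrite lee_fin sqr_ge0.
have h0 x : (0 <= h x)%E by apply: integral_ge0 => t _; rewrite lee_fin sqr_ge0.
apply: (@le_trans _ _ (\int[leb]_x (b%:E * h x))%E).
  apply: ge0_le_integral => //.
  - by move=> x _; rewrite lee_fin sqr_ge0.
  - by apply/measurable_EFinP/measurable_funX; exact: measurable_avg.
  - by apply: emeasurable_funM => //; exact: measurable_cst.
  - by move=> x _; exact: avg_sqr_le.
rewrite ge0_integralZl//; last by rewrite lee_fin ltW.
rewrite EFinM /nsq EFin_Rint// leb_tonelli1//.
by move=> x; rewrite lee_fin sqr_ge0.
Qed.

Lemma sqint_avg w : off_strip0 w -> sqint leb w ->
  sqint leb (avg w) /\ nsq leb (avg w) <= b * nsq leb w.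
Proof.
move=> w0 sw; have := integral_avg_sqr_le w0 sw; have [mw wi] := sw => h.
have ma := measurable_avg mw.
have s : sqint leb (avg w).
  split => //; apply: integ_lty.
  - exact: measurable_funX.
  - by move=> x; exact: sqr_ge0.
  - by apply: (le_lt_trans h); rewrite ltry.
by split => //; rewrite -lee_fin /nsq EFin_Rint//; exact: s.2.
Qed.

(** By Fubini almost every slice is square integrable, and on a segment of finite length this
    implies integrability. *)
Lemma ae_integ_slice w : off_strip0 w -> sqint leb w ->
  {ae leb, forall x, mu.-integrable setT (EFin \o (fun t => w (join_pt (x, t))))}.
Proof.
move=> w0 [mw wi].
have := ae_integrable1 (leb_integrable_join wi).
apply: filterS => x h; apply: integ_slice => //; split => //.
exact: measurable_slice.
Qed.

(** Integrals subtract where both slices are integrable, which leaves a null set of exceptions. *)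
Lemma avgB w1 w2 : off_strip0 w1 -> off_strip0 w2 -> sqint leb w1 -> sqint leb w2 ->
  {ae leb, forall x, avg (fun y => w1 y - w2 y) x = avg w1 x - avg w2 x}.
Proof.
move=> w10 w20 s1 s2; have h1 := ae_integ_slice w10 s1; have h2 := ae_integ_slice w20 s2.
by apply: filterS2 h1 h2 => x i1 i2; exact: RintB.
Qed.

Lemma nsq_ae (f g : 'rV[R]_d -> R) : measurable_fun setT f -> measurable_fun setT g ->
  {ae leb, forall x, f x = g x} -> nsq leb f = nsq leb g.
Proof.
move=> mf mg fg; apply: Rint_ae; [exact: measurable_funX|exact: measurable_funX|].
by apply: filterS fg => x ->.
Qed.

Lemma nsq_avg_cvg (W : nat -> 'rV[R]_d.+1 -> R) w : (forall k, off_strip0 (W k)) ->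
  off_strip0 w -> (forall k, sqint leb (W k)) -> sqint leb w ->
  nsq leb (fun x => W k x - w x) @[k --> \oo] --> 0 ->
  nsq leb (fun x => avg (W k) x - avg w x) @[k --> \oo] --> 0.
Proof.
move=> W0 w0 sW sw h.
have hb : b * nsq leb (fun x => W k x - w x) @[k --> \oo] --> 0.
  by rewrite -[X in _ --> X](mulr0 b); apply: cvgM => //; exact: cvg_cst.
apply: cvg0_le hb => k; rewrite nsq_ge0 /=.
have o : off_strip0 (fun x => W k x - w x) by move=> x xs; rewrite W0// w0// subrr.
have [s le] := sqint_avg o (sqintB (sW k) sw).
apply: le_trans le; rewrite le_eqVlt; apply/orP; left; apply/eqP; apply: nsq_ae.
- by apply: measurable_funB; apply: measurable_avg; [case: (sW k)|case: sw].
- by case: s.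
- by apply: filterS (avgB (W0 k) w0 (sW k) sw) => x ->.
Qed.

(** Fubini turns a transform on the base into an integral over the strip, where integration by parts
    is available. *)
Lemma osc_avg (c : R -> R) w xi : measurable_fun setT c -> (forall t, `|c t| <= 1) ->
  integ w -> (forall x, mu.-integrable setT (EFin \o (fun t => w (join_pt (x, t))))) ->
  \int[leb]_x (avg w x * c (phase x xi)) = \int[leb]_x (w x * c (phase (init_pt x) xi)).
Proof.
move=> mc c1 wi ws; rewrite leb_Rfubini.
- apply: eq_Rintegral => x _; rewrite mulrC -RintZ//.
  by apply: eq_Rintegral => t _; rewrite init_join mulrC.
- apply: (integ_mulb (M := 1) wi) => //; apply: measurableT_comp mc _.
  by apply: measurable_phase; [exact: measurable_init_pt|exact: measurable_cst].
- move=> x; apply: (integ_mulb (M := 1) (ws x)) => //.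
  by under eq_fun do rewrite init_join; exact: measurable_cst.
Qed.

Lemma integ_avg w : integ w ->
  (forall x, mu.-integrable setT (EFin \o (fun t => w (join_pt (x, t))))) ->
  integ (avg w).
Proof.
move=> wi ws.
exact: (@integ_fubini1 _ _ _ _ _ (@sleb R d) mu (fun p => w (join_pt p))
  (leb_integrable_join wi) ws).
Qed.

End slab_average.

(** * Bump functions *)

Section flat_functions.
Variables (R : realType) (c : R).
Hypothesis c0 : 0 < c.
Implicit Types (P : {poly R}).

(** A polynomial in [1 / t] is carried along so that the family is closed under differentiation;
    [P = 1] is the classical function that is flat at 0. *)
Definition flat P (t : R) : R := if 0 < t then P.[t^-1] * expR (- (c / t)) else 0.

(* (flat P)' = flat (flat_next P). *)
Definition flat_next P : {poly R} := 'X^2 * (c *: P - P^`()).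

Lemma exprn_expR_bounded (k : nat) : exists C : R, forall y, 0 < y ->
  y ^+ k * expR (- (c * y)) <= C.
Proof.
case: k => [|k].
  exists 1 => y y0; rewrite expr0 mul1r -[leRHS]expR0 ler_expR.
  by rewrite oppr_le0 mulr_ge0 ?ltW.
(* With [m = k + 1], [exp (c * y)] is the [m]-th power of [exp (c * y / m)], which is at least
   [c * y / m]. *)
exists ((k.+1%:R / c) ^+ k.+1) => y y0.
have k0 : 0 < k.+1%:R :> R by [].
rewrite expRN ler_pdivrMr ?expR_gt0//.
have -> : expR (c * y) = expR (c * y / k.+1%:R) ^+ k.+1.
  rewrite -expRM_natl; congr expR; field; lra.
rewrite -exprMn; apply: lerXn2r; rewrite ?nnegrE ?(ltW y0)//.
  by rewrite ltW// mulr_gt0 ?divr_gt0 ?expR_gt0.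
rewrite mulrC -ler_pdivrMr ?divr_gt0//.
have -> : y / (k.+1%:R / c) = c * y / k.+1%:R by rewrite invf_div mulrA [y * c]mulrC.
by apply: le_trans (expR_ge1Dx _); rewrite lerDr.
Qed.

Lemma poly_expR_bounded P : exists2 C : R, 0 <= C & forall y, 0 < y ->
  `|P.[y]| * expR (- (c * y)) <= C.
Proof.
have /choice[C hC] k := exprn_expR_bounded k.
exists (\sum_(i < size P) `|P`_i| * `|C i|); first by rewrite sumr_ge0.
move=> y y0; rewrite horner_coef.
apply: (@le_trans _ _ ((\sum_(i < size P) `|P`_i| * y ^+ i) * expR (- (c * y)))).
  rewrite ler_wpM2r ?expR_ge0// (le_trans (ler_norm_sum _ _ _))//.
  by apply: ler_sum => i _; rewrite normrM [`|y ^+ i|]ger0_norm// exprn_ge0// ltW.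
rewrite mulr_suml; apply: ler_sum => i _; rewrite -mulrA ler_wpM2l//.
by rewrite (le_trans (hC i y y0))// ler_norm.
Qed.

(** For [t != 0] the formula is calculus on one side of 0. At 0 the derivative is 0, because
    [flat P z] is bounded by a multiple of [z ^+ 2]. *)
Lemma is_derive_flat P (t : R) : is_derive t 1 (flat P) (flat (flat_next P) t).
Proof.
have [t0|t0|->] := ltgtP t 0.
- rewrite {2}/flat ltNge (ltW t0) /=.
  apply: (@near_eq_is_derive _ _ _ (cst 0)).
    by near=> z; rewrite /flat ltNge ltW//=; near: z; exact: lt_nbhsl.
- rewrite {2}/flat t0.
  refine (@near_eq_is_derive R R R (fun z => P.[z^-1] * expR (- (c / z))) (flat P) t 1 _ _ _).
    by near=> z; rewrite /flat ifT//; near: z; exact: lt_nbhsr.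
  have tn0 : t != 0 by rewrite gt_eqF.
  have dV : is_derive t 1 (fun z : R => z^-1) (- t ^- 2).
    have := @is_deriveV R id t 1 1 tn0 (is_derive_id _ _).
    by rewrite /GRing.scale /= mulr1.
  have d1 : is_derive t 1 (fun z : R => P.[z^-1]) ((P^`()).[t^-1] * (- t ^- 2)).
    exact: (@is_derive1_comp R (horner P) (fun z : R => z^-1)).
  have d2 : is_derive t 1 (fun z : R => expR (- (c / z))) (expR (- (c / t)) * (c * t ^- 2)).
    apply: (@is_derive1_comp R expR (fun z : R => - (c / z))).
    by apply: is_derive_eq; rewrite /GRing.scale /=; ring.
  apply: is_derive_eq; rewrite /GRing.scale /= /flat_next.
  rewrite hornerM hornerXn hornerD hornerN hornerZ.
  move: (P.[_]) (P^`().[_])%R (expR _) => p q e; by field.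
rewrite {2}/flat ltxx; apply/is_derive1_caratheodory.
exists (fun z => if 0 < z then flat P z / z else 0); split.
- move=> z; rewrite subr0 {2}/flat ltxx subr0; case: ifPn => [z0|].
    by rewrite divfK// gt_eqF.
  by rewrite /flat => /negbTE ->; rewrite mul0r.
(* The factor ['X^2] yields two powers of [z]: one is used up by the difference quotient, the other
   makes the quotient tend to 0. *)
- have [C C0 hC] := poly_expR_bounded ('X^2 * P).
  have b z : `|if 0 < z then flat P z / z else 0| <= C * `|z|.
    case: ifPn => [z0|_]; last by rewrite normr0 mulr_ge0.
    rewrite /flat z0 [`|z|]gtr0_norm// normrM [`|z^-1|]gtr0_norm ?invr_gt0//.
    rewrite ler_pdivrMr// normrM [`|expR _|]gtr0_norm ?expR_gt0//.
    have zi0 : 0 < z^-1 by rewrite invr_gt0.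
    have := hC z^-1 zi0; rewrite !hornerE normrM [`|z^-1 ^+ 2|]gtr0_norm ?exprn_gt0//.
    rewrite -/(c / z) => h.
    have -> : `|P.[z^-1]| * expR (- (c / z)) =
        (z^-1 ^+ 2 * `|P.[z^-1]| * expR (- (c / z))) * (z * z).
      by field; rewrite gt_eqF.
    by rewrite -[leRHS]mulrA ler_wpM2r// ltW// mulr_gt0.
  rewrite /prop_for /continuous_at ltxx.
  apply: norm_cvg0.
  have h : C * `|z| @[z --> (0 : R)] --> 0.
    rewrite -[X in _ --> X](mulr0 C); apply: cvgM; first exact: cvg_cst.
    rewrite -[X in _ --> X](normr0 R); exact: (@norm_continuous _ R).
  apply: (squeeze_cvgr (f := fun=> 0) _ _ h); last exact: cvg_cst.
  by apply: nearW => z; rewrite normr_ge0 b.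
- by rewrite ltxx.
Unshelve. all: by end_near. Qed.

End flat_functions.

(** * Closure properties of smooth functions *)

Section smooth_closure.
Variables (R : realType) (n : nat).
Implicit Types f g : 'rV[R]_n -> R.

(** Smoothness cut off at order [k], so that closure under products can be proved by induction on
    the order: the Leibniz rule pairs a derivative with an undifferentiated factor, and both are
    known up to one order less. *)
Definition smooth_upto k f := forall (s : seq 'I_n), (size s <= k)%N ->
  forall x, differentiable (partials s f) x.

Lemma smooth_uptoP f : smooth f <-> forall k, smooth_upto k f.
Proof. by split => [h k s _|h s]; [exact: h|exact: (h (size s))]. Qed.

Lemma smooth_upto_diff k f x : smooth_upto k f -> differentiable f x.
Proof. by move=> h; exact: (h [::]). Qed.

(** [partials] applies the last index first, so inductions take indices off the right end. *)
Lemma partials_rcons (s : seq 'I_n) i f : partials (rcons s i) f = partials s (partial i f).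
Proof. by rewrite /partials foldr_rcons. Qed.

Lemma smooth_upto_partial k i f : smooth_upto k.+1 f -> smooth_upto k (partial i f).
Proof. by move=> h s sk x; rewrite -partials_rcons; apply: h; rewrite size_rcons. Qed.

Lemma smooth_uptoW k f : smooth_upto k.+1 f -> smooth_upto k f.
Proof. by move=> h s sk; apply: h; exact: leqW. Qed.

Lemma smooth_uptoS k f : (forall x, differentiable f x) ->
  (forall i, smooth_upto k (partial i f)) -> smooth_upto k.+1 f.
Proof.
move=> df h s; case/lastP: s => [_ x|s i]; first exact: df.
by rewrite size_rcons ltnS partials_rcons => sk; exact: h.
Qed.

Lemma smooth_uptoD k f g : smooth_upto k f -> smooth_upto k g ->
  smooth_upto k (fun x => f x + g x).
Proof.
elim: k f g => [|k IH] f g hf hg.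
  move=> s; rewrite leqn0 size_eq0 => /eqP -> x.
  by apply: differentiableD; [exact: (smooth_upto_diff _ hf)|exact: (smooth_upto_diff _ hg)].
apply: smooth_uptoS => [x|i].
  by apply: differentiableD; [exact: (smooth_upto_diff _ hf)|exact: (smooth_upto_diff _ hg)].
rewrite (_ : partial i _ = fun x => partial i f x + partial i g x).
  by apply: IH; exact: smooth_upto_partial.
apply/funext => x; rewrite /partial.
by apply: deriveD; apply: diff_derivable; [exact: (smooth_upto_diff _ hf)|exact: (smooth_upto_diff _ hg)].
Qed.

Lemma smooth_uptoM k f g : smooth_upto k f -> smooth_upto k g ->
  smooth_upto k (fun x => f x * g x).
Proof.
elim: k f g => [|k IH] f g hf hg.
  move=> s; rewrite leqn0 size_eq0 => /eqP -> x.
  by apply: differentiableM; [exact: (smooth_upto_diff _ hf)|exact: (smooth_upto_diff _ hg)].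
apply: smooth_uptoS => [x|i].
  by apply: differentiableM; [exact: (smooth_upto_diff _ hf)|exact: (smooth_upto_diff _ hg)].
rewrite (_ : partial i _ = fun x => f x * partial i g x + g x * partial i f x).
  by apply: smooth_uptoD; apply: IH; (exact: smooth_upto_partial || exact: smooth_uptoW).
apply/funext => x; rewrite /partial.
by apply: deriveM; apply: diff_derivable; [exact: (smooth_upto_diff _ hf)|exact: (smooth_upto_diff _ hg)].
Qed.

Lemma smooth_upto_cst k (a : R) : smooth_upto k (cst a).
Proof.
elim: k a => [|k IH] a.
  by move=> s; rewrite leqn0 size_eq0 => /eqP -> x; exact: differentiable_cst.
apply: smooth_uptoS => [x|i]; first exact: differentiable_cst.
rewrite (_ : partial i _ = cst 0); first exact: IH.
by apply/funext => x; rewrite /partial derive_cst.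
Qed.

(** [F] lists a function of one variable with its successive derivatives. Differentiation lowers the
    order and raises [m], so the induction on [k] keeps [m] general. *)
Lemma smooth_upto_coord k (F : nat -> R -> R) (i : 'I_n) :
  (forall m t, is_derive (t : R) (1 : R) (F m) (F m.+1 t)) ->
  forall m, smooth_upto k (fun x : 'rV[R]_n => F m (x 0 i)).
Proof.
move=> dF; have dc m (x : 'rV[R]_n) : differentiable (fun x : 'rV[R]_n => F m (x 0 i)) x.
  apply: (differentiable_comp (f := fun x : 'rV[R]_n => x 0 i) (g := F m)).
    exact: differentiable_coord.
  by apply/derivable1_diffP; have [] := dF m (x 0 i).
elim: k => [|k IH] m.
  by move=> s; rewrite leqn0 size_eq0 => /eqP -> x; exact: dc.
apply: smooth_uptoS => [x|j]; first exact: dc.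
rewrite (_ : partial j _ = fun x => (j == i)%:R * F m.+1 (x 0 i)).
  by apply: smooth_uptoM; [exact: smooth_upto_cst|exact: IH].
apply/funext => x.
have h : is_derive x (delta_mx 0 j) (fun x : 'rV[R]_n => F m (x 0 i))
    ((j == i)%:R * F m.+1 (x 0 i)).
  have d1 : is_derive (0 : R) (1 : R) (fun s : R => F m ((j == i)%:R * s + x 0 i))
      ((j == i)%:R * F m.+1 (x 0 i)).
    have hl : is_derive (0 : R) (1 : R) (fun s : R => (j == i)%:R * s + x 0 i) (j == i)%:R.
      by apply: is_derive_eq; rewrite /GRing.scale /= !(mulr0, addr0, mulr1).
    have hF := dF m ((j == i)%:R * 0 + x 0 i).
    have := @is_derive1_comp R (F m) _ 0 _ _ hF hl.
    by rewrite mulr0 add0r mulrC.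
  apply: is_derive_line d1 => s.
  by rewrite !mxE eqxx /= addr0 [_%:A]mulr1 eq_sym [_ * s]mulrC.
by rewrite /partial derive_val.
Qed.

Lemma smooth_upto_prod k (I : Type) (s : seq I) (F : I -> 'rV[R]_n -> R) :
  (forall i, smooth_upto k (F i)) -> smooth_upto k (fun x => \prod_(i <- s) F i x).
Proof.
move=> sF; elim: s => [|i s IH].
  by under eq_fun do rewrite big_nil; exact: smooth_upto_cst.
by under eq_fun do rewrite big_cons; exact: smooth_uptoM.
Qed.

End smooth_closure.

Section bumps.
Variables (R : realType) (n : nat).
Implicit Types (a b x : 'rV[R]_n).

(** [c] sets the steepness: as it tends to 0 the function tends to the indicator of the open
    interval. *)
Definition bump1 (c u v t : R) : R := flat c 1 (t - u) * flat c 1 (v - t).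

Definition bump c a b x : R := \prod_i bump1 c (a 0 i) (b 0 i) (x 0 i).

Lemma flat1_itv c t : 0 < c -> 0 <= flat c 1 t <= (1 : R).
Proof.
move=> c0; rewrite /flat; case: ifPn => [t0|_]; last by rewrite lexx ler01.
rewrite hornerC mul1r expR_ge0 -expR0 ler_expR oppr_le0.
by rewrite divr_ge0// ltW.
Qed.

Lemma bump1_itv c u v t : 0 < c -> 0 <= bump1 c u v t <= 1.
Proof.
move=> c0; have /andP[h1 h2] := flat1_itv (t - u) c0.
have /andP[h3 h4] := flat1_itv (v - t) c0.
by rewrite /bump1 mulr_ge0//= -[leRHS]mulr1 ler_pM.
Qed.

Lemma bump1_out c u v t : ~ (u < t < v) -> bump1 c u v t = 0.
Proof.
move=> h; rewrite /bump1 /flat !subr_gt0.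
case: (ltP u t) => ut; last by rewrite mul0r.
by case: (ltP t v) => tv; [case: h; rewrite ut tv|rewrite mulr0].
Qed.

Lemma smooth_bump c a b : 0 < c -> smooth (bump c a b).
Proof.
move=> c0; apply/smooth_uptoP => k; apply: smooth_upto_prod => i.
apply: smooth_uptoM.
  pose F m t := flat c (iter m (flat_next c) 1) (t - a 0 i).
  have dF m t : is_derive (t : R) (1 : R) (F m) (F m.+1 t).
    have hl : is_derive (t : R) (1 : R) (fun t : R => t - a 0 i) 1.
      by apply: is_derive_eq; rewrite subr0.
    have := @is_derive1_comp R _ _ t _ _
      (is_derive_flat c0 (iter m (flat_next c) 1) (t - a 0 i)) hl.
    by rewrite mulr1.
  exact: (@smooth_upto_coord R n k F i dF 0%N).
(* The reflection [b 0 i - t] contributes a sign at each differentiation, which is put into the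
   polynomial. *)
pose F m t := flat c (iter m (fun P => - flat_next c P) 1) (b 0 i - t).
have dF m t : is_derive (t : R) (1 : R) (F m) (F m.+1 t).
  have hl : is_derive (t : R) (1 : R) (fun t : R => b 0 i - t) (-1).
    by apply: is_derive_eq; rewrite add0r mul1r.
  have := @is_derive1_comp R _ _ t _ _
    (is_derive_flat c0 (iter m (fun P => - flat_next c P) 1) (b 0 i - t)) hl.
  rewrite mulrN1 (_ : - flat _ _ _ = F m.+1 t)//.
  by rewrite /F /flat /=; case: ifPn => _; rewrite ?oppr0// hornerN mulNr.
exact: (@smooth_upto_coord R n k F i dF 0%N).
Qed.

Definition cbox a b : set 'rV[R]_n := [set x | forall i, a 0 i <= x 0 i <= b 0 i].

Lemma compact_cbox a b : compact (cbox a b).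
Proof.
have := @rV_compact R n (fun i => `[a 0 i, b 0 i]%classic) (fun i => @segment_compact R _ _).
by rewrite (_ : [set v | _] = cbox a b).
Qed.

Lemma bump_out c a b x : ~ obox a b x -> bump c a b x = 0.
Proof.
move=> /existsNP[i h]; rewrite /bump (bigD1 i)//= bump1_out ?mul0r//.
Qed.

Lemma bump_itv c a b x : 0 < c -> 0 <= bump c a b x <= 1.
Proof.
move=> c0; rewrite /bump; apply/andP; split.
  by apply: prodr_ge0 => i _; have /andP[] := bump1_itv (a 0 i) (b 0 i) (x 0 i) c0.
apply: (@le_trans _ _ (\prod_(i < n) 1)); last by rewrite big1.
by apply: ler_prod => i _; exact: bump1_itv.
Qed.

Lemma test_bump c a b (D : set 'rV[R]_n) : 0 < c -> cbox a b `<=` D ->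
  test_fun D (bump c a b).
Proof.
move=> c0 abD; split; first exact: smooth_bump.
exists (cbox a b); split => //; first exact: compact_cbox.
move=> x nx; apply: bump_out => h; apply: nx => i.
by have /andP[/ltW -> /ltW ->] := h i.
Qed.

Lemma flat1_cvg (t : R) : 0 < t -> flat (k.+1%:R^-1) 1 t @[k --> \oo] --> (1 : R).
Proof.
move=> t0; rewrite /flat t0.
have h : - (k.+1%:R^-1 / t) @[k --> \oo] --> (0 : R).
  have := cvgN (cvgM (@cvg_harmonic R) (cvg_cst t^-1)).
  by rewrite mul0r oppr0; exact.
have := cvg_comp _ _ h (@continuous_expR R 0); rewrite expR0 => h2.
by under eq_fun do rewrite hornerC mul1r; exact: h2.
Qed.

Lemma bump_cvg a b x : bump (k.+1%:R^-1) a b x @[k --> \oo] --> (\1_(obox a b) x : R).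
Proof.
rewrite indicE; have [xab|xab] := pselect (obox a b x); last first.
  rewrite memNset//; under eq_fun do rewrite bump_out//; exact: cvg_cst.
rewrite mem_set// -[X in _ --> X](expr1n R n) -[in X in _ --> X](card_ord n) -prodr_const.
apply: (cvg_prod_seq (F := fun i k => bump1 (k.+1%:R^-1) (a 0 i) (b 0 i) (x 0 i))) => i.
have /andP[h1 h2] := xab i.
rewrite -[X in _ --> X](mulr1 (1 : R)).
by apply: cvgM; apply: flat1_cvg; rewrite subr_gt0.
Qed.

End bumps.

(** * Functions that integrate to 0 against boxes or test functions *)

Section box_system.
Variables (R : realType) (n : nat).
Implicit Types (f w : 'rV[R]_n -> R) (a c x : 'rV[R]_n) (E : set 'rV[R]_n).

Definition boxes : set (set 'rV[R]_n) := [set E | exists a c, E = obox a c].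

Lemma oboxI a c a' c' : obox a c `&` obox a' c' =
  obox (\row_i Num.max (a 0 i) (a' 0 i)) (\row_i Num.min (c 0 i) (c' 0 i)).
Proof.
apply/seteqP; split => x.
  by move=> [h h'] i; have := h i; have := h' i; rewrite !mxE gt_max lt_min => /andP[-> ->] /andP[-> ->].
move=> h; split => i; have := h i; rewrite !mxE gt_max lt_min;
  by move=> /andP[/andP[h1 h2] /andP[h3 h4]]; apply/andP; split.
Qed.

(** A half-space where one coordinate exceeds [r] is a countable union of open boxes, so the
    coordinates are measurable for the sigma-algebra that boxes generate. *)
Lemma measurable_sub_boxes : (@measurable _ 'rV[R]_n) `<=` <<s boxes >>.
Proof.
pose T : measurableType _ := g_sigma_algebraType boxes.
have mc (i : 'I_n) : measurable_fun setT (fun x : T => (x : 'rV[R]_n) 0 i).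
  apply: (measurability _ (RGenOInfty.measurableE R)) => _ [_ [r ->] <-].
  rewrite setTI (_ : _ @^-1` _ = \bigcup_k (obox
     (\row_j if j == i then r else - k%:R) (const_mx k%:R) : set 'rV[R]_n)).
    apply: (@bigcup_measurable _ T) => k _; apply: sub_sigma_algebra.
    by eexists; eexists.
  apply/seteqP; split => x /=; rewrite in_itv /= andbT.
    move=> rx; have [k _ /cubeP xk] : (\bigcup_k cube k%:R) x by rewrite bigcup_cube.
    exists k => // j; rewrite !mxE; have := xk j; rewrite ltr_norml => /andP[h1 h2].
    by case: eqP => [ji|_]; apply/andP; split => //; rewrite ji.
  by move=> [k _ /(_ i)]; rewrite !mxE eqxx => /andP[].
apply: smallest_sub; first exact: sigma_algebra_measurable T.
elim/big_ind : _ => [//|X Y XG YG A [/XG|/YG]//|i _ _ [B mB <-]].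
exact: mc i measurableT B mB.
Qed.

Lemma integ_indic f E : measurable E -> integ f -> integ (fun x => f x * \1_E x).
Proof.
move=> mE fi; apply: integ_le (integ_abs fi).
  by apply: measurable_funM; [exact: integ_measurable fi|exact: measurable_indic].
move=> x; rewrite indicE normrM; case: (_ \in _); rewrite /= ?normr1 ?mulr1//.
by rewrite normr0 mulr0.
Qed.

(** Boxes are stable under intersection, and the measurable sets over which [f] integrates to 0 form
    a lambda-system, which therefore contains every measurable set. *)
Lemma Rint_boxes_ae0 f : integ f ->
  (forall a c, \int[leb]_x (f x * \1_(obox a c) x) = 0) -> {ae leb, forall x, f x = 0}.
Proof.
move=> fi f0; have mf := integ_measurable fi.
have dom E x : `|f x * \1_E x| <= `|f x|.
  by rewrite indicE normrM; case: (_ \in _); rewrite /= ?normr1 ?mulr1// normr0 mulr0.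
pose H := [set E : set 'rV[R]_n | measurable E /\ \int[leb]_x (f x * \1_E x) = 0].
have mfE E : measurable E -> measurable_fun setT (fun x => f x * \1_E x).
  by move=> mE; apply: measurable_funM => //; exact: measurable_indic.
(* Dominated convergence for increasing unions. It also puts the whole space into [H], as an
   increasing union of cubes. *)
have limH (F : nat -> set 'rV[R]_n) : nondecreasing_seq F ->
    (forall i, H (F i)) -> H (\bigcup_i F i).
  move=> ndF HF; have mU : measurable (\bigcup_i F i).
    by apply: bigcup_measurable => k _; exact: (HF k).1.
  split => //.
  have cv x : f x * \1_(F k) x @[k --> \oo] --> f x * \1_(\bigcup_i F i) x.
    have [[K _ FK]|nF] := pselect ((\bigcup_i F i) x).
      apply: cvg_near_cst; exists K => //= k /= Kk.
      rewrite !indicE !mem_set//; first by exists K.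
      by move/ndF: Kk => /subsetPset; apply.
    apply: cvg_near_cst; apply: nearW => k.
    by rewrite !indicE !memNset// => Fx; apply: nF; exists k.
  have [_ h] := Rint_dominated (fun k => mfE _ (HF k).1) (mfE _ mU) cv
    (integ_abs fi) (fun k x => dom (F k) x).
  have h2 : (fun k => \int[leb]_x (f x * \1_(F k) x)) = cst 0.
    by apply/funext => k; exact: (HF k).2.
  rewrite h2 in h; exact: (cvg_unique _ h (cvg_cst 0)).
have lam : lambda_system setT H.
  split => //.
  - rewrite -(@bigcup_cube R n); apply: limH.
      move=> k m km; apply/subsetPset => x /cubeP xk; apply/cubeP => i.
      by apply: lt_le_trans (xk i) _; rewrite ler_nat.
    by move=> k; split; [exact: measurable_obox|exact: f0].
  - move=> A B BA [mA A0] [mB B0]; split; first exact: measurableD.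
    have -> : \int[leb]_x (f x * \1_(A `\` B) x) =
        \int[leb]_x (f x * \1_A x - f x * \1_B x).
      apply: eq_Rintegral => x _; rewrite -mulrBr; congr (_ * _).
      rewrite !indicE in_setD; have [xB|xB] := boolP (x \in B).
        by rewrite (mem_set (BA _ (set_mem xB))) /= subrr.
      by rewrite andbT subr0.
    by rewrite RintB ?A0 ?B0 ?subrr//; exact: integ_indic.
have GH : boxes `<=` H.
  by move=> _ [a [c ->]]; split; [exact: measurable_obox|exact: f0].
have IG : setI_closed boxes.
  by move=> _ _ [a [c ->]] [a' [c' ->]]; eexists; eexists; exact: oboxI.
have mH : (@measurable _ 'rV[R]_n) `<=` H.
  by apply: subset_trans measurable_sub_boxes _; exact: lambda_system_subset.
have h : ae_eq leb setT (EFin \o f) (cst 0%E).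
  apply: integral_ae_eq => // E _ mE; rewrite integral0.
  have [_ E0] := mH E mE.
  transitivity (\int[leb]_x (f x * \1_E x)%:E)%E.
    rewrite integral_mkcond; apply: eq_integral => x _.
    by rewrite patchE indicE; case: ifPn => _; rewrite /= ?mulr1 ?mulr0.
  by rewrite -EFin_Rint ?E0//; exact: integ_indic.
by apply: filterS h => x /(_ I) /= [].
Qed.

(** The restriction of [w] to the box is integrated over a second box. The indicator of the
    intersection is a limit of bumps, which are test functions on [D] because the closed box lies in
    [D]. *)
Lemma test_fun_ae0_box (D : set 'rV[R]_n) w a c : cbox a c `<=` D ->
  integ (fun x => w x * \1_(obox a c) x) ->
  (forall phi, test_fun D phi -> \int[leb]_(x in D) (w x * phi x) = 0) ->
  {ae leb, forall x, obox a c x -> w x = 0}.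
Proof.
move=> acD wi w0.
suff h : {ae leb, forall x, w x * \1_(obox a c) x = 0}.
  by apply: filterS h => x + xo; rewrite indicE mem_set// mulr1.
apply: Rint_boxes_ae0 => // a' c'.
pose a2 : 'rV[R]_n := \row_i Num.max (a 0 i) (a' 0 i).
pose c2 : 'rV[R]_n := \row_i Num.min (c 0 i) (c' 0 i).
have sub : obox a2 c2 `<=` obox a c by rewrite -oboxI => x [].
have E : (fun x => w x * \1_(obox a c) x * \1_(obox a' c') x) =
         (fun x => w x * \1_(obox a c) x * \1_(obox a2 c2) x).
  apply/funext => x; rewrite -!mulrA -oboxI !indicI /=; congr (_ * _).
  by rewrite mulrA -expr2 indic_sqr.
rewrite E.
have k0 k : 0 < k.+1%:R^-1 :> R by rewrite invr_gt0.
have mw := integ_measurable wi.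
have sc k : smooth (bump (k.+1%:R^-1) a2 c2) by exact: smooth_bump.
have mF k : measurable_fun setT
    (fun x => w x * \1_(obox a c) x * bump (k.+1%:R^-1) a2 c2 x).
  by apply: measurable_funM => //; apply: continuous_measurable_rV; exact: smooth_continuous (sc k).
have mf : measurable_fun setT (fun x => w x * \1_(obox a c) x * \1_(obox a2 c2) x).
  by apply: measurable_funM => //; apply: measurable_indic; exact: measurable_obox.
have cv x : w x * \1_(obox a c) x * bump (k.+1%:R^-1) a2 c2 x @[k --> \oo] -->
    w x * \1_(obox a c) x * \1_(obox a2 c2) x.
  by apply: cvgM; [exact: cvg_cst|exact: bump_cvg].
have dom k x : `|w x * \1_(obox a c) x * bump (k.+1%:R^-1) a2 c2 x| <=
    `|w x * \1_(obox a c) x|.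
  have /andP[h1 h2] := bump_itv a2 c2 x (k0 k).
  by rewrite normrM ler_piMr// ger0_norm.
have [_ h] := Rint_dominated mF mf cv (integ_abs wi) dom.
have h2 : (fun k => \int[leb]_x (w x * \1_(obox a c) x * bump (k.+1%:R^-1) a2 c2 x)) = cst 0.
  apply/funext => k /=.
  have tb : test_fun D (bump (k.+1%:R^-1) a2 c2).
    apply: test_bump => // x xb; apply: acD => i; have := xb i.
    by rewrite !mxE ge_max le_min => /andP[/andP[-> _] /andP[-> _]].
  rewrite -[RHS](w0 _ tb) Rint_restrict.
    apply: eq_Rintegral => x _; have [xo|xo] := pselect (obox a2 c2 x).
      by rewrite indicE (mem_set (sub _ xo)) mulr1.
    by rewrite bump_out// !mulr0.
  move=> x nD; rewrite bump_out ?mulr0// => xo; apply: nD; apply: acD => i.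
  by have /andP[/ltW -> /ltW ->] := sub _ xo i.
rewrite h2 in h; exact: (cvg_unique _ h (cvg_cst 0)).
Qed.

Lemma test_fun_ae0 (D : set 'rV[R]_n) w (A C : nat -> 'rV[R]_n) :
  (forall k, cbox (A k) (C k) `<=` D) -> D `<=` \bigcup_k obox (A k) (C k) ->
  (forall k, integ (fun x => w x * \1_(obox (A k) (C k)) x)) ->
  (forall phi, test_fun D phi -> \int[leb]_(x in D) (w x * phi x) = 0) ->
  {ae leb, forall x, D x -> w x = 0}.
Proof.
move=> cD DU wi w0.
have := ae_foralln (fun k => test_fun_ae0_box (cD k) (wi k) w0).
by apply: filterS => x h /DU[k _]; exact: h.
Qed.

End box_system.

(** * Weak derivatives and traces *)

Section L2_norms.
Variables (R : realType) (n : nat).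
Implicit Types (f g v w phi chi : 'rV[R]_n -> R) (D : set 'rV[R]_n).

Lemma L2normE D f :
  L2norm D f = ((\int[leb]_x ((f \_ D) x ^+ 2)%:E) `^ 2^-1)%E.
Proof.
rewrite /L2norm unlock; congr (_ `^ _)%E; apply: eq_integral => x _ /=.
by congr EFin; rewrite powR_mulrn// real_normK ?num_real.
Qed.

Lemma L2norm_sqint D f : sqint leb (f \_ D) ->
  L2norm D f = (Num.sqrt (nsq leb (f \_ D)))%:E.
Proof.
move=> [mf fi]; rewrite L2normE -EFin_Rint// poweR_EFin powR12_sqrt//.
exact: nsq_ge0.
Qed.

Lemma L2_sqint D f : measurable D -> L2 D f <-> sqint leb (f \_ D).
Proof.
move=> mD; split=> [[mf fD]|sf].
  have mfD : measurable_fun setT (f \_ D) by apply/(measurable_restrictT _ mD).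
  split => //; apply: integ_lty.
  - exact: measurable_funX.
  - by move=> x; exact: sqr_ge0.
  - move: fD; rewrite L2normE; apply: contraLR; rewrite -!leNgt !leye_eq => /eqP ->.
    by rewrite poweRyr ?invr_neq0.
split; last by rewrite L2norm_sqint// ltry.
by apply/(measurable_restrictT _ mD); case: sf.
Qed.

Lemma cvg_sqrt0 (u : nat -> R) : (forall k, 0 <= u k) ->
  (Num.sqrt (u k))%:E @[k --> \oo] --> 0%E -> u k @[k --> \oo] --> 0.
Proof.
move=> u0 /fine_cvgP[_ h].
have := cvgM h h; rewrite mulr0.
rewrite (_ : _ \* _ = u); first exact.
by apply/funext => k /=; rewrite -expr2 sqr_sqrtr.
Qed.

Lemma L2norm_cvg0 D (F : nat -> 'rV[R]_n -> R) : (forall k, sqint leb (F k \_ D)) ->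
  L2norm D (F k) @[k --> \oo] --> 0%E <-> nsq leb (F k \_ D) @[k --> \oo] --> 0.
Proof.
move=> F2; split => h.
  apply: cvg_sqrt0 => [k|]; first exact: nsq_ge0.
  by under eq_fun do rewrite -L2norm_sqint//.
under eq_fun do rewrite L2norm_sqint//.
apply: cvg_EFin; first exact: nearW.
rewrite -[X in _ --> X](sqrtr0 R); apply: continuous_cvg => //.
exact: sqrt_continuous.
Qed.

Lemma restrictB D f g : (f \- g) \_ D = fun x => (f \_ D) x - (g \_ D) x.
Proof. by apply/funext => x; rewrite !patchE; case: ifPn => //; rewrite subr0. Qed.

Lemma restrictM D f g : (fun x => f x * g x) \_ D = fun x => (f \_ D) x * g x.
Proof. by apply/funext => x; rewrite !patchE; case: ifPn => //; rewrite mul0r. Qed.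

Lemma restrict_off D f x : ~ D x -> (f \_ D) x = 0.
Proof. by move=> nD; rewrite patchE memNset. Qed.

(** The form in which openness of [D] is used: with countably many boxes, vanishing almost
    everywhere passes from each box to [D]. *)
Definition exhausted D := measurable D /\ exists A C : nat -> 'rV[R]_n,
  (forall k, cbox (A k) (C k) `<=` D) /\ D `<=` \bigcup_k obox (A k) (C k).

Lemma sqint_indic_box a c : sqint leb (\1_(obox a c) : 'rV[R]_n -> R).
Proof.
have mb := @measurable_obox R n a c.
split; first exact: measurable_indic.
under eq_fun do rewrite indic_sqr.
apply: integ_lty; first exact: measurable_indic.
  by move=> x.
by rewrite integral_indic// setIT; exact: leb_obox_lty.
Qed.

Lemma sqint_test D phi : test_fun D phi -> sqint leb phi.
Proof.
move=> tp; have [M [B [M0 B0 _ _ [pB _]]]] := test_fun_bounds tp.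
have mp := measurable_test tp; split => //.
by under eq_fun do rewrite expr2; exact: integ_test_mul tp mp pB.
Qed.

Lemma sqint_partial_test D phi i : test_fun D phi -> sqint leb (partial i phi).
Proof.
move=> tp; have [M [B [M0 B0 _ _ [_ pB]]]] := test_fun_bounds tp.
have mp := @measurable_partial_test _ _ _ _ i tp; split => //.
by under eq_fun do rewrite expr2; exact: integ_partial_mul tp mp (pB i).
Qed.

Lemma sqint_restrict D f : measurable D -> sqint leb f -> sqint leb (f \_ D).
Proof.
move=> mD sf; have [mf _] := sf; apply: sqint_le sf.
  by apply/(measurable_restrictT _ mD); exact: measurable_funS mf.
by move=> x; rewrite patchE; case: ifPn; rewrite ?normr0.
Qed.

Lemma integ_test D f phi : sqint leb (f \_ D) -> test_fun D phi ->
  integ (fun x => (f \_ D) x * phi x).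
Proof. by move=> sf tp; apply: sqint_mul => //; exact: sqint_test tp. Qed.

Lemma integ_test_partial D f phi i : sqint leb (f \_ D) -> test_fun D phi ->
  integ (fun x => (f \_ D) x * partial i phi x).
Proof. by move=> sf tp; apply: sqint_mul => //; exact: sqint_partial_test tp. Qed.

Lemma weak_partial_unique D i f v w : exhausted D -> L2 D v -> L2 D w ->
  is_weak_partial D i f v -> is_weak_partial D i f w ->
  {ae leb, forall x, (v \_ D) x = (w \_ D) x}.
Proof.
move=> [mD [A [C [cD DU]]]] /(L2_sqint _ mD) v2 /(L2_sqint _ mD) w2 vf wf.
have s := sqintB v2 w2.
have h := test_fun_ae0 (w := fun x => (v \_ D) x - (w \_ D) x) cD DU.
have h1 : {ae leb, forall x, D x -> (v \_ D) x - (w \_ D) x = 0}.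
  apply: h => [k|phi tp]; first by apply: sqint_mul => //; exact: sqint_indic_box.
  rewrite Rint_restrict; last by move=> x nD; rewrite !restrict_off// subrr mul0r.
  under eq_Rintegral do rewrite mulrBl.
  rewrite RintB; [|exact: integ_test|exact: integ_test].
  have := vf phi tp; rewrite (wf phi tp) !(Rintegral_mkcond _ D) !restrictM => /oppr_inj ->.
  by rewrite subrr.
apply: filterS h1 => x hx; have [Dx|nD] := pselect (D x).
  by apply/eqP; rewrite -subr_eq0; apply/eqP; exact: hx.
by rewrite !restrict_off.
Qed.

Lemma weak_partialP D i f : H1 D f ->
  L2 D (weak_partial D i f) /\ is_weak_partial D i f (weak_partial D i f).
Proof. by move=> [_ /(_ i) h]; exact: (xgetPex (cst 0) h). Qed.

(** An explicit weak derivative of [phi - f] is exhibited, whereas [weak_partial] of that difference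
    is another choice; [weak_partial_unique] reconciles the two in [H1_approx]. *)
Lemma H1_test_sub D f phi : measurable D -> H1 D f -> test_fun setT phi ->
  H1 D (phi \- f) /\ forall i, L2 D (partial i phi \- weak_partial D i f) /\
    is_weak_partial D i (phi \- f) (partial i phi \- weak_partial D i f).
Proof.
move=> mD Hf tp.
have fD : sqint leb (f \_ D) by apply/L2_sqint => //; case: Hf.
have pD : sqint leb (phi \_ D) by apply: sqint_restrict => //; exact: sqint_test tp.
have dpD i : sqint leb (partial i phi \_ D).
  by apply: sqint_restrict => //; exact: sqint_partial_test tp.
have vD i : sqint leb (weak_partial D i f \_ D).
  by apply/L2_sqint => //; case: (weak_partialP i Hf).
have H i : L2 D (partial i phi \- weak_partial D i f) /\
    is_weak_partial D i (phi \- f) (partial i phi \- weak_partial D i f).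
  split; first by apply/L2_sqint => //; rewrite restrictB; exact: sqintB.
  move=> chi tc.
  have := @test_fun_weak_partial R n D phi i tp chi tc.
  have [_ /(_ _ tc)] := weak_partialP i Hf.
  rewrite !(Rintegral_mkcond _ D) !restrictM => h1 h2.
  have E (g1 g2 k : 'rV[R]_n -> R) : integ (fun x => g1 x * k x) ->
      integ (fun x => g2 x * k x) ->
      \int[leb]_x ((g1 x - g2 x) * k x) = \int[leb]_x (g1 x * k x) - \int[leb]_x (g2 x * k x).
    by move=> i1 i2; rewrite -RintB//; apply: eq_Rintegral => x _; rewrite mulrBl.
  rewrite !restrictB E; [|exact: integ_test_partial|exact: integ_test_partial].
  rewrite E; [|exact: integ_test|exact: integ_test].
  by rewrite h1 h2; ring.
split => //; split; first by apply/L2_sqint => //; rewrite restrictB; exact: sqintB.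
by move=> i; exists (partial i phi \- weak_partial D i f).
Qed.

Lemma H1norm_ge D g : measurable D -> H1 D g ->
  ((Num.sqrt (nsq leb (g \_ D)))%:E <= H1norm D g)%E /\
  forall i, ((Num.sqrt (nsq leb (weak_partial D i g \_ D)))%:E <= H1norm D g)%E.
Proof.
move=> mD Hg.
have gD : sqint leb (g \_ D) by apply/L2_sqint => //; case: Hg.
have vD i : sqint leb (weak_partial D i g \_ D).
  by apply/L2_sqint => //; case: (weak_partialP i Hg).
pose q x := (g \_ D) x ^+ 2 + \sum_i (weak_partial D i g \_ D) x ^+ 2.
have qi : integ q.
  by apply: integD; [exact: gD.2|apply: integ_sum => i; exact: (vD i).2].
have E : H1norm D g = ((\int[leb]_x q x) `^ 2^-1)%:E.
  rewrite /H1norm -poweR_EFin EFin_Rint//; congr (_ `^ _)%E.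
  rewrite [LHS]integral_mkcond; apply: eq_integral => x _.
  rewrite /q !patchE; have [xD|xD] := boolP (x \in D).
    by congr (_ + _)%:E; apply: eq_bigr => i _; rewrite patchE xD.
  by rewrite expr0n add0r big1// => i _; rewrite patchE (negbTE xD) expr0n.
have q0 : 0 <= \int[leb]_x q x.
  by apply: Rint_ge0 => x; rewrite addr_ge0 ?sqr_ge0// sumr_ge0// => i _; exact: sqr_ge0.
rewrite E powR12_sqrt//; split => [|i]; rewrite lee_fin ler_wsqrtr//; apply: Rint_le => //.
- exact: gD.2.
- by move=> x; rewrite lerDl sumr_ge0// => i _; exact: sqr_ge0.
- exact: (vD i).2.
- move=> x; rewrite /q (bigD1 i)//= addrCA lerDl addr_ge0 ?sqr_ge0// sumr_ge0// => j _.
  exact: sqr_ge0.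
Qed.

(** [H1norm] bounds the function and each derivative separately. The derivative inside it is a
    representative chosen for [phi k - f], here replaced, up to a null set, by the difference of the
    derivatives. *)
Lemma H1_approx D f (phi : nat -> 'rV[R]_n -> R) : exhausted D -> H1 D f ->
  (forall k, test_fun setT (phi k)) ->
  H1norm D (phi k \- f) @[k --> \oo] --> 0%E ->
  nsq leb (fun x => (phi k \_ D) x - (f \_ D) x) @[k --> \oo] --> 0 /\
  forall i, nsq leb (fun x => (partial i (phi k) \_ D) x - (weak_partial D i f \_ D) x)
    @[k --> \oo] --> 0.
Proof.
move=> eD Hf tp h; have [mD _] := eD.
have Hk k := (H1_test_sub mD Hf (tp k)).
have sq0 (u : nat -> R) : (forall k, 0 <= u k) ->
    (forall k, ((Num.sqrt (u k))%:E <= H1norm D (phi k \- f)%R)%E) ->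
    u k @[k --> \oo] --> 0.
  move=> u0 ule; apply: cvg_sqrt0 => //.
  apply: (squeeze_cvge (f := fun=> 0%E) _ _ h); last exact: cvg_cst.
  by apply: nearW => k; rewrite lee_fin sqrtr_ge0 ule.
split => [|i]; apply: sq0 => k; rewrite ?nsq_ge0//.
  have [h1 _] := H1norm_ge mD (Hk k).1.
  by apply: le_trans h1; rewrite restrictB.
have [_ /(_ i) h1] := H1norm_ge mD (Hk k).1.
have [L2k wk] := (Hk k).2 i; have [L2k' wk'] := weak_partialP i (Hk k).1.
apply: le_trans h1; rewrite le_eqVlt; apply/orP; left; apply/eqP; congr (Num.sqrt _)%:E.
rewrite -restrictB; apply: nsq_ae.
- by have [] := (L2_sqint _ mD).1 L2k.
- by have [] := (L2_sqint _ mD).1 L2k'.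
- exact: weak_partial_unique wk wk'.
Qed.

End L2_norms.

(** * Traces at the top of the strip *)

Section strip_traces.
Variables (R : realType) (d : nat) (b : R).
Hypothesis b0 : 0 < b.
Local Notation mu := (@lebesgue_measure R).
Local Notation S := (strip b : set 'rV[R]_d.+1).
Implicit Types (f phi : 'rV[R]_d.+1 -> R).

Lemma exhausted_strip : exhausted S.
Proof.
split; first exact: measurable_strip.
exists (fun k => join_pt (const_mx (- k%:R), k.+1%:R^-1)),
       (fun k => join_pt (const_mx k%:R, b - k.+1%:R^-1)); split.
  move=> k x /(_ ord_max); rewrite !join_pt_max /= => /andP[h1 h2].
  have k0 : 0 < k.+1%:R^-1 :> R by rewrite invr_gt0.
  move: (k.+1%:R^-1) k0 h1 h2 => e e0 h1 h2.
  by rewrite /strip /=; apply/andP; split; lra.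
move=> x; rewrite /strip /= => /andP[x0 xb].
have [m _ /cubeP hm] : (\bigcup_k cube k%:R) (init_pt x) by rewrite bigcup_cube.
pose e := Num.min (x 0 ord_max) (b - x 0 ord_max).
have e0 : 0 < e by rewrite lt_min x0 subr_gt0.
(* One index meets both constraints: the horizontal coordinates are below [k], and the distance to
   the top and bottom exceeds [1 / (k + 1)]. *)
pose k := maxn m (Num.truncn e^-1).
have ke : k.+1%:R^-1 < e.
  rewrite -[ltRHS]invrK ltf_pV2 ?posrE ?invr_gt0//.
  apply: lt_le_trans (truncnS_gt _) _.
  by rewrite ler_nat ltnS leq_maxr.
move: ke; rewrite lt_min => /andP[k1 k2].
exists k => //; elim/ord_maxP => [|j].
  rewrite !join_pt_max /=; move: (k.+1%:R^-1) k1 k2 => e' k1 k2.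
  by apply/andP; split; lra.
rewrite !join_pt_lift !mxE; have := hm j; rewrite mxE ltr_norml => /andP[h1 h2].
have mk : m%:R <= k%:R :> R by rewrite ler_nat leq_maxl.
by apply/andP; split; lra.
Qed.

Lemma restrict_off_strip0 f : off_strip0 b (f \_ S).
Proof. by move=> x; exact: restrict_off. Qed.

Lemma restrict_join f x t :
  (f \_ S) (join_pt (x, t)) = ((fun s => f (join_pt (x, s))) \_ (`]0, b[%classic)) t.
Proof.
rewrite !patchE (_ : (join_pt (x, t) \in S) = (t \in `]0, b[%classic))//.
by apply/idP/idP; rewrite !inE /strip /= join_pt_max in_itv.
Qed.

Lemma avg_restrict f x :
  avg (f \_ S) x = \int[mu]_(t in `]0, b[) f (join_pt (x, t)).
Proof.
by rewrite Rintegral_mkcond; apply: eq_Rintegral => t _; rewrite restrict_join.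
Qed.

Lemma avg_derivative (G g : 'rV[R]_d.+1 -> R) (x : 'rV[R]_d) :
  (forall y, is_derive y (delta_mx 0 ord_max) G (g y)) -> continuous g ->
  avg (g \_ S) x = G (join_pt (x, b)) - G (join_pt (x, 0)).
Proof.
move=> dG cg; rewrite avg_restrict.
have dF (t : R) : is_derive t 1 (fun t => G (join_pt (x, t))) (g (join_pt (x, t))).
  apply: is_derive_line (dG (join_pt (x, t))) => h.
  by rewrite -join_shift_max [_%:A]mulr1.
have cF : continuous (fun t => G (join_pt (x, t))).
  by move=> t; apply: derivable_continuous; have [] := dF t.
have cf : continuous (fun t => g (join_pt (x, t))).
  rewrite (_ : (fun t => _) = fun s : R => g (s *: delta_mx 0 ord_max + join_pt (x, 0))).
    exact: continuous_line.
  by apply/funext => t; rewrite -join_shift_max addr0.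
have mf : measurable_fun `]0, b[ (EFin \o (fun t => g (join_pt (x, t)))).
  by apply/measurable_EFinP; apply: measurable_funTS; exact: continuous_measurable_fun.
rewrite /Rintegral -(@integral_itv_bndoo _ 0 b _ true false)//.
rewrite (@continuous_FTC2 _ (fun t => g (join_pt (x, t))) (fun t => G (join_pt (x, t))))//.
- by apply: continuous_subspaceT.
- split.
  + by move=> t _; have [] := dF t.
  + by apply: cvg_at_right_filter; exact: cF.
  + by apply: cvg_at_left_filter; exact: cF.
- by move=> t _; rewrite derive1E; have [] := dF t.
Qed.

Lemma avg_partial_test phi x : test_fun setT phi ->
  avg (partial ord_max phi \_ S) x = phi (join_pt (x, b)) - phi (join_pt (x, 0)).
Proof.
move=> [sp _]; apply: avg_derivative; last exact: smooth_partial_continuous.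
by move=> y; exact: smooth_is_derive.
Qed.

(** The weight [t] removes the bottom value, so the top value is expressed by data inside the
    strip. *)
Lemma avg_weighted_test phi x : test_fun setT phi ->
  avg ((fun y => phi y + y 0 ord_max * partial ord_max phi y) \_ S) x =
  b * phi (join_pt (x, b)).
Proof.
move=> [sp _].
have dG y : is_derive y (delta_mx 0 ord_max) (fun y : 'rV[R]_d.+1 => y 0 ord_max * phi y)
    (phi y + y 0 ord_max * partial ord_max phi y).
  have h := @smooth_is_derive _ _ _ ord_max y sp.
  have hc : is_derive y (delta_mx 0 ord_max) (fun z : 'rV[R]_d.+1 => z 0 ord_max) 1.
    have h1 : is_derive (y 0 ord_max) 1 (@id R) 1 by exact: is_derive_id.
    apply: is_derive_line h1 => s.
    by rewrite !mxE !eqxx /= [_%:A]mulr1 mulr1.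
  by apply: is_derive_eq; rewrite /GRing.scale /= mulr1; ring.
have cg : continuous (fun y => phi y + y 0 ord_max * partial ord_max phi y).
  move=> y.
  have c1 : {for y, continuous phi} by exact: smooth_continuous.
  have c2 : {for y, continuous (partial ord_max phi)} by exact: smooth_partial_continuous.
  have c3 : {for y, continuous (fun z : 'rV[R]_d.+1 => z 0 ord_max)}.
    by apply: coord_continuous.
  exact: (cvgD c1 (cvgM c3 c2)).
by rewrite (avg_derivative x dG cg) !join_pt_max /= mul0r subr0.
Qed.

Lemma sqint_test_slice phi c : test_fun setT phi ->
  sqint leb (fun x : 'rV[R]_d => phi (join_pt (x, c))).
Proof.
move=> tp; have [M [B [_ _ p0 _ [pB _]]]] := test_fun_bounds tp.
apply: (sqint_supp_cube (M := M) (B := B)) => // [|x cx].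
  exact: (measurableT_comp (measurable_test tp) (measurable_join_l c)).
by apply: p0; left => /join_cube[].
Qed.

(** The sequence that gives trace 0 at the bottom also gives the trace at the top: at height [b],
    [phi k] is its value at height 0 plus the vertical integral of its derivative, and both converge
    in $L^2$. *)
Lemma is_trace_top f : is_trace b 0 f (cst 0) ->
  is_trace b b f (avg (weak_partial S ord_max f \_ S)).
Proof.
move=> [Hf _ [phi [tp hH hL]]]; set v := weak_partial _ _ _.
have [mS _] := exhausted_strip.
have [_ /(_ ord_max) cv] := H1_approx exhausted_strip Hf tp hH.
have vS : sqint leb (v \_ S) by apply/L2_sqint => //; case: (weak_partialP ord_max Hf).
have pS k : sqint leb (partial ord_max (phi k) \_ S).
  by apply: sqint_restrict => //; exact: sqint_partial_test (tp k).
have [av _] := sqint_avg b0 (restrict_off_strip0 v) vS.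
have s0 k := sqint_test_slice 0 (tp k); have sb k := sqint_test_slice b (tp k).
have restT (g : 'rV[R]_d -> R) : g \_ setT = g by apply: restrict_supp => x /(_ Logic.I).
split => //; first by apply/(L2_sqint _ measurableT); rewrite restT.
exists phi; split => //.
apply/L2norm_cvg0 => [k|]; first by rewrite restT; exact: sqintB.
have n0 : nsq leb (fun x : 'rV[R]_d => phi k (join_pt (x, 0))) @[k --> \oo] --> 0.
  have E k : ((fun x' => phi k (join_pt (x', 0))) \- cst 0) \_ setT =
     (fun x : 'rV[R]_d => phi k (join_pt (x, 0))).
    by rewrite restT; apply/funext => x; rewrite /= subr0.
  have sE k : sqint leb (((fun x' => phi k (join_pt (x', 0))) \- cst 0) \_ setT).
    by rewrite E; exact: s0.
  have := (L2norm_cvg0 sE).1 hL.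
  by rewrite (_ : (fun k => _) = fun k => nsq leb (fun x : 'rV[R]_d => phi k (join_pt (x, 0))))//;
    apply/funext => k; rewrite E.
have na := nsq_avg_cvg b0 (fun k => restrict_off_strip0 _) (restrict_off_strip0 _) pS vS cv.
have h2 : 2 * nsq leb (fun x : 'rV[R]_d => phi k (join_pt (x, 0))) +
    2 * nsq leb (fun x => avg (partial ord_max (phi k) \_ S) x - avg (v \_ S) x)
    @[k --> \oo] --> 0.
  exact: cvg0_lin.
apply: cvg0_le h2 => k; rewrite nsq_ge0 /= restT.
rewrite (_ : _ \- _ = fun x => phi k (join_pt (x, 0)) +
  (avg (partial ord_max (phi k) \_ S) x - avg (v \_ S) x)); last first.
  by apply/funext => x; rewrite /= avg_partial_test//; ring.
apply: nsqD => //; apply: sqintB => //.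
by have [] := sqint_avg b0 (restrict_off_strip0 (partial ord_max (phi k))) (pS k).
Qed.

(* For test functions this integrates d/dt (t phi); as the right-hand side does
   not involve h, the trace at the top is unique. *)
Lemma is_trace_top_avg f h : is_trace b b f h ->
  {ae leb, forall x, b * h x =
    avg (fun y => (f \_ S) y + (y 0 ord_max * \1_S y) * (weak_partial S ord_max f \_ S) y) x}.
Proof.
move=> [Hf hL2 [phi [tp hH hL]]]; set v := weak_partial _ _ _.
have [mS _] := exhausted_strip.
have [cf /(_ ord_max) cv] := H1_approx exhausted_strip Hf tp hH.
have fS : sqint leb (f \_ S) by apply/L2_sqint => //; case: Hf.
have vS : sqint leb (v \_ S) by apply/L2_sqint => //; case: (weak_partialP ord_max Hf).
have phS k : sqint leb (phi k \_ S).
  by apply: sqint_restrict => //; exact: sqint_test (tp k).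
have pS k : sqint leb (partial ord_max (phi k) \_ S).
  by apply: sqint_restrict => //; exact: sqint_partial_test (tp k).
have restT (g : 'rV[R]_d -> R) : g \_ setT = g by apply: restrict_supp => x /(_ Logic.I).
have h2 : sqint leb h by have /L2_sqint := hL2; rewrite restT; apply.
(* The indicator keeps the multiplier below [b], so that it preserves square integrability. *)
pose y1 (y : 'rV[R]_d.+1) := y 0 ord_max * \1_S y.
have my1 : measurable_fun setT y1.
  by apply: measurable_funM; [exact: measurable_coord|exact: measurable_indic].
have by1 y : `|y1 y| <= b.
  rewrite /y1 indicE; have [yS|yS] := boolP (y \in S).
    by rewrite mulr1; move: yS; rewrite inE /strip /= => /andP[? ?]; rewrite ger0_norm ltW.
  by rewrite mulr0 normr0 ltW.
pose W g g' (y : 'rV[R]_d.+1) := (g \_ S) y + y1 y * (g' \_ S) y : R.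
pose Wk k := W (phi k) (partial ord_max (phi k)).
have W0 g g' : off_strip0 b (W g g').
  by move=> y yS; rewrite /W !restrict_off// mulr0 addr0.
have W2 g g' : sqint leb (g \_ S) -> sqint leb (g' \_ S) -> sqint leb (W g g').
  by move=> g2 g2'; apply: sqintD => //; exact: sqint_mulb.
pose NF k := nsq leb (fun y => (phi k \_ S) y - (f \_ S) y).
pose NP k := nsq leb (fun y => (partial ord_max (phi k) \_ S) y - (v \_ S) y).
have cW : nsq leb (fun y => Wk k y - W f v y) @[k --> \oo] --> 0.
  have hc : 2 * NF k + 2 * (b ^+ 2 *
     NP k) @[k --> \oo] --> 0.
    rewrite (_ : (fun k => _) = fun k => 2 * NF k + (2 * b ^+ 2) *
     NP k); first exact: cvg0_lin.
    by apply/funext => k; rewrite -mulrA.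
  apply: cvg0_le hc => k; rewrite nsq_ge0 /=.
  have sd := sqintB (pS k) vS.
  have sy := sqint_mulb my1 by1 sd.
  rewrite (_ : (fun y => _) = fun y => ((phi k \_ S) y - (f \_ S) y) +
     y1 y * ((partial ord_max (phi k) \_ S) y - (v \_ S) y)); last first.
    by apply/funext => y; rewrite /Wk /W; ring.
  apply: le_trans (nsqD (sqintB (phS k) fS) sy) _.
  rewrite lerD2l ler_wpM2l// -(nsqZ b sd); apply: Rint_le.
  - exact: sy.2.
  - exact: (sqintZ b sd).2.
  - move=> y; rewrite [leLHS]exprMn [leRHS]exprMn ler_wpM2r ?sqr_ge0//; exact: sqr_le_norm (by1 y).
have na := nsq_avg_cvg b0 (fun k => W0 _ _) (W0 _ _) (fun k => W2 _ _ (phS k) (pS k)) (W2 _ _ fS vS) cW.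
have [aW _] := sqint_avg b0 (W0 f v) (W2 _ _ fS vS).
have sb k := sqint_test_slice b (tp k).
have nh : nsq leb (fun x : 'rV[R]_d => phi k (join_pt (x, b)) - h x) @[k --> \oo] --> 0.
  have E k : ((fun x' => phi k (join_pt (x', b))) \- h) \_ setT =
     (fun x : 'rV[R]_d => phi k (join_pt (x, b)) - h x) by rewrite restT.
  have sE k : sqint leb (((fun x' => phi k (join_pt (x', b))) \- h) \_ setT).
    by rewrite E; exact: sqintB.
  have := (L2norm_cvg0 sE).1 hL.
  by rewrite (_ : (fun k => _) = fun k => nsq leb (fun x : 'rV[R]_d => phi k (join_pt (x, b)) - h x))//;
    apply/funext => k; rewrite E.
have EW k x : avg (Wk k) x = b * phi k (join_pt (x, b)).
  rewrite -avg_weighted_test//; congr (avg _ _); apply/funext => y.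
  rewrite /Wk /W /y1 !patchE indicE; case: ifPn => yS; first by rewrite mulr1.
  by rewrite !mulr0 addr0.
have s3 : sqint leb (fun x => b * h x - avg (W f v) x) by apply: sqintB => //; exact: sqintZ.
(* The quantity does not depend on [k]; inserting [b * phi k] at height [b] bounds it by terms that
   tend to 0. *)
have n0 : nsq leb (fun x => b * h x - avg (W f v) x) = 0.
  have hc : 2 * nsq leb (fun x => avg (Wk k) x - avg (W f v) x) +
    2 * (b ^+ 2 * nsq leb (fun x : 'rV[R]_d => phi k (join_pt (x, b)) - h x)) @[k --> \oo] --> 0.
    rewrite (_ : (fun k => _) = fun k => 2 * nsq leb (fun x => avg (Wk k) x - avg (W f v) x) +
    (2 * b ^+ 2) * nsq leb (fun x : 'rV[R]_d => phi k (join_pt (x, b)) - h x)); first exact: cvg0_lin.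
    by apply/funext => k; rewrite -mulrA.
  apply/eqP; rewrite eq_le nsq_ge0 andbT.
  apply: (ler_cvg_to (cvg_cst (nsq leb (fun x => b * h x - avg (W f v) x))) hc).
  apply: nearW => k /=.
  have sk := sqintB (sb k) h2.
  have sak : sqint leb (fun x => avg (Wk k) x - avg (W f v) x).
    by apply: sqintB => //; have [] := sqint_avg b0 (W0 _ _) (W2 _ _ (phS k) (pS k)).
  have := nsqD sak (sqintN (sqintZ b sk)); rewrite nsqN nsqZ//.
  congr (_ <= _); congr nsq; apply/funext => x; rewrite EW; ring.
apply: filterS (nsq_eq0 s3 n0) => x /eqP; rewrite subr_eq0 => /eqP; exact.
Qed.

(** [trace] is a choice among all traces. One exists by [is_trace_top], and any two agree almost
    everywhere, since [b] times either is the same vertical integral. *)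
Lemma trace_top f : is_trace b 0 f (cst 0) ->
  L2 setT (trace b b f) /\
  {ae leb, forall x, trace b b f x = avg (weak_partial S ord_max f \_ S) x}.
Proof.
move=> tf; have t1 := is_trace_top tf.
have t2 : is_trace b b f (trace b b f).
  by apply: (xgetPex (cst 0)); exists (avg (weak_partial S ord_max f \_ S)).
split; first by case: t2.
apply: filterS2 (is_trace_top_avg t1) (is_trace_top_avg t2) => x h1 h2.
by apply: (mulfI (lt0r_neq0 b0)); rewrite h1 h2.
Qed.

End strip_traces.

(** * Fourier transform of vertically integrated horizontal derivatives *)

Section horizontal_fourier.
Variables (R : realType) (d : nat) (b : R).
Hypothesis b0 : 0 < b.
Local Notation mu := (@lebesgue_measure R).
Local Notation S := (strip b : set 'rV[R]_d.+1).
Implicit Types (f q phi : 'rV[R]_d.+1 -> R) (xi : 'rV[R]_d).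

Local Notation integ_slices w := (integ w /\
  forall x, mu.-integrable setT (EFin \o (fun t => w (join_pt (x, t))))).

Lemma restrict_istrip f : f \_ S = fun x => f x * istrip b x.
Proof.
apply/funext => x; rewrite patchE /istrip indicE.
by case: ifPn => _; rewrite ?mulr1 ?mulr0.
Qed.

Lemma integ_restrict_slices q M B : measurable_fun setT q ->
  (forall x, ~ cube M x -> q x = 0) -> (forall x, `|q x| <= B) ->
  integ_slices (q \_ S).
Proof.
move=> mq q0 qB; have B0 : 0 <= B by exact: le_trans (qB 0).
have ms : measurable_fun setT (q \_ S).
  by rewrite restrict_istrip; apply: measurable_funM => //; exact: measurable_istrip.
have sB x : `|(q \_ S) x| <= B.
  by rewrite patchE; case: ifPn => _ //; rewrite normr0.
split.
  apply: (integ_supp_cube (M := M) (B := B)) => // x cx.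
  by rewrite restrict_istrip q0// mul0r.
move=> x; apply: (@integ_le _ _ _ mu (fun t => (q \_ S) (join_pt (x, t))) (fun t => B * \1_(`]0, b[%classic) t)).
- exact: measurable_slice.
- move=> t; rewrite restrict_join patchE indicE; case: ifPn => _.
    by rewrite mulr1.
  by rewrite mulr0 normr0.
- apply: integZ; have [_] := sqint_indic_itv b.
  by under eq_fun do rewrite indic_sqr.
Qed.

Lemma test_integ_slices phi : test_fun setT phi ->
  integ_slices (phi \_ S) /\ forall i, integ_slices (partial i phi \_ S).
Proof.
move=> tp; have [M [B [_ _ p0 q0 [pB qB]]]] := test_fun_bounds tp; split=> [|i].
  exact: integ_restrict_slices (measurable_test tp) (fun x cx => p0 x (or_introl cx)) pB.
exact: integ_restrict_slices (measurable_partial_test i tp)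
  (fun x cx => q0 i x (or_introl cx)) (qB i).
Qed.

Lemma avg_test_fourier phi j xi : test_fun setT phi ->
  cosT (avg (partial (lift ord_max j) phi \_ S)) xi =
    2 * pi * xi 0 j * sinT (avg (phi \_ S)) xi /\
  sinT (avg (partial (lift ord_max j) phi \_ S)) xi =
    - (2 * pi * xi 0 j) * cosT (avg (phi \_ S)) xi.
Proof.
move=> tp; have [[pi1 pi2] /(_ (lift ord_max j))[qi1 qi2]] := test_integ_slices tp.
have mc : measurable_fun setT (@cos R) by exact: measurable_cos.
have ms : measurable_fun setT (@sin R) by exact: measurable_sin.
rewrite /cosT /sinT !(osc_avg xi mc (@cos_max R))// !(osc_avg xi ms (@sin_max R))//.
have E q (T : R -> R) : \int[leb]_x ((q \_ S) x * T (phase (init_pt x) xi)) =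
    \int[leb]_x (q x * (istrip b x * T (phase (init_pt x) xi))).
  by apply: eq_Rintegral => x _; rewrite restrict_istrip mulrA.
by rewrite !E; exact: strip_partial_cos_sin.
Qed.

(** The factor [2 * pi * xi 0 j] is put on [psi], because [C] and [T] multiplied by it may leave
    $L^2$. The identity holds along the approximating test functions, and both sides are continuous
    in $L^2$. *)
Lemma avg_weak_partial_fourier f (j : 'I_d) (C T psi : 'rV[R]_d -> R) : is_trace b 0 f (cst 0) ->
  (forall phi : 'rV[R]_d -> R, integ phi -> sqint leb phi ->
      \int[leb]_x (avg (f \_ S) x * cosT phi x) = \int[leb]_x (C x * phi x) /\
      \int[leb]_x (avg (f \_ S) x * sinT phi x) = \int[leb]_x (T x * phi x)) ->
  integ psi -> sqint leb psi ->
  integ (fun xi => 2 * pi * xi 0 j * psi xi) ->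
  sqint leb (fun xi => 2 * pi * xi 0 j * psi xi) ->
  \int[leb]_x (avg (weak_partial S (lift ord_max j) f \_ S) x * cosT psi x) =
    \int[leb]_xi (T xi * (2 * pi * xi 0 j * psi xi)) /\
  \int[leb]_x (avg (weak_partial S (lift ord_max j) f \_ S) x * sinT psi x) =
    - \int[leb]_xi (C xi * (2 * pi * xi 0 j * psi xi)).
Proof.
pose q xi := 2 * pi * xi 0 j * psi xi.
move=> [Hf _ [phi [tp hH _]]] hCT pi1 pi2 qi1 qi2; set i := lift ord_max j.
set v := weak_partial _ _ _.
have [mS _] := @exhausted_strip R d b.
have [cf /(_ i) cv] := H1_approx (@exhausted_strip R d b) Hf tp hH.
have fS : sqint leb (f \_ S) by apply/L2_sqint => //; case: Hf.
have vS : sqint leb (v \_ S) by apply/L2_sqint => //; case: (weak_partialP i Hf).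
have phS k : sqint leb (phi k \_ S).
  by apply: sqint_restrict => //; exact: sqint_test (tp k).
have pS k : sqint leb (partial i (phi k) \_ S).
  by apply: sqint_restrict => //; exact: sqint_partial_test (tp k).
have o (g : 'rV[R]_d.+1 -> R) := restrict_off_strip0 (b := b) g.
have ca := nsq_avg_cvg b0 (fun k => o _) (o _) phS fS cf.
have cb := nsq_avg_cvg b0 (fun k => o _) (o _) pS vS cv.
have ap k := (sqint_avg b0 (o _) (phS k)).1.
have aq k := (sqint_avg b0 (o _) (pS k)).1.
have af := (sqint_avg b0 (o _) fS).1.
have av := (sqint_avg b0 (o _) vS).1.
have [sc ss _] := plancherel_le pi1 pi2.
have [sc' ss' _] := plancherel_le qi1 qi2.
have ia k : integ (avg (phi k \_ S)).
  by have [[? ?] _] := test_integ_slices (tp k); exact: integ_avg.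
have ib k : integ (avg (partial i (phi k) \_ S)).
  by have [_ /(_ i)[? ?]] := test_integ_slices (tp k); exact: integ_avg.
have [hC hT] := hCT _ qi1 qi2.
rewrite -hT -hC; split.
- have l1 := nsq_cvg_mul aq av sc cb.
  have l2 := nsq_cvg_mul ap af ss' ca.
  (* The vertical integrals of [phi k] and of its derivative are integrable, so the multiplication
     formula moves the transform onto them, where differentiation becomes a factor that is then
     given to [psi]. *)
  have E k : \int[leb]_x (avg (partial i (phi k) \_ S) x * cosT psi x) =
     \int[leb]_x (avg (phi k \_ S) x * sinT q x).
    rewrite (Rint_cosT (ib k) pi1) (Rint_sinT (ia k) qi1).
    by apply: eq_Rintegral => xi _; rewrite (avg_test_fourier j xi (tp k)).1 /q; ring.
  apply: (cvg_unique _ _ l2) => //=.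
  by move: l1; under eq_fun do rewrite E.
- have l1 := nsq_cvg_mul aq av ss cb.
  have l2 := cvgN (nsq_cvg_mul ap af sc' ca).
  have E k : \int[leb]_x (avg (partial i (phi k) \_ S) x * sinT psi x) =
     - \int[leb]_x (avg (phi k \_ S) x * cosT q x).
    rewrite (Rint_sinT (ib k) pi1) (Rint_cosT (ia k) qi1) -RintN.
      by apply: eq_Rintegral => xi _; rewrite (avg_test_fourier j xi (tp k)).2 /q; ring.
    by apply: sqint_mul => //; have [] := plancherel_le (ia k) (ap k).
  have l3 : \int[leb]_x (avg (partial i (phi k) \_ S) x * sinT psi x) @[k --> \oo] -->
      - \int[leb]_x (avg (f \_ S) x * cosT q x).
    by under eq_fun do rewrite E; exact: l2.
  by apply: (cvg_unique _ _ l3) => //=.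
Qed.

End horizontal_fourier.

(** * Fourier transforms of regular distributions *)

Section complex_norm.
Variable R : realType.
Implicit Types z w : R[i].

Lemma ReM z w : complex.Re (z * w) = complex.Re z * complex.Re w - complex.Im z * complex.Im w.
Proof. by case: z; case: w. Qed.

Lemma ImM z w : complex.Im (z * w) = complex.Re z * complex.Im w + complex.Im z * complex.Re w.
Proof. by case: z; case: w. Qed.

Lemma ReD z w : complex.Re (z + w) = complex.Re z + complex.Re w.
Proof. by case: z; case: w. Qed.

Lemma ImD z w : complex.Im (z + w) = complex.Im z + complex.Im w.
Proof. by case: z; case: w. Qed.

Lemma complex_eq z w : complex.Re z = complex.Re w -> complex.Im z = complex.Im w -> z = w.
Proof. by case: z; case: w => ? ? ? ? /= -> ->. Qed.

Lemma normc_sqr z : normc z ^+ 2 = complex.Re z ^+ 2 + complex.Im z ^+ 2.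
Proof. by case: z => x y /=; rewrite sqr_sqrtr// addr_ge0// sqr_ge0. Qed.

Lemma normc_nneg z : 0 <= normc z.
Proof. by case: z => x y; exact: sqrtr_ge0. Qed.

Lemma norm_Re_le z : `|complex.Re z| <= normc z.
Proof.
by rewrite -(@ler_pXn2r _ 2)// ?nnegrE ?normc_nneg// normc_sqr real_normK ?num_real// lerDl sqr_ge0.
Qed.

Lemma norm_Im_le z : `|complex.Im z| <= normc z.
Proof.
by rewrite -(@ler_pXn2r _ 2)// ?nnegrE ?normc_nneg// normc_sqr real_normK ?num_real// lerDr sqr_ge0.
Qed.

Lemma normc_le z : normc z <= `|complex.Re z| + `|complex.Im z|.
Proof.
rewrite -(@ler_pXn2r _ 2)// ?nnegrE ?normc_nneg ?addr_ge0// normc_sqr sqrrD.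
by rewrite !real_normK ?num_real// lerD2r lerDl mulrn_wge0// mulr_ge0.
Qed.

Lemma measurable_normc d (T : measurableType d) (F : T -> R[i]) :
  measurable_fun setT (@complex.Re R \o F) -> measurable_fun setT (@complex.Im R \o F) ->
  measurable_fun setT (fun x => normc (F x)).
Proof.
move=> mr mi.
have ms : measurable_fun setT (@Num.sqrt R).
  by apply: continuous_measurable_fun; exact: sqrt_continuous.
rewrite (_ : (fun x => _) = @Num.sqrt R \o
  (fun x => (@complex.Re R \o F) x ^+ 2 + (@complex.Im R \o F) x ^+ 2)).
  by apply: measurableT_comp => //; apply: measurable_funD; exact: measurable_funX.
by apply/funext => x /=; case: (F x).
Qed.

End complex_norm.

Section distribution_fourier.
Variables (R : realType) (n : nat).
Implicit Types (f g w phi : 'rV[R]_n -> R) (F G : 'rV[R]_n -> R[i]).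

(** Cubes of integer size stand for compact sets, each of which lies in one of them. *)
Definition locint w := forall k : nat, integ (fun x => w x * \1_(cube k%:R) x).

Lemma compact_sub_cube_nat (K : set 'rV[R]_n) : compact K ->
  exists k : nat, K `<=` cube k%:R.
Proof.
move=> /compact_sub_cube[M M0 KM]; exists (Num.truncn M).+1 => x /KM/cubeP xM.
by apply/cubeP => i; apply: lt_trans (xM i) _; exact: truncnS_gt.
Qed.

Lemma L1loc_locint F : L1loc F ->
  locint (@complex.Re R \o F) /\ locint (@complex.Im R \o F).
Proof.
move=> [mr mi FK].
have mn := measurable_normc mr mi.
have mc k : measurable (cube k%:R : set 'rV[R]_n) by exact: measurable_obox.
have in1 (k : nat) : integ (fun x => normc (F x) * \1_(cube k%:R) x).
  apply: integ_lty.
  - by apply: measurable_funM => //; exact: measurable_indic.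
  - by move=> x; rewrite mulr_ge0 ?normc_nneg.
  - apply: le_lt_trans (FK _ (@compact_cbox R n (const_mx (- k%:R)) (const_mx k%:R))).
    rewrite [leRHS]integral_mkcond; apply: ge0_le_integral => //.
    + by move=> x _; rewrite lee_fin mulr_ge0 ?normc_nneg.
    + by apply/measurable_EFinP; apply: measurable_funM => //; exact: measurable_indic.
    + apply/(measurable_restrictT _ (compact_measurable_rV (@compact_cbox R n _ _))).
      by apply: measurable_funTS; exact/measurable_EFinP.
    + move=> x _; rewrite patchE; case: ifPn => [_|].
        by rewrite lee_fin ler_piMr ?normc_nneg// indicE lern1 leq_b1.
      rewrite notin_setE => nx; rewrite lee_fin indicE memNset ?mulr0// => /= h.
      by apply: nx => i; have /andP[/ltW -> /ltW ->] := h i.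
split => k.
- apply: (@integ_le _ _ _ _ _ (fun x => normc (F x) * \1_(cube k%:R) x)) => //.
    by apply: measurable_funM => //; exact: measurable_indic.
  by move=> x; rewrite normrM (ger0_norm (_ : 0 <= \1__ x))// ler_wpM2r//; exact: norm_Re_le.
- apply: (@integ_le _ _ _ _ _ (fun x => normc (F x) * \1_(cube k%:R) x)) => //.
    by apply: measurable_funM => //; exact: measurable_indic.
  by move=> x; rewrite normrM (ger0_norm (_ : 0 <= \1__ x))// ler_wpM2r//; exact: norm_Im_le.
Qed.

Lemma locint_L1loc F : measurable_fun setT (@complex.Re R \o F) ->
  measurable_fun setT (@complex.Im R \o F) ->
  locint (@complex.Re R \o F) -> locint (@complex.Im R \o F) -> L1loc F.
Proof.
move=> mr mi lr li; split => // K cK; have [k Kk] := compact_sub_cube_nat cK.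
have := integD (integ_abs (lr k)) (integ_abs (li k)) => /integrableP[_].
apply: le_lt_trans; rewrite [leLHS]integral_mkcond; apply: ge0_le_integral => //.
- by move=> x _; rewrite patchE; case: ifPn => // _; rewrite lee_fin; exact: normc_nneg.
- apply/(measurable_restrictT _ (compact_measurable_rV cK)).
  by apply: measurable_funTS; apply/measurable_EFinP; exact: measurable_normc.
- have mc : measurable_fun setT (\1_(cube k%:R) : 'rV[R]_n -> R).
    by apply: measurable_indic; exact: measurable_obox.
  apply: measurableT_comp => //; apply/measurable_EFinP.
  by apply: measurable_funD; apply: measurableT_comp => //; exact: measurable_funM.
- move=> x _; rewrite patchE; case: ifPn => [|_]; last exact: abse_ge0.
  rewrite inE => /Kk kx; rewrite /= lee_fin indicE mem_set// !mulr1.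
  exact: le_trans (normc_le _) (ler_norm _).
Qed.

Lemma locint_test w phi : measurable_fun setT w -> locint w -> test_fun setT phi ->
  integ (fun x => w x * phi x).
Proof.
move=> mw lw tp; have [M [B [_ _ p0 _ [pB _]]]] := test_fun_bounds tp.
have := integ_mulb (lw (Num.truncn M).+1) (measurable_test tp) pB.
congr (integ _); apply/funext => x; rewrite indicE.
have [xc|/negP xc] := boolP (x \in cube (Num.truncn M).+1%:R); first by rewrite mulr1.
rewrite mulr0 mul0r p0 ?mulr0//; left => /cubeP xM; apply: xc.
by rewrite inE; apply/cubeP => i; apply: lt_trans (xM i) _; exact: truncnS_gt.
Qed.

Lemma test_fun0 : test_fun setT (cst 0 : 'rV[R]_n -> R).
Proof.
split; last by exists set0; split => //; exact: compact0.
have E s : partials s (cst 0 : 'rV[R]_n -> R) = cst 0.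
  elim: s => //= i s ->; apply/funext => x; exact: derive_cst.
by move=> s x; rewrite E; exact: differentiable_cst.
Qed.

(** Real test functions separate the real part of [F] from its imaginary part, which reduces the
    claim to real functions that are integrable on every cube. *)
Lemma is_fourier_unique T F G : is_fourier T F -> is_fourier T G ->
  {ae leb, forall x, F x = G x}.
Proof.
move=> [LF hF] [LG hG].
have [mrF miF _] := LF; have [mrG miG _] := LG.
have [lrF liF] := L1loc_locint LF; have [lrG liG] := L1loc_locint LG.
have ae0 (f g : 'rV[R]_n -> R) : measurable_fun setT f -> measurable_fun setT g ->
    locint f -> locint g ->
    (forall phi, test_fun setT phi -> \int[leb]_x (f x * phi x) = \int[leb]_x (g x * phi x)) ->
    {ae leb, forall x, f x = g x}.
  move=> mf mg lf lg fg.
  have DU' : [set: 'rV[R]_n] `<=` \bigcup_k obox (const_mx (- k%:R)) (const_mx k%:R).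
    by rewrite -[X in X `<=` _]bigcup_cube.
  have h := test_fun_ae0 (w := fun x => f x - g x) (fun k => @subsetT _ _) DU'.
  have h1 : {ae leb, forall x : 'rV[R]_n, setT x -> f x - g x = 0}.
    apply: h => [k|phi tp].
      have := integB (lf k) (lg k); congr (integ _).
      by apply/funext => x; rewrite mulrBl.
    under eq_Rintegral do rewrite mulrBl.
    rewrite RintB; [|exact: locint_test|exact: locint_test].
    by rewrite fg// subrr.
  by apply: filterS h1 => x /(_ Logic.I) /eqP; rewrite subr_eq0 => /eqP.
have hFG phi : test_fun setT phi ->
    cint (fun x => F x * (phi x)%:C%C) = cint (fun x => G x * (phi x)%:C%C).
  move=> tp.
  have t0 : test_fun setT (@complex.Im R \o (fun x => (phi x)%:C%C)) by exact: test_fun0.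
  by rewrite -hF// -hG.
have reE H phi : \int[leb]_x complex.Re (H x * (phi x)%:C%C) =
    \int[leb]_x ((@complex.Re R \o H) x * phi x).
  by apply: eq_Rintegral => x _; rewrite ReM /= mulr0 subr0.
have imE H phi : \int[leb]_x complex.Im (H x * (phi x)%:C%C) =
    \int[leb]_x ((@complex.Im R \o H) x * phi x).
  by apply: eq_Rintegral => x _; rewrite ImM /= mulr0 add0r.
have hr : {ae leb, forall x, (@complex.Re R \o F) x = (@complex.Re R \o G) x}.
  by apply: ae0 => // phi /hFG/(congr1 (@complex.Re R)) /=; rewrite !reE.
have hi : {ae leb, forall x, (@complex.Im R \o F) x = (@complex.Im R \o G) x}.
  by apply: ae0 => // phi /hFG/(congr1 (@complex.Im R)) /=; rewrite !imE.
by apply: filterS2 hr hi => x; exact: complex_eq.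
Qed.

End distribution_fourier.

Section regular_distributions.
Variables (R : realType) (n : nat).
Local Notation mu := (@lebesgue_measure R).
Implicit Types (f : 'rV[R]_n -> R) (phi psi : 'rV[R]_n -> R[i]).

Lemma Re_fourier phi xi : integ (@complex.Re R \o phi) -> integ (@complex.Im R \o phi) ->
  complex.Re (fourier phi xi) = cosT (@complex.Re R \o phi) xi + sinT (@complex.Im R \o phi) xi.
Proof.
move=> ri ii; rewrite /= -RintD; [|exact: integ_cosT|exact: integ_sinT].
apply: eq_Rintegral => x _; rewrite ReM /= -/(phase x xi) cosN sinN; ring.
Qed.

Lemma Im_fourier phi xi : integ (@complex.Re R \o phi) -> integ (@complex.Im R \o phi) ->
  complex.Im (fourier phi xi) = cosT (@complex.Im R \o phi) xi - sinT (@complex.Re R \o phi) xi.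
Proof.
move=> ri ii; rewrite /= -RintB; [|exact: integ_cosT|exact: integ_sinT].
apply: eq_Rintegral => x _; rewrite ImM /= -/(phase x xi) cosN sinN; ring.
Qed.

Lemma regular_distrE f phi : regular_distr f phi =
  ((\int[leb]_x (f x * complex.Re (phi x))) +i* (\int[leb]_x (f x * complex.Im (phi x))))%C.
Proof.
apply: complex_eq => /=; apply: eq_Rintegral => x _; rewrite ?ReM ?ImM /=; ring.
Qed.

Lemma integ_test_fun D (phi : 'rV[R]_n -> R) : test_fun D phi -> integ phi.
Proof.
move=> tp; have [M [B [_ _ p0 _ [pB _]]]] := test_fun_bounds tp.
by apply: (integ_supp_cube (M := M) (B := B)) (measurable_test tp) _ pB => x cx; apply: p0; left.
Qed.

(** The minus sign before [S] is that of the exponent in [fourier]. The hypothesis is applied to the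
    real and to the imaginary part of the complex test function. *)
Lemma is_fourier_regular f (C S : 'rV[R]_n -> R) : sqint leb f ->
  measurable_fun setT C -> measurable_fun setT S -> locint C -> locint S ->
  (forall psi : 'rV[R]_n -> R, test_fun setT psi ->
    \int[leb]_x (f x * cosT psi x) = \int[leb]_x (C x * psi x) /\
    \int[leb]_x (f x * sinT psi x) = \int[leb]_x (S x * psi x)) ->
  is_fourier (regular_distr f) (fun x => (C x +i* - S x)%C).
Proof.
move=> f2 mC mS lC lS hCS; split.
  apply: locint_L1loc => //=; first exact: measurableT_comp.
  by move=> k; have := integN (lS k); under eq_fun do rewrite -mulNr.
move=> phi t1 t2; rewrite /fourier_distr regular_distrE.
set p1 := _ \o phi in t1; set p2 := _ \o phi in t2.
have i1 := integ_test_fun t1; have i2 := integ_test_fun t2.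
have [c1 s1 _] := plancherel_le i1 (sqint_test t1).
have [c2 s2 _] := plancherel_le i2 (sqint_test t2).
have [h1 h1'] := hCS _ t1; have [h2 h2'] := hCS _ t2.
apply: complex_eq.
- transitivity (\int[leb]_x (f x * cosT p1 x + f x * sinT p2 x)).
    by apply: eq_Rintegral => x _; rewrite -mulrDr -Re_fourier.
  rewrite RintD; [|exact: sqint_mul|exact: sqint_mul].
  rewrite h1 h2' -RintD; [|exact: locint_test|exact: locint_test].
  by apply: eq_Rintegral => x _; rewrite ReM /= mulNr opprK.
- transitivity (\int[leb]_x (f x * cosT p2 x - f x * sinT p1 x)).
    by apply: eq_Rintegral => x _; rewrite -mulrBr -Im_fourier.
  rewrite RintB; [|exact: sqint_mul|exact: sqint_mul].
  rewrite h2 h1' -RintB; [|exact: locint_test|exact: locint_test].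
  by apply: eq_Rintegral => x _; rewrite ImM /= mulNr.
Qed.

(** An integrable majorant of Schwartz functions up to a constant; the product form reduces its
    integral to arctangent integrals on the line. *)
Definition decay (x : 'rV[R]_n) : R := \prod_i (oneDsqr (x 0 i))^-1.

Lemma decay_ge0 x : 0 <= decay x.
Proof. by apply: prodr_ge0 => i _; rewrite invr_ge0 oneDsqr_nneg. Qed.

Lemma measurable_oneDsqrV : measurable_fun setT (fun t : R => (oneDsqr t)^-1).
Proof. by apply: continuous_measurable_fun; exact: continuous_oneDsqrV. Qed.

Lemma measurable_decay : measurable_fun setT decay.
Proof.
apply: measurable_prod => i _.
exact: (measurableT_comp measurable_oneDsqrV (@measurable_coord R n i)).
Qed.

Lemma integ_decay : integ decay.
Proof.
apply: integ_lty; [exact: measurable_decay|exact: decay_ge0|].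
rewrite (integral_leb_prod (k := fun _ t => (oneDsqr t)^-1) (c := fun=> pi)) ?ltry//.
- by move=> i; exact: measurable_oneDsqrV.
- by move=> _; exact: integral_oneDsqrV.
Qed.

Lemma decay_le1 x : decay x <= 1.
Proof.
by apply: prodr_ile1 => i _; rewrite invr_ge0 oneDsqr_nneg/= invf_le1 ?oneDsqr_gt0.
Qed.

Lemma sqint_decay : sqint leb decay.
Proof.
split; first exact: measurable_decay.
apply: integ_le integ_decay; first by apply: measurable_funX; exact: measurable_decay.
move=> x; rewrite ger0_norm ?sqr_ge0// expr2.
by rewrite ler_piMr ?decay_ge0 ?decay_le1.
Qed.

(** Order [2 * n] because each of the [n] factors [oneDsqr (x 0 i)] is at most
    [(1 + enorm x) ^+ 2]. *)
Lemma schwartz_decay phi x : schwartz phi ->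
  normc (phi x) <= schwartz_norm (2 * n) phi * decay x.
Proof.
move=> [_ _ /(_ (2 * n)%N) ub].
have h : (1 + enorm x) ^+ (2 * n) * normc (phi x) <= schwartz_norm (2 * n) phi.
  apply: sup_upper_bound; first last.
    by exists [::], x; split => //=; case: (phi x).
  by split => //; exists ((1 + enorm x) ^+ (2 * n) * normc (phi x)), [::], x; split => //=; case: (phi x).
have e0 : 0 <= enorm x by exact: sqrtr_ge0.
have p0 : 0 < \prod_i oneDsqr (x 0 i) by apply: prodr_gt0 => i _; by rewrite ltr_wpDr ?sqr_ge0.
rewrite /decay prodfV ler_pdivlMr// mulrC; apply: le_trans h.
apply: ler_wpM2r; first exact: normc_nneg.
rewrite exprM -[X in _ ^+ X](card_ord n) -prodr_const.
apply: ler_prod => i _; rewrite oneDsqr_nneg/=.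
have xe : x 0 i ^+ 2 <= enorm x ^+ 2.
  rewrite sqr_sqrtr; last by apply: sumr_ge0 => j _; rewrite -expr2 sqr_ge0.
  by rewrite /dotp (bigD1 i)//= -expr2 lerDl sumr_ge0// => j _; rewrite -expr2 sqr_ge0.
rewrite /oneDsqr sqrrD expr1n mul1r -addrA lerD2l; apply: le_trans xe _.
by rewrite lerDr mulrn_wge0.
Qed.

Lemma schwartz_sqint phi : schwartz phi ->
  sqint leb (@complex.Re R \o phi) /\ sqint leb (@complex.Im R \o phi).
Proof.
move=> sp; have [s1 s2 _] := sp.
have sd := sqintZ (schwartz_norm (2 * n) phi) sqint_decay.
split.
- apply: sqint_le sd; first exact: continuous_measurable_rV (smooth_continuous s1).
  move=> x; rewrite (le_trans (norm_Re_le _))// (le_trans (schwartz_decay x sp))//.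
  exact: ler_norm.
- apply: sqint_le sd; first exact: continuous_measurable_rV (smooth_continuous s2).
  move=> x; rewrite (le_trans (norm_Im_le _))// (le_trans (schwartz_decay x sp))//.
  exact: ler_norm.
Qed.

Lemma tempered_regular f : sqint leb f -> tempered (regular_distr f).
Proof.
move=> f2; split.
  move=> a phi psi /schwartz_sqint[p1 p2] /schwartz_sqint[q1 q2].
  have i1 := sqint_mul f2 p1; have i2 := sqint_mul f2 p2.
  have j1 := sqint_mul f2 q1; have j2 := sqint_mul f2 q2.
  rewrite !regular_distrE; apply: complex_eq.
  - rewrite ReD ReM /= -!RintZ// -RintB; [|exact: integZ|exact: integZ].
    rewrite -RintD//; last by apply: integB; exact: integZ.
    by apply: eq_Rintegral => x _; rewrite ReD ReM; ring.
  - rewrite ImD ImM /= -!RintZ// -RintD; [|exact: integZ|exact: integZ].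
    rewrite -RintD//; last by apply: integD; exact: integZ.
    by apply: eq_Rintegral => x _; rewrite ImD ImM; ring.
pose I := \int[leb]_x (`|f x| * decay x).
have fa2 : sqint leb (fun x => `|f x|).
  have [mf _] := f2; apply: (sqint_le (g := f)) => //; first exact: measurableT_comp.
  by move=> x; rewrite normr_id.
have di := sqint_mul fa2 sqint_decay.
(* The factor 2 accounts for the real and the imaginary part, each bounded by [I] times the
   seminorm. *)
exists (2 * n)%N, (2 * I) => phi sp; have [p1 p2] := schwartz_sqint sp.
have le (p : 'rV[R]_n -> R) : sqint leb p -> (forall x, `|p x| <= normc (phi x)) ->
    `|\int[leb]_x (f x * p x)| <= schwartz_norm (2 * n) phi * I.
  move=> sqp pn; have fp := sqint_mul f2 sqp.
  apply: le_trans (Rint_norm fp) _; rewrite -RintZ//.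
  apply: Rint_le; [exact: integ_abs|exact: integZ|move=> x].
  rewrite normrM mulrCA ler_wpM2l//.
  exact: le_trans (pn x) (schwartz_decay x sp).
rewrite regular_distrE; apply: le_trans (normc_le _) _ => /=.
rewrite mulrAC -mulrA mulr_natl mulr2n; apply: lerD.
  by apply: le => // x; exact: norm_Re_le.
by apply: le => // x; exact: norm_Im_le.
Qed.

Lemma real_valued_regular f : real_valued (regular_distr f).
Proof.
move=> phi _ pr; rewrite regular_distrE /=.
under eq_Rintegral do rewrite pr mulr0.
by rewrite /Rintegral integral0.
Qed.

End regular_distributions.

(** With [A], [B], [C] as set in the proof, the sum of [(A * c i - B * a i) ^+ 2] equals
    [A * (A * C - B ^+ 2)]; if [A = 0], every [a i] vanishes. *)
Lemma sum_cauchy_schwarz (R : realFieldType) (n : nat) (a c : 'I_n -> R) :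
  (\sum_i a i * c i) ^+ 2 <= (\sum_i a i ^+ 2) * \sum_i c i ^+ 2.
Proof.
set B := \sum_i _ * _; set A := \sum_i a i ^+ 2; set C := \sum_i c i ^+ 2.
have A0 : 0 <= A by apply: sumr_ge0 => i _; exact: sqr_ge0.
have C0 : 0 <= C by apply: sumr_ge0 => i _; exact: sqr_ge0.
have [Az|An] := eqVneq A 0.
  have az i : a i = 0.
    apply/eqP; rewrite -sqrf_eq0; apply/eqP.
    by apply: (psumr_eq0P _ Az) => // j _; exact: sqr_ge0.
  rewrite [B]big1 ?expr0n ?mulr_ge0// => i _.
  by rewrite az mul0r.
have : 0 <= \sum_i (A * c i - B * a i) ^+ 2 by apply: sumr_ge0 => i _; exact: sqr_ge0.
have E (x y : R) : \sum_i (x * c i - y * a i) ^+ 2 = x ^+ 2 * C - 2 * x * y * B + y ^+ 2 * A.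
  by rewrite !mulr_sumr -sumrB -big_split /=; apply: eq_bigr => i _; ring.
rewrite E (_ : _ + _ = A * (A * C - B ^+ 2)); last by ring.
by rewrite pmulr_rge0 ?lt0r ?An// subr_ge0.
Qed.

(** * Estimates for the homogeneous norm *)

Section homogeneous_norm.
Variables (R : realType) (d : nat).
Implicit Types (T : ('rV[R]_d -> R[i]) -> R[i]) (F : 'rV[R]_d -> R[i]) (xi : 'rV[R]_d).

(** With the convention [0^-1 = 0] the weight is the real power [-1] of [dotp xi xi] at the origin
    too, and real powers are measurable. *)
Lemma measurable_enormV2 : measurable_fun setT (fun xi => enorm xi ^- 2).
Proof.
have E (xi : 'rV[R]_d) : enorm xi ^- 2 = (dotp xi xi) `^ (-1).
  have h : 0 <= dotp xi xi by apply: sumr_ge0 => i _; rewrite -expr2 sqr_ge0.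
  by rewrite powR_inv1// sqr_sqrtr.
under eq_fun do rewrite E.
have md : measurable_fun setT (fun xi => dotp xi xi) by exact: measurable_dotp.
exact: (measurableT_comp (measurable_powR (-1)) md).
Qed.

(** [fourier_fun] is a chosen transform; by uniqueness it agrees almost everywhere with [F], so the
    pointwise bound on [F] can be integrated. *)
Lemma Hdotm1_norm_le T F (G : 'rV[R]_d -> R) : is_fourier T F -> integ G ->
  (forall xi, enorm xi ^- 2 * normc (F xi) ^+ 2 <= G xi) ->
  (Hdotm1_norm T <= (Num.sqrt (\int[leb]_xi G xi))%:E)%E.
Proof.
move=> hF iG FG.
have hT : is_fourier T (fourier_fun T) by apply: (xgetPex (cst 0)); exists F.
have G0 xi : 0 <= G xi.
  by apply: le_trans (FG xi); rewrite mulr_ge0 ?exprn_ge0 ?invr_ge0 ?exprn_ge0 ?sqrtr_ge0 ?normc_nneg.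
rewrite -powR12_sqrt ?Rint_ge0// -poweR_EFin EFin_Rint//.
have w0 xi : 0 <= enorm xi ^- 2 * normc (fourier_fun T xi) ^+ 2.
  by rewrite mulr_ge0 ?exprn_ge0 ?invr_ge0 ?exprn_ge0 ?sqrtr_ge0 ?normc_nneg.
apply: gt0_ler_poweR; first by rewrite invr_ge0.
- by rewrite in_itv /= leey andbT integral_ge0// => x _; rewrite lee_fin.
- by rewrite in_itv /= leey andbT integral_ge0// => x _; rewrite lee_fin.
apply: ae_ge0_le_integral => //.
- by move=> x _; rewrite lee_fin.
- apply/measurable_EFinP; apply: measurable_funM; first exact: measurable_enormV2.
  by apply: measurable_funX; have [[mr mi _] _] := hT; exact: measurable_normc.
- by move=> x _; rewrite lee_fin.
- by apply/measurable_EFinP; exact: integ_measurable iG.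
- by apply: filterS (is_fourier_unique hT hF) => x E _; rewrite lee_fin E.
Qed.

(** The coordinate is bounded on each cube, though not on the whole space; hence the local
    statement. *)
Lemma locint_coord (T : 'rV[R]_d -> R) j : sqint leb T ->
  locint (fun xi => 2 * pi * xi 0 j * T xi).
Proof.
move=> T2 k; have mT := T2.1.
have mc : measurable_fun setT (\1_(cube k%:R) : 'rV[R]_d -> R).
  by apply: measurable_indic; exact: measurable_obox.
have s : sqint leb (fun xi => 2 * pi * xi 0 j * \1_(cube k%:R) xi).
  have s1 : sqint leb (\1_(cube k%:R) : 'rV[R]_d -> R) by exact: sqint_indic_box.
  have := sqintZ (2 * pi * k%:R) s1; apply: sqint_le.
    apply: measurable_funM => //; apply: measurable_funM => //; exact: measurable_coord.
  move=> x; rewrite !normrM indicE; have [|_] := boolP (x \in _); last by rewrite normr0 !mulr0.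
  rewrite inE => /cubeP/(_ j)/ltW h; rewrite ler_wpM2r// ler_wpM2l//.
  by rewrite (ger0_norm (ler0n _ k)).
have := sqint_mul s T2; congr (integ _); apply/funext => x; ring.
Qed.

Lemma locint_sum (I : Type) (s : seq I) (F : I -> 'rV[R]_d -> R) :
  (forall i, locint (F i)) -> locint (fun x => \sum_(i <- s) F i x).
Proof.
move=> lF k; have := integ_sum s (fun i => lF i k).
by under eq_fun do rewrite -mulr_suml.
Qed.

Lemma test_coord (psi : 'rV[R]_d -> R) j : test_fun setT psi ->
  integ (fun xi => 2 * pi * xi 0 j * psi xi) /\
  sqint leb (fun xi => 2 * pi * xi 0 j * psi xi).
Proof.
move=> tp; have [M [B [M0 B0 p0 _ [pB _]]]] := test_fun_bounds tp.
have mf : measurable_fun setT (fun xi => 2 * pi * xi 0 j * psi xi).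
  apply: measurable_funM; last exact: measurable_test tp.
  by apply: measurable_funM => //; exact: measurable_coord.
have f0 x : ~ cube M x -> 2 * pi * x 0 j * psi x = 0.
  by move=> cx; rewrite p0 ?mulr0//; left.
have fB (x : 'rV[R]_d) : `|2 * pi * x 0 j * psi x| <= `|2 * pi| * M * B.
  have [cx|cx] := pselect (cube M x).
    rewrite normrM ler_pM// normrM ler_wpM2l ?mulr_ge0//.
    by apply: ltW; move/cubeP: cx.
  by rewrite f0// normr0 !mulr_ge0// ltW.
by split; [exact: integ_supp_cube mf f0 fB|exact: sqint_supp_cube mf f0 fB].
Qed.

Lemma enorm_sqr n (x : 'rV[R]_n) : enorm x ^+ 2 = \sum_i x 0 i ^+ 2.
Proof.
rewrite sqr_sqrtr; first by apply: eq_bigr => i _; rewrite expr2.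
by apply: sumr_ge0 => i _; rewrite -expr2 sqr_ge0.
Qed.

(* If |xi| = 0 the left-hand side vanishes, by the convention 0^-1 = 0. *)
Lemma enorm_weight_le (C S : 'I_d -> R) xi :
  enorm xi ^- 2 * normc ((- \sum_j 2 * pi * xi 0 j * S j) +i*
      - \sum_j 2 * pi * xi 0 j * C j)%C ^+ 2 <=
  (2 * pi) ^+ 2 * \sum_j (C j ^+ 2 + S j ^+ 2).
Proof.
have cs (A : 'I_d -> R) : (\sum_j 2 * pi * xi 0 j * A j) ^+ 2 <=
    enorm xi ^+ 2 * ((2 * pi) ^+ 2 * \sum_j A j ^+ 2).
  under eq_bigr do rewrite -(mulrA (2 * pi)).
  by rewrite -mulr_sumr exprMn [leRHS]mulrCA ler_wpM2l ?sqr_ge0// enorm_sqr sum_cauchy_schwarz.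
have S0 : 0 <= \sum_j (C j ^+ 2 + S j ^+ 2).
  by apply: sumr_ge0 => j _; rewrite addr_ge0// sqr_ge0.
have [->|xn] := eqVneq (enorm xi) 0.
  by rewrite expr0n/= invr0 mul0r mulr_ge0// sqr_ge0.
rewrite normc_sqr [complex.Re _]/= [complex.Im _]/= !sqrrN mulrC ler_pdivrMr; last by rewrite exprn_even_gt0.
apply: le_trans (lerD (cs S) (cs C)) _.
by rewrite big_split [leRHS]mulrC addrC -!mulrDr.
Qed.

End homogeneous_norm.

(** * The trace, the divergence and their transform for the given field *)

Section slab_identity.
Variables (R : realType) (d : nat) (b : R).
Hypothesis b0 : 0 < b.
Local Notation mu := (@lebesgue_measure R).
Local Notation S := (strip b : set 'rV[R]_d.+1).
Variable u : 'rV[R]_d.+1 -> 'rV[R]_d.+1.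
Implicit Types xi : 'rV[R]_d.
Hypothesis hu : H1_0 b u.

Let comp i : 'rV[R]_d.+1 -> R := fun x => u x 0 i.
Let dcomp i := weak_partial S i (comp i).

Lemma sqint_comp i : sqint leb (comp i \_ S).
Proof. by apply/(L2_sqint _ (@measurable_strip R d b)); case: (hu i) => -[]. Qed.

Lemma sqint_dcomp i : sqint leb (dcomp i \_ S).
Proof.
by apply/(L2_sqint _ (@measurable_strip R d b)); case: (hu i) => /(weak_partialP i)[].
Qed.

(** The vertical derivative in the divergence cancels the trace. The exceptional points are those
    where the trace formula fails or where a slice of some derivative is not integrable. *)
Lemma trace_sub_div_avg :
  let f := fun x' : 'rV[R]_d => trace b b (comp ord_max) x' -
    \int[mu]_(t in `]0, b[) weak_div S u (join_pt (x', t)) in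
  measurable_fun setT f /\
  {ae leb, forall x, f x = \sum_j - avg (dcomp (lift ord_max j) \_ S) x}.
Proof.
move=> f.
have o (q : 'rV[R]_d.+1 -> R) := restrict_off_strip0 (b := b) q.
have [hL2 htr] := trace_top b0 (hu ord_max).2.
have rg : weak_div S u \_ S = fun x => \sum_i (dcomp i \_ S) x.
  apply/funext => x; rewrite patchE; case: ifPn => xS.
    by apply: eq_bigr => i _; rewrite patchE xS.
  by rewrite big1// => i _; rewrite patchE (negbTE xS).
have fE x : f x = trace b b (comp ord_max) x - avg (weak_div S u \_ S) x.
  by rewrite /f avg_restrict.
have mg : measurable_fun setT (weak_div S u \_ S).
  by rewrite rg; apply: measurable_sum => i; case: (sqint_dcomp i).
split.
  rewrite (_ : f = fun x => trace b b (comp ord_max) x - avg (weak_div S u \_ S) x); last exact/funext.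
  by apply: measurable_funB; [case: hL2|exact: measurable_avg].
have ha : {ae leb, forall x : 'rV[R]_d, forall i : 'I_d.+1,
    mu.-integrable setT (EFin \o (fun t => (dcomp i \_ S) (join_pt (x, t))))}.
  by have hi i := ae_integ_slice (o (dcomp i)) (sqint_dcomp i); exact: filter_forall hi.
apply: filterS2 htr ha => x h1 h2.
rewrite fE h1 rg {2}/avg Rint_sum// sum_lift_max opprD.
by rewrite addrC sumrN -addrA addNr addr0.
Qed.

(** Dropping the vertical component makes this an inequality; only the horizontal ones are
    averaged. *)
Lemma sqint_enorm : sqint leb ((fun x => enorm (u x)) \_ S) /\
  \sum_j nsq leb (comp (lift ord_max j) \_ S) <= nsq leb ((fun x => enorm (u x)) \_ S).
Proof.
have E x : ((fun x => enorm (u x)) \_ S) x ^+ 2 = \sum_i (comp i \_ S) x ^+ 2.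
  rewrite patchE; case: ifPn => xS.
    by rewrite enorm_sqr; apply: eq_bigr => i _; rewrite patchE xS.
  by rewrite expr0n big1// => i _; rewrite patchE (negbTE xS) expr0n.
have ii : integ (fun x => \sum_i (comp i \_ S) x ^+ 2).
  by apply: integ_sum => i; case: (sqint_comp i).
split.
  split; last by under eq_fun do rewrite E.
  rewrite (_ : _ \_ _ = @Num.sqrt R \o (fun x => \sum_i (comp i \_ S) x ^+ 2)).
    apply: measurableT_comp; last exact: integ_measurable ii.
    by apply: continuous_measurable_fun; exact: sqrt_continuous.
  apply/funext => x /=; rewrite -E sqrtr_sqr ger0_norm// patchE.
  by case: ifPn => // _; exact: sqrtr_ge0.
rewrite {2}/nsq; under [leRHS]eq_Rintegral do rewrite E.
rewrite Rint_sum => [|i]; last by case: (sqint_comp i).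
by rewrite sum_lift_max lerDl nsq_ge0.
Qed.

(** The transform is the sum over [j] of $-2\pi i\,\xi_j(C_j - iT_j)$, whose real part involves the
    [T j] and whose imaginary part the [C j]. *)
Lemma fourier_trace_sub_div (f : 'rV[R]_d -> R) : measurable_fun setT f ->
  {ae leb, forall x, f x = \sum_j - avg (dcomp (lift ord_max j) \_ S) x} ->
  sqint leb f /\ exists C T : 'I_d -> 'rV[R]_d -> R,
  [/\ forall j, sqint leb (C j), forall j, sqint leb (T j),
      forall j, nsq leb (C j) + nsq leb (T j) <= b * nsq leb (comp (lift ord_max j) \_ S) &
      is_fourier (regular_distr f) (fun xi => (- \sum_j 2 * pi * xi 0 j * T j xi) +i*
        - \sum_j 2 * pi * xi 0 j * C j xi)%C].
Proof.
move=> mf fE.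
have o (q : 'rV[R]_d.+1 -> R) := restrict_off_strip0 (b := b) q.
have aU j := sqint_avg b0 (o (comp (lift ord_max j))) (sqint_comp (lift ord_max j)).
have aV j := (sqint_avg b0 (o (dcomp (lift ord_max j))) (sqint_dcomp (lift ord_max j))).1.
have sV : sqint leb (fun x => \sum_j - avg (dcomp (lift ord_max j) \_ S) x).
  by apply: sqint_sum => j; exact: sqintN.
have sf : sqint leb f.
  split => //; apply: integ_ae sV.2 _; first exact: measurable_funX.
  by apply: filterS fE => x ->.
split => //.
have /choice[C /choice[T hCT]] j := fourier_L2 (aU j).1.
exists C, T; split.
- by move=> j; have [] := hCT j.
- by move=> j; have [] := hCT j.
- by move=> j; have [_ _ h _] := hCT j; exact: le_trans h (aU j).2.
have sC j : sqint leb (C j) by have [] := hCT j.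
have sT j : sqint leb (T j) by have [] := hCT j.
have mc (A : 'I_d -> 'rV[R]_d -> R) : (forall j, sqint leb (A j)) ->
    measurable_fun setT (fun xi => \sum_j 2 * pi * xi 0 j * A j xi).
  move=> sA; apply: measurable_sum => j; have [mA _] := sA j.
  by apply: measurable_funM => //; apply: measurable_funM => //; exact: measurable_coord.
have lc (A : 'I_d -> 'rV[R]_d -> R) : (forall j, sqint leb (A j)) ->
    locint (fun xi => \sum_j 2 * pi * xi 0 j * A j xi).
  by move=> sA; apply: locint_sum => j; exact: locint_coord.
apply: (is_fourier_regular (C := fun xi => - \sum_j 2 * pi * xi 0 j * T j xi)) => //.
- by apply: measurableT_comp => //; exact: mc.
- exact: mc.
- by move=> k; have := integN (lc _ sT k); under eq_fun do rewrite -mulNr.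
- exact: lc.
move=> psi tp.
have i1 := integ_test_fun tp; have s1 := sqint_test tp.
have [c2 s2 _] := plancherel_le i1 s1.
have hV j := avg_weak_partial_fourier b0 (hu (lift ord_max j)).2
  (let: And4 _ _ _ h := hCT j in h) i1 s1 (test_coord j tp).1 (test_coord j tp).2.
(* The identity for [f] holds almost everywhere, which suffices once it is integrated against
   [g]. *)
have fint (g : 'rV[R]_d -> R) : sqint leb g -> \int[leb]_x (f x * g x) =
    \sum_j - \int[leb]_x (avg (dcomp (lift ord_max j) \_ S) x * g x).
  move=> sg.
  transitivity (\int[leb]_x ((\sum_j - avg (dcomp (lift ord_max j) \_ S) x) * g x)).
    apply: Rint_ae.
    - by apply: measurable_funM => //; case: sg.
    - by apply: measurable_funM; [case: sV|case: sg].
    - by apply: filterS fE => x ->.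
  under eq_Rintegral do rewrite mulr_suml.
  rewrite Rint_sum => [|j]; last by apply: sqint_mul => //; exact: sqintN.
  apply: eq_bigr => j _; rewrite -RintN; last exact: sqint_mul.
  by apply: eq_Rintegral => x _; rewrite mulNr.
have lt (A : 'I_d -> 'rV[R]_d -> R) : (forall j, sqint leb (A j)) ->
    \int[leb]_x ((\sum_j 2 * pi * x 0 j * A j x) * psi x) =
    \sum_j \int[leb]_x (A j x * (2 * pi * x 0 j * psi x)).
  move=> sA; rewrite -Rint_sum => [|j]; last by apply: sqint_mul => //; case: (test_coord j tp).
  apply: eq_Rintegral => x _; rewrite mulr_suml; apply: eq_bigr => j _; ring.
split.
- rewrite fint//; under [RHS]eq_Rintegral do rewrite mulNr.
  rewrite RintN; last by apply: locint_test => //; [exact: mc|exact: lc].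
  by rewrite lt// -sumrN; apply: eq_bigr => j _; rewrite (hV j).1.
- by rewrite fint// lt//; apply: eq_bigr => j _; rewrite (hV j).2 opprK.
Qed.

End slab_identity.

Theorem theorem3p1 (R : realType) (d : nat) (hn : (2 <= d.+1)%N) (b : R)
    (hb : 0 < b) (u : 'rV[R]_d.+1 -> 'rV[R]_d.+1) (hu : H1_0 b u) :
  let g := weak_div (strip b) u in
  let h := trace b b (fun x => u x 0 ord_max) in
  let f := fun x' : 'rV[R]_d =>
    h x' - \int[lebesgue_measure]_(t in `]0, b[) g (join_pt (x', t)) in
  Hdotm1 (regular_distr f) /\
  (Hdotm1_norm (regular_distr f) <=
     (2 * pi * Num.sqrt b)%:E * L2norm (strip b) (fun x => enorm (u x)))%E.
Proof.
move=> g h f; have [mf fE] := trace_sub_div_avg hb hu.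
have [sf [C [T [sC sT CT hF]]]] := fourier_trace_sub_div hb hu mf fE.
have [su nu] := sqint_enorm hu.
pose G (xi : 'rV[R]_d) := (2 * pi) ^+ 2 * \sum_j (C j xi ^+ 2 + T j xi ^+ 2).
have iCT j : integ (fun xi => C j xi ^+ 2 + T j xi ^+ 2).
  by apply: integD; [case: (sC j)|case: (sT j)].
have iG : integ G by apply: integZ; exact: integ_sum.
have le1 := Hdotm1_norm_le hF iG (fun xi => enorm_weight_le (C^~ xi) (T^~ xi) xi).
(* [CT] already combines Plancherel's inequality with the factor [b] of the vertical Cauchy-Schwarz;
   summing over [j] leaves the horizontal part of the norm of [u]. *)
have le2 : \int[leb]_xi G xi <= (2 * pi) ^+ 2 * (b * nsq leb ((fun x => enorm (u x)) \_ (strip b))).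
  rewrite RintZ; last exact: integ_sum.
  rewrite ler_wpM2l ?sqr_ge0// Rint_sum//; apply: le_trans (ler_wpM2l (ltW hb) nu).
  rewrite mulr_sumr; apply: ler_sum => j _; apply: le_trans (CT j).
  by rewrite RintD//; [case: (sC j)|case: (sT j)].
have le3 : (Hdotm1_norm (regular_distr f) <=
    (2 * pi * Num.sqrt b)%:E * L2norm (strip b) (fun x => enorm (u x)))%E.
  apply: le_trans le1 _; rewrite L2norm_sqint// -EFinM lee_fin.
  apply: le_trans (ler_wsqrtr le2) _.
  rewrite sqrtrM ?sqr_ge0// sqrtr_sqr ger0_norm ?mulr_ge0 ?pi_ge0//.
  by rewrite (sqrtrM _ (ltW hb)) mulrA.
split => //; split.
- exact: tempered_regular.
- exact: real_valued_regular.
- by eexists; exact: hF.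
- by apply: le_lt_trans le3 _; rewrite L2norm_sqint// -EFinM ltry.
Qed.
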